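(* Let $G=\mathrm{GL}_2$ and assume that $C$ is a special nilpotent extension of $\overline C$ (of arbitrary length), where $\overline C$ is a smooth proper curve over a finite field. Then for any pair of simple divisors $c$ and $c'$ on $C$ one has $h_ch_{c'}=h_{c'}h_c$ in $\mathcal H_{G,C}$.
   Context: A nilpotent extension $C$ of $\overline C$ is a scheme of finite type whose associated reduced scheme is $\overline C$; $\mathcal N\subset\mathcal O_C$ is the nilradical. It is special (of length $n\ge 1$) if $\mathcal N^n=0$ and $\mathcal N^i/\mathcal N^{i+1}$ is a line bundle on $\overline C$ for $i=1,\dots,n-1$. For a closed point $p$, $\mathcal O_p$ is the completed local ring of $C$ at $p$, $F_p$ is its total ring of fractions; $\mathbb A$ is the restricted product of the $F_p$ with respect to the $\mathcal O_p$, and $\mathcal O=\prod_p\mathcal O_p$. $\mathcal H_{G,C}$ is the algebra (under convolution) of compactly supported $G(\mathcal O)$-biinvariant measures on $G(\mathbb A)$. A simple divisor is an effective Cartier divisor $c\subset C$ such that the scheme-theoretic intersection $\overline c=c\cap\overline C$ is a reduced point of $\overline C$. For a simple divisor $c$, $f_c$ is the idele given by a local generator of the ideal of $c$ at the place $\overline c$ and equal to $1$ at all other places. $h_c\in\mathcal H_{G,C}$ is the characteristic measure of the double coset $G(\mathcal O)\begin{pmatrix} f_c^{-1}&0\\0&1\end{pmatrix}G(\mathcal O)$, i.e. the unique $G(\mathcal O)$-biinvariant measure of total mass $1$ supported on it. *)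

(* Defs.v *)
From HB Require Import structures.
From mathcomp Require Import all_boot all_order all_algebra ring.
From mathcomp Require Import all_classical all_reals all_analysis.
(* The notations of mpoly clash with those of MathComp-Analysis. *)
From mathcomp Require Import -(notations) mpoly.
Set Implicit Arguments.
Unset Strict Implicit.
Unset Printing Implicit Defensive.
Import Order.TTheory GRing.Theory Num.Theory.
Local Open Scope classical_set_scope.
Local Open Scope ring_scope.
Local Obligation Tactic := idtac.

(* Rings are [comPzRingType]s: the zero ring is allowed, since it is the
   ring of sections over the empty open set. *)

Section Ideals.
Variable A : comPzRingType.
Implicit Types (I J S : set A) (a b : A).

Definition ideal_gen S : set A :=
  [set x | exists2 l : seq (A * A),
     (forall p, p \in l -> S p.2) & x = \sum_(p <- l) p.1 * p.2].

Definition ideal_mul I J : set A :=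
  ideal_gen [set x | exists2 a, I a & exists2 b, J b & x = a * b].

Fixpoint ideal_pow I (n : nat) : set A :=
  if n is m.+1 then ideal_mul I (ideal_pow I m) else setT.

Definition is_ideal I : Prop :=
  [/\ I 0, forall a b, I a -> I b -> I (a + b) & forall a b, I b -> I (a * b)].

Definition prime_ideal I : Prop :=
  [/\ is_ideal I, ~ I 1 & forall a b, I (a * b) -> I a \/ I b].

Definition is_unit a : Prop := exists b, a * b = 1.

(* the maximal ideal, when [A] is local *)
Definition nonunits : set A := [set a | ~ is_unit a].

Definition nonzerodivisor a : Prop := forall b, b * a = 0 -> b = 0.

Definition nilrad : set A := [set a | exists m, a ^+ m = 0].

Lemma ideal_gen_ideal S : is_ideal (ideal_gen S).
Proof.
split.
- by exists [::] => //; rewrite big_nil.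
- move=> a b [l hl ->] [l' hl' ->]; exists (l ++ l'); last by rewrite big_cat.
  by move=> p; rewrite mem_cat => /orP[/hl|/hl'].
- move=> a b [l hl ->]; exists [seq (a * p.1, p.2) | p <- l].
    by move=> p /mapP[q /hl ? ->].
  by rewrite big_map mulr_sumr; apply: eq_bigr => p _; rewrite mulrA.
Qed.

Lemma ideal_pow_ideal I n : is_ideal (ideal_pow I n).
Proof. by case: n => [|n]; [split|exact: ideal_gen_ideal]. Qed.

Lemma ideal_powS I n : ideal_pow I n.+1 `<=` ideal_pow I n.
Proof.
move=> _ [l hl ->]; have [h0 hD hM] := ideal_pow_ideal I n.
elim: l hl => [|p l IHl] hl; first by rewrite big_nil.
rewrite big_cons; apply: (hD); last first.
  by apply: IHl => q ql; apply: hl; rewrite inE ql orbT.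
apply: (hM); have [a _ [b hb ->]] := hl p (mem_head _ _); exact: (hM).
Qed.

Lemma idealN I a : is_ideal I -> I a -> I (- a).
Proof. by move=> [_ _ hM] /(hM (-1)); rewrite mulN1r. Qed.

Lemma idealB I a b : is_ideal I -> I a -> I b -> I (a - b).
Proof. by move=> hI Ia Ib; have [_ hD _] := hI; apply: hD => //; apply: idealN. Qed.

End Ideals.

(* [phi] exhibits its target as the localization of its source at the
   powers of [f]. *)
Definition localization_away (A B : comPzRingType) (f : A)
    (phi : {rmorphism A -> B}) : Prop :=
  [/\ is_unit (phi f),
      forall b, exists n a, phi f ^+ n * b = phi a &
      forall a, phi a = 0 -> exists n, f ^+ n * a = 0].

(* A ring presented as the quotient of a type with operations by a
   congruence modulo which the ring axioms hold. *)
Record setoidRing := SetoidRing {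
  sr_sort :> Type;
  sr_eq : sr_sort -> sr_sort -> Prop;
  sr_zero : sr_sort;
  sr_one : sr_sort;
  sr_opp : sr_sort -> sr_sort;
  sr_add : sr_sort -> sr_sort -> sr_sort;
  sr_mul : sr_sort -> sr_sort -> sr_sort;
  sr_refl : forall x, sr_eq x x;
  sr_sym : forall x y, sr_eq x y -> sr_eq y x;
  sr_trans : forall x y z, sr_eq x y -> sr_eq y z -> sr_eq x z;
  sr_eqN : forall x x', sr_eq x x' -> sr_eq (sr_opp x) (sr_opp x');
  sr_eqD : forall x x' y y', sr_eq x x' -> sr_eq y y' ->
    sr_eq (sr_add x y) (sr_add x' y');
  sr_eqM : forall x x' y y', sr_eq x x' -> sr_eq y y' ->
    sr_eq (sr_mul x y) (sr_mul x' y');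
  sr_addA : forall x y z,
    sr_eq (sr_add x (sr_add y z)) (sr_add (sr_add x y) z);
  sr_addC : forall x y, sr_eq (sr_add x y) (sr_add y x);
  sr_add0 : forall x, sr_eq (sr_add sr_zero x) x;
  sr_addN : forall x, sr_eq (sr_add (sr_opp x) x) sr_zero;
  sr_mulA : forall x y z,
    sr_eq (sr_mul x (sr_mul y z)) (sr_mul (sr_mul x y) z);
  sr_mulC : forall x y, sr_eq (sr_mul x y) (sr_mul y x);
  sr_mul1 : forall x, sr_eq (sr_mul sr_one x) x;
  sr_mulD : forall x y z, sr_eq (sr_mul (sr_add x y) z)
    (sr_add (sr_mul x z) (sr_mul y z)) }.

Definition quotRing (S : setoidRing) : Type :=
  {c : set S | exists x, c = [set y | sr_eq x y]}.

Section QuotRing.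
Variable S : setoidRing.
Implicit Types (x y : S) (u v w : quotRing S).

Definition qpi x : quotRing S := exist _ [set y | sr_eq x y] (ex_intro _ x erefl).

Fact qrepr_subproof u : {x | qpi x = u}.
Proof.
case: u => c hc; have [x e] := cid hc.
by exists x; apply: eq_exist; rewrite e.
Qed.

Definition qrepr u : S := sval (qrepr_subproof u).

Lemma qreprK u : qpi (qrepr u) = u.
Proof. exact: svalP (qrepr_subproof u). Qed.

Lemma qpiP x y : qpi x = qpi y <-> sr_eq x y.
Proof.
split=> [[] /(congr1 (fun c : set S => c y)) h|h].
  have : sr_eq y y by exact: sr_refl.
  by rewrite /= in h; rewrite -h.
apply: eq_exist; apply/seteqP; split=> z /= hz.
  exact: sr_trans (sr_sym h) hz.
exact: sr_trans h hz.
Qed.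

Lemma qreprP x : sr_eq (qrepr (qpi x)) x.
Proof. by apply/qpiP; rewrite qreprK. Qed.

Definition qadd u v := qpi (sr_add (qrepr u) (qrepr v)).
Definition qmul u v := qpi (sr_mul (qrepr u) (qrepr v)).
Definition qopp u := qpi (sr_opp (qrepr u)).

Lemma qpiD x y : qpi (sr_add x y) = qadd (qpi x) (qpi y).
Proof. by apply/qpiP/sr_sym/sr_eqD; exact: qreprP. Qed.
Lemma qpiM x y : qpi (sr_mul x y) = qmul (qpi x) (qpi y).
Proof. by apply/qpiP/sr_sym/sr_eqM; exact: qreprP. Qed.
Lemma qpiN x : qpi (sr_opp x) = qopp (qpi x).
Proof. by apply/qpiP/sr_sym/sr_eqN; exact: qreprP. Qed.

Let qE := (qpiD, qpiM, qpiN).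

Fact qaddA : associative qadd.
Proof.
move=> u v w; rewrite -(qreprK u) -(qreprK v) -(qreprK w) -!qE.
by apply/qpiP/sr_addA.
Qed.
Fact qaddC : commutative qadd.
Proof.
by move=> u v; rewrite -(qreprK u) -(qreprK v) -!qE; apply/qpiP/sr_addC.
Qed.
Fact qadd0 : left_id (qpi (sr_zero S)) qadd.
Proof. by move=> u; rewrite -(qreprK u) -!qE; apply/qpiP/sr_add0. Qed.
Fact qaddN : left_inverse (qpi (sr_zero S)) qopp qadd.
Proof. by move=> u; rewrite -(qreprK u) -!qE; apply/qpiP/sr_addN. Qed.
Fact qmulA : associative qmul.
Proof.
move=> u v w; rewrite -(qreprK u) -(qreprK v) -(qreprK w) -!qE.
by apply/qpiP/sr_mulA.
Qed.
Fact qmulC : commutative qmul.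
Proof.
by move=> u v; rewrite -(qreprK u) -(qreprK v) -!qE; apply/qpiP/sr_mulC.
Qed.
Fact qmul1 : left_id (qpi (sr_one S)) qmul.
Proof. by move=> u; rewrite -(qreprK u) -!qE; apply/qpiP/sr_mul1. Qed.
Fact qmulD : left_distributive qmul qadd.
Proof.
move=> u v w; rewrite -(qreprK u) -(qreprK v) -(qreprK w) -!qE.
by apply/qpiP/sr_mulD.
Qed.

HB.instance Definition _ := gen_eqMixin (quotRing S).
HB.instance Definition _ := gen_choiceMixin (quotRing S).
HB.instance Definition _ :=
  GRing.isZmodule.Build (quotRing S) qaddA qaddC qadd0 qaddN.
HB.instance Definition _ :=
  GRing.Zmodule_isComPzRing.Build (quotRing S) qmulA qmulC qmul1 qmulD.

End QuotRing.

Section TotalFractions.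
Variable A : comPzRingType.

Record fraction := Fraction {
  fr_num : A; fr_den : A; fr_nzd : nonzerodivisor fr_den }.

Lemma nonzerodivisor1 : nonzerodivisor (1 : A).
Proof. by move=> b; rewrite mulr1. Qed.

Lemma nonzerodivisorM (a b : A) :
  nonzerodivisor a -> nonzerodivisor b -> nonzerodivisor (a * b).
Proof. by move=> ha hb c; rewrite mulrA => /hb/ha. Qed.

Lemma nonzerodivisorI (a b c : A) : nonzerodivisor c -> a * c = b * c -> a = b.
Proof. by move=> hc /eqP; rewrite -subr_eq0 -mulrBl => /eqP/hc/subr0_eq. Qed.

Definition fr_eq (x y : fraction) : Prop :=
  fr_num x * fr_den y = fr_num y * fr_den x.
Definition fr_zero := Fraction 0 nonzerodivisor1.
Definition fr_one := Fraction 1 nonzerodivisor1.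
Definition fr_opp (x : fraction) := Fraction (- fr_num x) (@fr_nzd x).
Definition fr_add (x y : fraction) :=
  Fraction (fr_num x * fr_den y + fr_num y * fr_den x)
           (nonzerodivisorM (@fr_nzd x) (@fr_nzd y)).
Definition fr_mul (x y : fraction) :=
  Fraction (fr_num x * fr_num y) (nonzerodivisorM (@fr_nzd x) (@fr_nzd y)).

Program Definition fraction_data : setoidRing :=
  @SetoidRing fraction fr_eq fr_zero fr_one fr_opp fr_add fr_mul
   _ _ _ _ _ _ _ _ _ _ _ _ _ _.
Next Obligation. by []. Qed.
Next Obligation. by move=> x y; rewrite /fr_eq => ->. Qed.
Next Obligation.
move=> [a s hs] [b t ht] [c u hu]; rewrite /fr_eq /= => h1 h2.
by apply: (nonzerodivisorI ht); rewrite mulrAC h1 mulrAC h2 mulrAC.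
Qed.
Next Obligation.
by move=> [a s hs] [b t ht]; rewrite /fr_eq /= => h; rewrite !mulNr h.
Qed.
Next Obligation.
move=> [a s hs] [a' s' hs'] [b t ht] [b' t' ht']; rewrite /fr_eq /= => h1 h2.
transitivity (a * s' * (t * t') + b * t' * (s * s')); first by ring.
by rewrite h1 h2; ring.
Qed.
Next Obligation.
move=> [a s hs] [a' s' hs'] [b t ht] [b' t' ht']; rewrite /fr_eq /= => h1 h2.
by rewrite mulrACA h1 h2 mulrACA.
Qed.
Next Obligation. by move=> [a s hs] [b t ht] [c u hu]; rewrite /fr_eq /=; ring. Qed.
Next Obligation. by move=> [a s hs] [b t ht]; rewrite /fr_eq /=; ring. Qed.
Next Obligation. by move=> [a s hs]; rewrite /fr_eq /=; ring. Qed.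
Next Obligation. by move=> [a s hs]; rewrite /fr_eq /=; ring. Qed.
Next Obligation. by move=> [a s hs] [b t ht] [c u hu]; rewrite /fr_eq /=; ring. Qed.
Next Obligation. by move=> [a s hs] [b t ht]; rewrite /fr_eq /=; ring. Qed.
Next Obligation. by move=> [a s hs]; rewrite /fr_eq /=; ring. Qed.
Next Obligation. by move=> [a s hs] [b t ht] [c u hu]; rewrite /fr_eq /=; ring. Qed.

Definition total_fractions : comPzRingType := quotRing fraction_data.

Definition to_frac (a : A) : total_fractions :=
  qpi (S := fraction_data) (Fraction a nonzerodivisor1).

Lemma to_fracN a : to_frac (- a) = - to_frac a.
Proof.
rewrite /to_frac -[RHS](@qpiN fraction_data).
by apply/qpiP; rewrite /= /fr_eq /=.
Qed.
Lemma to_fracD a b : to_frac (a + b) = to_frac a + to_frac b.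
Proof.
rewrite /to_frac -[RHS](@qpiD fraction_data).
by apply/qpiP; rewrite /= /fr_eq /= !mulr1.
Qed.
Lemma to_fracM a b : to_frac (a * b) = to_frac a * to_frac b.
Proof.
rewrite /to_frac -[RHS](@qpiM fraction_data).
by apply/qpiP; rewrite /= /fr_eq /= !mulr1.
Qed.

End TotalFractions.

Section AdicCompletion.
Variables (A : comPzRingType) (I : set A).

(* An element of lim A/I^k, as a coherent sequence of representatives. *)
Record coherent := Coherent {
  coh_seq :> nat -> A;
  coh_seqP : forall k, ideal_pow I k (coh_seq k.+1 - coh_seq k) }.

Let powD k a b : ideal_pow I k a -> ideal_pow I k b -> ideal_pow I k (a + b).
Proof. by have [_ h _] := ideal_pow_ideal I k; exact: h. Qed.
Let powM k a b : ideal_pow I k b -> ideal_pow I k (a * b).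
Proof. by have [_ _ h] := ideal_pow_ideal I k; exact: h. Qed.
Let powN k a : ideal_pow I k a -> ideal_pow I k (- a).
Proof. by apply: idealN; exact: ideal_pow_ideal. Qed.
Let pow0 k : ideal_pow I k 0.
Proof. by have [h _ _] := ideal_pow_ideal I k. Qed.
Let powMB k a a' b b' : ideal_pow I k (a - a') -> ideal_pow I k (b - b') ->
  ideal_pow I k (a * b - a' * b').
Proof.
move=> h h'; have -> : a * b - a' * b' = b * (a - a') + a' * (b - b').
  by rewrite !mulrBr addrA (mulrC b a) (mulrC b a') subrK.
by apply: powD; exact: powM.
Qed.
Let powDB k a a' b b' : ideal_pow I k (a - a') -> ideal_pow I k (b - b') ->
  ideal_pow I k (a + b - (a' + b')).
Proof. by move=> h h'; rewrite opprD addrACA; exact: powD. Qed.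
Let powNB k a a' : ideal_pow I k (a - a') -> ideal_pow I k (- a - - a').
Proof. by move=> h; rewrite -opprD; exact: powN. Qed.
Let powK k a b : a = b -> ideal_pow I k (a - b).
Proof. by move=> ->; rewrite subrr. Qed.

Definition coh_const a : coherent :=
  @Coherent (fun=> a) (fun k => powK k (erefl a)).
Definition coh_add (x y : coherent) : coherent :=
  @Coherent (fun k => x k + y k) (fun k => powDB (coh_seqP x k) (coh_seqP y k)).
Definition coh_mul (x y : coherent) : coherent :=
  @Coherent (fun k => x k * y k) (fun k => powMB (coh_seqP x k) (coh_seqP y k)).
Definition coh_opp (x : coherent) : coherent :=
  @Coherent (fun k => - x k) (fun k => powNB (coh_seqP x k)).
Definition coh_eq (x y : coherent) : Prop :=
  forall k, ideal_pow I k (x k - y k).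

Program Definition coherent_data : setoidRing :=
  @SetoidRing coherent coh_eq (coh_const 0) (coh_const 1) coh_opp coh_add coh_mul
   _ _ _ _ _ _ _ _ _ _ _ _ _ _.
Next Obligation. by move=> x k; exact: powK. Qed.
Next Obligation. by move=> x y h k; rewrite -opprB; exact: powN. Qed.
Next Obligation.
move=> x y z h h' k; rewrite -(subrK (y k) (x k)) -addrA; exact: powD.
Qed.
Next Obligation. by move=> x y h k; exact: powNB. Qed.
Next Obligation. by move=> x x' y y' h h' k; exact: powDB. Qed.
Next Obligation. by move=> x x' y y' h h' k; exact: powMB. Qed.
Next Obligation. by move=> x y z k; apply: powK; rewrite /= addrA. Qed.
Next Obligation. by move=> x y k; apply: powK; rewrite /= addrC. Qed.
Next Obligation. by move=> x k; apply: powK; rewrite /= add0r. Qed.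
Next Obligation. by move=> x k; apply: powK; rewrite /= addNr. Qed.
Next Obligation. by move=> x y z k; apply: powK; rewrite /= mulrA. Qed.
Next Obligation. by move=> x y k; apply: powK; rewrite /= mulrC. Qed.
Next Obligation. by move=> x k; apply: powK; rewrite /= mul1r. Qed.
Next Obligation. by move=> x y z k; apply: powK; rewrite /= mulrDl. Qed.

Definition adic_completion : comPzRingType := quotRing coherent_data.

Definition to_completion (a : A) : adic_completion :=
  qpi (S := coherent_data) (coh_const a).

(* the kernel of the projection to A/I^k: a basis of neighbourhoods of 0 *)
Definition completion_ker (k : nat) : set adic_completion :=
  [set x | ideal_pow I k (coh_seq (qrepr (S := coherent_data) x) k)].

Lemma completion_ker_le (j k : nat) :
  (j <= k)%N -> completion_ker k `<=` completion_ker j.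
Proof.
move=> /subnK <-; elim: (k - j)%N => [//|m IHm] x hx; apply: IHm.
rewrite /completion_ker /= in hx *.
have h := coh_seqP (qrepr (S := coherent_data) x) (m + j).
have := idealB (ideal_pow_ideal I _) (ideal_powS hx) h.
by rewrite opprB addrC subrK.
Qed.

End AdicCompletion.

Record opens (X : topologicalType) := Opens {
  pts :> set X;
  pts_open : open pts }.

Definition opens_full (X : topologicalType) : opens X := Opens (@openT X).
Definition opens_cap (X : topologicalType) (U V : opens X) : opens X :=
  Opens (openI (pts_open U) (pts_open V)).

Lemma opens_capl (X : topologicalType) (U V : opens X) :
  pts (opens_cap U V) `<=` pts U.
Proof. by move=> x []. Qed.
Lemma opens_capr (X : topologicalType) (U V : opens X) :
  pts (opens_cap U V) `<=` pts V.
Proof. by move=> x []. Qed.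

Record ringedSpace := RingedSpace {
  rs_top :> topologicalType;
  sect : opens rs_top -> comPzRingType;
  res : forall U V : opens rs_top, pts V `<=` pts U -> {rmorphism sect U -> sect V};
  res_id : forall (U : opens rs_top) (h : pts U `<=` pts U) (s : sect U), res h s = s;
  res_comp : forall (U V W : opens rs_top) (hVU : pts V `<=` pts U)
    (hWV : pts W `<=` pts V) (hWU : pts W `<=` pts U) (s : sect U),
    res hWV (res hVU s) = res hWU s;
  sect_separated : forall (U : opens rs_top) (J : Type) (V : J -> opens rs_top)
    (hV : forall j, pts (V j) `<=` pts U),
    pts U `<=` \bigcup_j pts (V j) -> forall s t : sect U,
    (forall j, res (hV j) s = res (hV j) t) -> s = t;
  sect_glue : forall (U : opens rs_top) (J : Type) (V : J -> opens rs_top)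
    (hV : forall j, pts (V j) `<=` pts U),
    pts U `<=` \bigcup_j pts (V j) -> forall s : (forall j, sect (V j)),
    (forall i j (W : opens rs_top) (hi : pts W `<=` pts (V i))
       (hj : pts W `<=` pts (V j)), res hi (s i) = res hj (s j)) ->
    exists t : sect U, forall j, res (hV j) t = s j }.

Section RingedSpace.
Variable X : ringedSpace.
Implicit Types (U V W : opens X) (x : X).

(* The open subspace U is isomorphic, as a ringed space, to Spec of A := O(U):
   [psi] is a homeomorphism from U to the set of prime ideals of A with the
   Zariski topology, through which the sheaf takes each D(f) to the localization
   A_f; as the D(f) form a basis, this determines the structure sheaf. *)
Definition affine U : Prop := exists psi : X -> set (sect U),
  [/\ forall x, pts U x -> prime_ideal (psi x),
      forall P, prime_ideal P -> exists! x, pts U x /\ psi x = P,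
      forall B : set X, B `<=` pts U ->
        (open B <-> exists S : set (sect U),
           B = [set x | pts U x /\ exists2 f, S f & ~ psi x f]) &
      forall (f : sect U) (D : opens X) (hD : pts D `<=` pts U),
        pts D = [set x | pts U x /\ ~ psi x f] -> localization_away f (res hD)].

Section Stalk.
Variable x : X.

Record germ := Germ { g_dom : opens X; g_in : pts g_dom x; g_sec : sect g_dom }.

Definition germ_eq (s t : germ) : Prop :=
  exists (W : opens X) (hs : pts W `<=` pts (g_dom s))
         (ht : pts W `<=` pts (g_dom t)),
    pts W x /\ res hs (g_sec s) = res ht (g_sec t).

Definition germ_const (c : forall U, sect U) : germ :=
  @Germ (opens_full X) I (c (opens_full X)).
Definition germ_opp (s : germ) : germ := Germ (g_in s) (- g_sec s).
Definition germ_op2 (op : forall U, sect U -> sect U -> sect U) (s t : germ) : germ :=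
  @Germ (opens_cap (g_dom s) (g_dom t)) (conj (g_in s) (g_in t))
    (op _ (res (@opens_capl _ (g_dom s) (g_dom t)) (g_sec s))
          (res (@opens_capr _ (g_dom s) (g_dom t)) (g_sec t))).
Definition germ_add := germ_op2 (fun U a b => a + b).
Definition germ_mul := germ_op2 (fun U a b => a * b).

Let resT U V W (hVU : pts V `<=` pts U) (hWV : pts W `<=` pts V) (s : sect U) :
  res hWV (res hVU s) = res (subset_trans hWV hVU) s.
Proof. exact: res_comp. Qed.

Let res_val U W (s : sect U) : pts W `<=` pts U ->
  exists a : sect W, forall h : pts W `<=` pts U, res h s = a.
Proof.
by move=> hWU; exists (res hWU s) => h; rewrite (Prop_irrelevance h hWU).
Qed.

Program Definition germ_data : setoidRing :=
  @SetoidRing germ germ_eq (germ_const (fun=> 0)) (germ_const (fun=> 1))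
    germ_opp germ_add germ_mul _ _ _ _ _ _ _ _ _ _ _ _ _ _.
Next Obligation.
move=> s; exists (g_dom s), (@subset_refl _ _), (@subset_refl _ _).
by split=> //; exact: g_in.
Qed.
Next Obligation. by move=> s t [W [h1 [h2 [Wx e]]]]; exists W, h2, h1. Qed.
Next Obligation.
move=> s t u [W [h1 [h2 [Wx e]]]] [W' [h3 [h4 [W'x e']]]].
have hW : pts (opens_cap W W') `<=` pts W by exact: opens_capl.
have hW' : pts (opens_cap W W') `<=` pts W' by exact: opens_capr.
exists (opens_cap W W'), (subset_trans hW h1), (subset_trans hW' h4).
split; first by split.
have [a Ea] := res_val (g_sec t) (subset_trans hW h2).
by rewrite -(resT h1 hW) e resT Ea -(resT h4 hW') -e' resT Ea.
Qed.
Next Obligation.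
move=> s t [W [h1 [h2 [Wx e]]]]; exists W, h1, h2.
by split=> //=; rewrite !rmorphN e.
Qed.
Next Obligation.
move=> s s' t t' [W [h1 [h2 [Wx e]]]] [W' [h3 [h4 [W'x e']]]].
have hW : pts (opens_cap W W') `<=` pts W by exact: opens_capl.
have hW' : pts (opens_cap W W') `<=` pts W' by exact: opens_capr.
have k1 : pts (opens_cap W W') `<=` pts (g_dom (germ_add s t)).
  by move=> z [z1 z2]; exact (conj (h1 z z1) (h3 z z2)).
have k2 : pts (opens_cap W W') `<=` pts (g_dom (germ_add s' t')).
  by move=> z [z1 z2]; exact (conj (h2 z z1) (h4 z z2)).
exists (opens_cap W W'), k1, k2; split=> //=.
have [a Ea] := res_val (g_sec s) (subset_trans hW h1).
have [b Eb] := res_val (g_sec t) (subset_trans hW' h3).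
have [a' Ea'] := res_val (g_sec s') (subset_trans hW h2).
have [b' Eb'] := res_val (g_sec t') (subset_trans hW' h4).
rewrite !rmorphD !resT Ea Eb Ea' Eb'.
move: (congr1 (res hW) e) (congr1 (res hW') e').
by rewrite !resT Ea Ea' Eb Eb' => -> ->.
Qed.
Next Obligation.
move=> s s' t t' [W [h1 [h2 [Wx e]]]] [W' [h3 [h4 [W'x e']]]].
have hW : pts (opens_cap W W') `<=` pts W by exact: opens_capl.
have hW' : pts (opens_cap W W') `<=` pts W' by exact: opens_capr.
have k1 : pts (opens_cap W W') `<=` pts (g_dom (germ_mul s t)).
  by move=> z [z1 z2]; exact (conj (h1 z z1) (h3 z z2)).
have k2 : pts (opens_cap W W') `<=` pts (g_dom (germ_mul s' t')).
  by move=> z [z1 z2]; exact (conj (h2 z z1) (h4 z z2)).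
exists (opens_cap W W'), k1, k2; split=> //=.
have [a Ea] := res_val (g_sec s) (subset_trans hW h1).
have [b Eb] := res_val (g_sec t) (subset_trans hW' h3).
have [a' Ea'] := res_val (g_sec s') (subset_trans hW h2).
have [b' Eb'] := res_val (g_sec t') (subset_trans hW' h4).
rewrite !rmorphM !resT Ea Eb Ea' Eb'.
move: (congr1 (res hW) e) (congr1 (res hW') e').
by rewrite !resT Ea Ea' Eb Eb' => -> ->.
Qed.
Next Obligation.
move=> s t u; pose W := g_dom (germ_add s (germ_add t u)).
have h : pts W `<=` pts (g_dom (germ_add (germ_add s t) u)) by move=> z [? []].
exists W, (@subset_refl _ _), h; split; first exact: g_in.
have [|a Ea] := @res_val _ W (g_sec s); first by move=> z [].
have [|b Eb] := @res_val _ W (g_sec t); first by move=> z [? []].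
have [|c Ec] := @res_val _ W (g_sec u); first by move=> z [? []].
by rewrite /= !(rmorphD, resT) !(Ea, Eb, Ec) addrA.
Qed.
Next Obligation.
move=> s t; pose W := g_dom (germ_add s t).
have h : pts W `<=` pts (g_dom (germ_add t s)) by move=> z [].
exists W, (@subset_refl _ _), h; split; first exact: g_in.
have [|a Ea] := @res_val _ W (g_sec s); first by move=> z [].
have [|b Eb] := @res_val _ W (g_sec t); first by move=> z [].
by rewrite /= !(rmorphD, resT) !(Ea, Eb) addrC.
Qed.
Next Obligation.
move=> s; pose W := g_dom s.
have h : pts W `<=` pts (g_dom (germ_add (germ_const (fun=> 0)) s)) by [].
exists W, h, (@subset_refl _ _); split; first exact: g_in.
have [|a Ea] := @res_val _ W (g_sec s); first by [].
by rewrite /= !(rmorphD, rmorph0, resT) !Ea add0r.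
Qed.
Next Obligation.
move=> s; pose W := g_dom s.
have h : pts W `<=` pts (g_dom (germ_add (germ_opp s) s)) by [].
have h' : pts W `<=` pts (g_dom (germ_const (fun=> 0))) by [].
exists W, h, h'; split; first exact: g_in.
have [|a Ea] := @res_val _ W (g_sec s); first by [].
by rewrite /= !(rmorphD, rmorph0, rmorphN, resT) !Ea addNr.
Qed.
Next Obligation.
move=> s t u; pose W := g_dom (germ_mul s (germ_mul t u)).
have h : pts W `<=` pts (g_dom (germ_mul (germ_mul s t) u)) by move=> z [? []].
exists W, (@subset_refl _ _), h; split; first exact: g_in.
have [|a Ea] := @res_val _ W (g_sec s); first by move=> z [].
have [|b Eb] := @res_val _ W (g_sec t); first by move=> z [? []].
have [|c Ec] := @res_val _ W (g_sec u); first by move=> z [? []].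
by rewrite /= !(rmorphM, resT) !(Ea, Eb, Ec) mulrA.
Qed.
Next Obligation.
move=> s t; pose W := g_dom (germ_mul s t).
have h : pts W `<=` pts (g_dom (germ_mul t s)) by move=> z [].
exists W, (@subset_refl _ _), h; split; first exact: g_in.
have [|a Ea] := @res_val _ W (g_sec s); first by move=> z [].
have [|b Eb] := @res_val _ W (g_sec t); first by move=> z [].
by rewrite /= !(rmorphM, resT) !(Ea, Eb) mulrC.
Qed.
Next Obligation.
move=> s; pose W := g_dom s.
have h : pts W `<=` pts (g_dom (germ_mul (germ_const (fun=> 1)) s)) by [].
exists W, h, (@subset_refl _ _); split; first exact: g_in.
have [|a Ea] := @res_val _ W (g_sec s); first by [].
by rewrite /= !(rmorphM, rmorph1, resT) !Ea mul1r.
Qed.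
Next Obligation.
move=> s t u; pose W := g_dom (germ_mul (germ_add s t) u).
have h : pts W `<=`
    pts (g_dom (germ_add (germ_mul s u) (germ_mul t u))) by move=> z [[]].
exists W, (@subset_refl _ _), h; split; first exact: g_in.
have [|a Ea] := @res_val _ W (g_sec s); first by move=> z [[]].
have [|b Eb] := @res_val _ W (g_sec t); first by move=> z [[]].
have [|c Ec] := @res_val _ W (g_sec u); first by move=> z [].
by rewrite /= !(rmorphM, rmorphD, resT) !(Ea, Eb, Ec) mulrDl.
Qed.

Definition stalk : comPzRingType := quotRing germ_data.

Definition germ_at U (Ux : pts U x) (s : sect U) : stalk :=
  qpi (S := germ_data) (Germ Ux s).

End Stalk.

End RingedSpace.

Record scheme := Scheme {
  sch_rs :> ringedSpace;
  sch_affine : forall x : sch_rs,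
    exists2 U : opens sch_rs, pts U x & affine U }.

(* For a continuous [f] and a sheaf map f^# : O_Y -> f_* O_X,
   [comor V U : O_Y(V) -> O_X(U)], defined when U is contained in f^-1(V), is
   f^#(V) followed by restriction to U. *)
Record morphism (X Y : scheme) := Morphism {
  mor :> X -> Y;
  mor_cont : continuous mor;
  comor : forall (V : opens Y) (U : opens X),
    pts U `<=` mor @^-1` pts V -> {rmorphism sect V -> sect U};
  comor_res : forall (V V' : opens Y) (U U' : opens X)
    (hV : pts V' `<=` pts V) (hU : pts U' `<=` pts U)
    (h : pts U `<=` mor @^-1` pts V) (h' : pts U' `<=` mor @^-1` pts V')
    (s : sect V), res hU (comor h s) = comor h' (res hV s);
  mor_local : forall (x : X) (V : opens Y) (U : opens X)
    (h : pts U `<=` mor @^-1` pts V) (Vy : pts V (mor x)) (Ux : pts U x)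
    (s : sect V), is_unit (germ_at Ux (comor h s)) -> is_unit (germ_at Vy s) }.

Section Morphisms.

Definition mor_eq (X Y : scheme) (f g : morphism X Y) : Prop :=
  f =1 g /\ forall V U (hf : pts U `<=` f @^-1` pts V)
    (hg : pts U `<=` g @^-1` pts V) (s : sect V), comor hf s = comor hg s.

Program Definition mor_id (X : scheme) : morphism X X :=
  @Morphism X X id _ (fun V U h => @res X V U h) _ _.
Next Obligation. by move=> X x; exact: cvg_id. Qed.
Next Obligation.
move=> X V V' U U' hV hU h h' s /=.
by rewrite (@res_comp X _ _ _ h hU (subset_trans hU h)) (@res_comp X _ _ _ hV h' (subset_trans hU h)).
Qed.
Next Obligation.
move=> X x V U h Vy Ux s; suff -> : germ_at Ux (@res X V U h s) = germ_at Vy s by [].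
apply/qpiP; exists U, (@subset_refl _ _), h; split=> //=.
by rewrite (@res_comp X _ _ _ h _ h).
Qed.

Definition opens_preim (X Y : scheme) (f : morphism X Y) (V : opens Y) : opens X :=
  Opens ((continuousP (mor f)).1 (@mor_cont _ _ f) _ (pts_open V)).

Program Definition mor_comp (X Y Z : scheme) (g : morphism Y Z) (f : morphism X Y) :
    morphism X Z :=
  @Morphism X Z (g \o f) _
    (fun V U h => GRing.RMorphism.clone _ _
       (@comor _ _ f (opens_preim g V) U h \o
        @comor _ _ g V (opens_preim g V) (@subset_refl _ _)) _) _ _.
Next Obligation.
move=> X Y Z g f x; apply: continuous_comp; exact: mor_cont.
Qed.
Next Obligation.
move=> X Y Z g f V V' U U' hV hU h h' s /=.
have k : pts (opens_preim g V') `<=` pts (opens_preim g V) by move=> y /hV.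
rewrite (comor_res k hU h h'); congr (comor _ _).
exact: comor_res.
Qed.
Next Obligation.
move=> X Y Z g f x V U h Vy Ux s /= /(@mor_local _ _ f x (opens_preim g V) U h Vy).
exact: mor_local.
Qed.

Definition closed_immersion (X Y : scheme) (f : morphism X Y) : Prop :=
  [/\ injective f,
      forall B : set X, closed B -> closed (f @` B) &
      forall (x : X) (a : stalk x), exists V U (h : pts U `<=` f @^-1` pts V)
        (Ux : pts U x) (s : sect V), a = germ_at Ux (comor h s)].

Definition reduced_scheme (X : scheme) : Prop :=
  forall (U : opens X) (s : sect U), nilrad s -> s = 0.

Definition integral_scheme (X : scheme) : Prop :=
  (exists x : X, True) /\
  forall U : opens X, (exists x, pts U x) ->
    (1 : sect U) <> 0 /\ forall s t : sect U, s * t = 0 -> s = 0 \/ t = 0.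

Definition fin_gen_algebra (S : comNzRingType) (A : comPzRingType) (sc : S -> A) :=
  exists n (pi : {rmorphism mpoly n S -> A}),
    (forall c, pi (mpolyC n c) = sc c) /\ forall a, exists p, pi p = a.

Definition finite_type (S : comNzRingType) (X : scheme)
    (sc : forall U : opens X, S -> sect U) : Prop :=
  exists m (U : 'I_m -> opens X),
    [/\ forall j, affine (U j), setT `<=` \bigcup_j pts (U j) &
        forall j, fin_gen_algebra (sc (U j))].

End Morphisms.

Record kscheme (k : fieldType) := KScheme {
  ks_sch :> scheme;
  ks_scal : {rmorphism k -> sect (opens_full ks_sch)} }.

Section OverField.
Variable k : fieldType.
Implicit Types X Y : kscheme k.

Definition scal X (U : opens X) (a : k) : sect U :=
  @res X (opens_full X) U (@subsetT _ (pts U)) (ks_scal X a).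

Definition over_k X Y (f : morphism X Y) : Prop :=
  forall (V : opens Y) (U : opens X) (h : pts U `<=` f @^-1` pts V) a,
    comor h (scal V a) = scal U a.

Definition is_fibre_product X Y (P : kscheme k)
    (p : morphism P X) (q : morphism P Y) : Prop :=
  [/\ over_k p, over_k q &
      forall (T : kscheme k) (f : morphism T X) (g : morphism T Y),
        over_k f -> over_k g ->
        (exists2 u : morphism T P, over_k u &
           mor_eq (mor_comp p u) f /\ mor_eq (mor_comp q u) g) /\
        (forall u v : morphism T P, over_k u -> over_k v ->
           mor_eq (mor_comp p u) f -> mor_eq (mor_comp q u) g ->
           mor_eq (mor_comp p v) f -> mor_eq (mor_comp q v) g -> mor_eq u v)].

Definition separated X : Prop :=
  forall (P : kscheme k) (p q : morphism P X) (d : morphism X P),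
    is_fibre_product p q ->
    mor_eq (mor_comp p d) (mor_id X) -> mor_eq (mor_comp q d) (mor_id X) ->
    closed_immersion d.

Definition universally_closed X : Prop :=
  forall (Y P : kscheme k) (p : morphism P X) (q : morphism P Y),
    is_fibre_product p q -> forall B : set P, closed B -> closed (q @` B).

Definition proper X : Prop :=
  [/\ finite_type (@scal X), separated X & universally_closed X].

(* A = k[x_1, .., x_(n+d)]/(f_1, .., f_n), where the Jacobian determinant of
   the f_i with respect to x_1, .., x_n is invertible in A. *)
Definition standard_smooth (d : nat) (A : comPzRingType) (sc : k -> A) : Prop :=
  exists n (f : 'I_n -> mpoly (n + d) k) (pi : {rmorphism mpoly (n + d) k -> A}),
    [/\ forall c, pi (mpolyC (n + d) c) = sc c,
        forall a, exists p, pi p = a,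
        forall p, pi p = 0 <-> ideal_gen (range f) p &
        is_unit (pi (\det (\matrix_(i < n, j < n) mderiv (lshift d j) (f i))))].

Definition smooth_of_rel_dim (d : nat) X : Prop :=
  forall x : X, exists U : opens X,
    [/\ pts U x, affine U & standard_smooth d (@scal X U)].

(* A curve is an integral separated scheme of finite type and of dimension 1
   over k. Properness subsumes separatedness and finite type, smoothness of
   relative dimension 1 subsumes the dimension. *)
Definition smooth_proper_curve X : Prop :=
  [/\ integral_scheme X, proper X & smooth_of_rel_dim 1 X].

End OverField.

(* [i] identifies Cbar with the reduced scheme associated to C. Finite type is
   understood absolutely, i.e. over Spec Z. *)
Definition nilpotent_extension (Cbar C : scheme) (i : morphism Cbar C) : Prop :=
  [/\ finite_type (fun (U : opens C) (z : int) => z%:~R : sect U),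
      closed_immersion i, (forall y, exists x, i x = y) & reduced_scheme Cbar].

(* The sheaves N^j are quasi-coherent: over an affine open U, N^j is given by
   the j-th power of the nilradical of O(U). The second condition says that
   N^j(U)/N^(j+1)(U) is free of rank one over O(U)/N(U) = O_Cbar(U), on the
   class of [e]. *)
Definition special (C : scheme) (n : nat) : Prop :=
  [/\ (0 < n)%N,
      forall U : opens C, affine U ->
        ideal_pow (@nilrad (sect U)) n `<=` [set 0] &
      forall j, (0 < j < n)%N -> forall x : C, exists U : opens C,
        [/\ pts U x, affine U & exists e : sect U,
          let N := ideal_pow (@nilrad (sect U)) in
          [/\ N j e,
              forall s, N j s -> exists a, N j.+1 (s - a * e) &
              forall a, N j.+1 (a * e) -> nilrad a]]].

(* An effective Cartier divisor, as a sheaf of ideals locally generated by a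
   nonzerodivisor. *)
Record cartierDivisor (X : scheme) := CartierDivisor {
  cd_ideal :> forall U : opens X, set (sect U);
  cd_idealP : forall U, is_ideal (@cd_ideal U);
  cd_res : forall (U V : opens X) (h : pts V `<=` pts U) s,
    cd_ideal s -> cd_ideal (res h s);
  cd_local : forall (U : opens X) (s : sect U),
    (forall x, pts U x -> exists (V : opens X) (h : pts V `<=` pts U),
       pts V x /\ cd_ideal (res h s)) -> cd_ideal s;
  cd_principal : forall x : X, exists (U : opens X) (f : sect U),
    pts U x /\ forall (V : opens X) (h : pts V `<=` pts U),
      nonzerodivisor (res h f) /\
      forall s : sect V, cd_ideal s <-> exists a, s = a * res h f }.

Definition cd_stalk (X : scheme) (c : cartierDivisor X) (x : X) : set (stalk x) :=
  [set a | exists (U : opens X) (Ux : pts U x) (s : sect U),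
     c U s /\ a = germ_at Ux s].
Arguments cd_stalk {X} c x _.

(* the stalk at x of the ideal sheaf of the scheme-theoretic intersection
   of c with the closed subscheme i : Y -> X *)
Definition intersection_stalk (Y X : scheme) (i : morphism Y X)
    (c : cartierDivisor X) (x : Y) : set (stalk x) :=
  ideal_gen [set a | exists (V : opens X) (U : opens Y)
    (h : pts U `<=` i @^-1` pts V) (Ux : pts U x) (s : sect V),
    c V s /\ a = germ_at Ux (comor h s)].
Arguments intersection_stalk {Y X} i c x _.

(* The last three fields say that the scheme-theoretic intersection of c with
   Cbar is the closed point sd_point with its reduced structure. *)
Record simpleDivisor (Cbar C : scheme) (i : morphism Cbar C) := SimpleDivisor {
  sd_div :> cartierDivisor C;
  sd_point : Cbar;
  sd_closed : closed [set sd_point];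
  sd_reduced : intersection_stalk i sd_div sd_point = @nonunits (stalk sd_point);
  sd_support : forall x : Cbar, x <> sd_point ->
    intersection_stalk i sd_div x = setT }.

Section Adeles.
Variable C : scheme.

Definition closedPoint : Type := {p : C | closed [set p]}.
Implicit Type p : closedPoint.

Definition local_ring p : comPzRingType :=
  adic_completion (@nonunits (stalk (sval p))).
Definition local_frac p : comPzRingType := total_fractions (local_ring p).

Definition integral_at p : set (local_frac p) := range (@to_frac (local_ring p)).

Record adele := Adele {
  ad_val :> forall p, local_frac p;
  ad_fin : finite_set [set p | ~ integral_at (ad_val p)] }.

Lemma adele_eq (a b : adele) : (forall p, a p = b p) -> a = b.
Proof.
case: a b => [a ha] [b hb] /= h; have e : a = b by exact: functional_extensionality_dep.
by case: _ / e hb => hb; rewrite (Prop_irrelevance ha hb).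
Qed.

Lemma integral0 p : integral_at (0 : local_frac p). Proof. by exists 0. Qed.
Lemma integral1 p : integral_at (1 : local_frac p). Proof. by exists 1. Qed.
Lemma integralN p (x : local_frac p) : integral_at x -> integral_at (- x).
Proof. by move=> [a _ <-]; exists (- a); [by []|exact: to_fracN]. Qed.
Lemma integralD p (x y : local_frac p) :
  integral_at x -> integral_at y -> integral_at (x + y).
Proof. by move=> [a _ <-] [b _ <-]; exists (a + b); [by []|exact: to_fracD]. Qed.
Lemma integralM p (x y : local_frac p) :
  integral_at x -> integral_at y -> integral_at (x * y).
Proof. by move=> [a _ <-] [b _ <-]; exists (a * b); [by []|exact: to_fracM]. Qed.

Lemma fin_cst (x : forall p, local_frac p) : (forall p, integral_at (x p)) ->
  finite_set [set p | ~ integral_at (x p)].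
Proof.
by move=> h; apply: sub_finite_set (@finite_set0 closedPoint) => p /= /(_ (h p)).
Qed.
Lemma finN (a : adele) : finite_set [set p | ~ integral_at (- a p)].
Proof. by apply: sub_finite_set (ad_fin a) => p /= h /integralN. Qed.
Lemma fin2 (op : forall p, local_frac p -> local_frac p -> local_frac p) :
  (forall p x y, integral_at x -> integral_at y -> integral_at (op p x y)) ->
  forall a b : adele, finite_set [set p | ~ integral_at (op p (a p) (b p))].
Proof.
move=> hop a b; apply: (@sub_finite_set _ _ ([set p | ~ integral_at (a p)] `|`
  [set p | ~ integral_at (b p)])); last by rewrite finite_setU; split; exact: ad_fin.
move=> p /= h; have [ha|ha] := pselect (integral_at (a p)); last by left.
by right => hb; apply: h; exact: hop.
Qed.

Definition ad_zero : adele := Adele (fin_cst integral0).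
Definition ad_one : adele := Adele (fin_cst integral1).
Definition ad_opp (a : adele) : adele := Adele (finN a).
Definition ad_add (a b : adele) : adele := Adele (fin2 integralD a b).
Definition ad_mul (a b : adele) : adele := Adele (fin2 integralM a b).

Fact ad_addA : associative ad_add.
Proof. by move=> a b c; apply: adele_eq => p /=; rewrite addrA. Qed.
Fact ad_addC : commutative ad_add.
Proof. by move=> a b; apply: adele_eq => p /=; rewrite addrC. Qed.
Fact ad_add0 : left_id ad_zero ad_add.
Proof. by move=> a; apply: adele_eq => p /=; rewrite add0r. Qed.
Fact ad_addN : left_inverse ad_zero ad_opp ad_add.
Proof. by move=> a; apply: adele_eq => p /=; rewrite addNr. Qed.
Fact ad_mulA : associative ad_mul.
Proof. by move=> a b c; apply: adele_eq => p /=; rewrite mulrA. Qed.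
Fact ad_mulC : commutative ad_mul.
Proof. by move=> a b; apply: adele_eq => p /=; rewrite mulrC. Qed.
Fact ad_mul1 : left_id ad_one ad_mul.
Proof. by move=> a; apply: adele_eq => p /=; rewrite mul1r. Qed.
Fact ad_mulD : left_distributive ad_mul ad_add.
Proof. by move=> a b c; apply: adele_eq => p /=; rewrite mulrDl. Qed.

HB.instance Definition _ := gen_eqMixin adele.
HB.instance Definition _ := gen_choiceMixin adele.
HB.instance Definition _ := GRing.isZmodule.Build adele ad_addA ad_addC ad_add0 ad_addN.
HB.instance Definition _ :=
  GRing.Zmodule_isComPzRing.Build adele ad_mulA ad_mulC ad_mul1 ad_mulD.

Definition integral_adele : set adele := [set a | forall p, integral_at (a p)].

(* As [k] runs over the finitely supported functions, these are a basis of
   neighbourhoods of 0 for the restricted product topology, each F_p having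
   O_p, with its inverse limit topology, as an open subring. *)
Definition adele_nbhd (k : closedPoint -> nat) : set adele :=
  [set a | forall p, exists2 x, completion_ker (k p) x & a p = to_frac x].

End Adeles.

Record GL2 (A : comPzRingType) := MkGL2 {
  gl_mx :> 'M[A]_2;
  gl_inv_mx : 'M[A]_2;
  gl_mxV : gl_mx *m gl_inv_mx = 1%:M;
  gl_Vmx : gl_inv_mx *m gl_mx = 1%:M }.

Section GL2.
Variable A : comPzRingType.
Implicit Types g h : GL2 A.

Definition gl_one : GL2 A := MkGL2 (mul1mx 1%:M) (mul1mx 1%:M).

Fact gl_mul_subproof g h :
  (g *m h) *m (gl_inv_mx h *m gl_inv_mx g) = 1%:M.
Proof. by rewrite mulmxA -(mulmxA g) gl_mxV mulmx1 gl_mxV. Qed.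
Fact gl_mul_subproof2 g h :
  (gl_inv_mx h *m gl_inv_mx g) *m (g *m h) = 1%:M.
Proof. by rewrite mulmxA -(mulmxA (gl_inv_mx h)) gl_Vmx mulmx1 gl_Vmx. Qed.

Definition gl_mul g h : GL2 A :=
  MkGL2 (gl_mul_subproof g h) (gl_mul_subproof2 g h).

Definition diag2 (a b : A) : 'M[A]_2 :=
  \matrix_(i, j) if i == j then (if i == ord0 then a else b) else 0.

Lemma mul_diag2 (a b a' b' : A) : diag2 a b *m diag2 a' b' = diag2 (a * a') (b * b').
Proof.
apply/matrixP => i j; rewrite !mxE (bigD1 i) //= big1 ?addr0 => [|l /negPf hl].
  by rewrite !mxE eqxx; case: (i == j); case: (i == ord0); rewrite // mulr0.
by rewrite !mxE eq_sym hl mul0r.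
Qed.

Lemma diag2_11 : diag2 1 1 = 1%:M.
Proof. by apply/matrixP => i j; rewrite !mxE; case: (i == j); case: (i == ord0). Qed.

Fact gl_diag_subproof (a b : A) : a * b = 1 -> diag2 a 1 *m diag2 b 1 = 1%:M.
Proof. by move=> h; rewrite mul_diag2 h mulr1 diag2_11. Qed.

End GL2.

Record ringUnit (A : comPzRingType) := RingUnit {
  ru_val :> A; ru_inv : A; ru_valK : ru_val * ru_inv = 1; ru_invK : ru_inv * ru_val = 1 }.

Definition gl_diagV (A : comPzRingType) (f : ringUnit A) : GL2 A :=
  MkGL2 (gl_diag_subproof (ru_invK f)) (gl_diag_subproof (ru_valK f)).

Section GL2Adeles.
Variable C : scheme.

Definition GL2A : Type := GL2 (adele C).

HB.instance Definition _ := gen_eqMixin GL2A.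
HB.instance Definition _ := gen_choiceMixin GL2A.
HB.instance Definition _ := isPointed.Build GL2A (gl_one (adele C)).

(* The topology induced by g |-> (g, g^-1) from M_2(adele) x M_2(adele). *)
Definition gl_open : set (set GL2A) :=
  [set E | forall g, E g -> exists2 k : closedPoint C -> nat,
     finite_set [set p | k p <> 0%N] &
     forall h : GL2A,
       (forall i j, adele_nbhd k (gl_mx h i j - gl_mx g i j) /\
                    adele_nbhd k (gl_inv_mx h i j - gl_inv_mx g i j)) -> E h].

Fact gl_openT : gl_open setT.
Proof.
move=> g _; exists (fun=> 0%N) => //.
by apply: sub_finite_set (@finite_set0 (closedPoint C)) => p /=.
Qed.

Fact gl_openI : setI_closed gl_open.
Proof.
move=> E E' hE hE' g [Eg E'g].
have [k fk hk] := hE g Eg; have [k' fk' hk'] := hE' g E'g.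
exists (fun p => maxn (k p) (k' p)).
  apply: (@sub_finite_set _ _ ([set p | k p <> 0%N] `|` [set p | k' p <> 0%N])).
    move=> p /= h; have [e|] := pselect (k p = 0%N); last by left.
    by right => e'; apply: h; rewrite e e'.
  by rewrite finite_setU.
have le (j j' : closedPoint C -> nat) : (forall p, (j p <= j' p)%N) ->
    adele_nbhd j' `<=` adele_nbhd j.
  by move=> hj a ha p; have [x /(completion_ker_le (hj p)) ? ->] := ha p; exists x.
move=> h hh; split; [apply: hk|apply: hk'] => i j; have [h1 h2] := hh i j.
  by split; [apply: le h1|apply: le h2] => p; exact: leq_maxl.
by split; [apply: le h1|apply: le h2] => p; exact: leq_maxr.
Qed.

Fact gl_open_bigU (J : Type) (E : J -> set GL2A) :
  (forall j, gl_open (E j)) -> gl_open (\bigcup_j E j).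
Proof.
move=> hE g [j _ Eg]; have [k fk hk] := hE j g Eg.
by exists k => // h hh; exists j => //; exact: hk.
Qed.

HB.instance Definition _ :=
  isOpenTopological.Build GL2A gl_openT gl_openI gl_open_bigU.

Definition borelGL2A := g_sigma_algebraType (@open GL2A).

Definition GL2O : set GL2A :=
  [set g | forall i j, integral_adele (gl_mx g i j) /\ integral_adele (gl_inv_mx g i j)].

Definition double_coset (g : GL2A) : set GL2A :=
  [set gl_mul (gl_mul u g) v | u in GL2O & v in GL2O].

Definition idele : Type := ringUnit (adele C).

Section Hecke.
Variable R : realType.
Implicit Types mu nu : {measure set borelGL2A -> \bar R}.

Local Open Scope ereal_scope.

(* The (nonnegative) elements of the Hecke algebra. As usual on a locally
   compact group, measures are Radon measures. *)
Definition hecke_measure mu : Prop :=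
  [/\ mu setT < +oo,
      forall E : set borelGL2A, measurable E -> mu E = ereal_sup
        [set mu K | K in [set K : set borelGL2A |
           [/\ measurable K, compact (K : set GL2A) & K `<=` E]]],
      exists K : set borelGL2A,
        [/\ measurable K, compact (K : set GL2A) & mu (~` K) = 0] &
      forall (u : GL2A) (E : set borelGL2A), GL2O u -> measurable E ->
        mu [set gl_mul u x | x in E] = mu E /\
        mu [set gl_mul x u | x in E] = mu E].

Definition characteristic_measure (g : GL2A) mu : Prop :=
  [/\ hecke_measure mu, mu setT = 1 & mu (~` double_coset g) = 0].

Definition convolution mu nu (E : set borelGL2A) : \bar R :=
  \int[mu]_x nu [set y | E (gl_mul x y)].

End Hecke.
End GL2Adeles.

Section DivisorIdele.
Variables (Cbar C : scheme) (i : morphism Cbar C) (c : simpleDivisor i).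

Definition divisor_idele (f : idele C) : Prop :=
  forall p : closedPoint C,
    (sval p = i (sd_point c) -> exists a : stalk (sval p),
       cd_stalk c (sval p) = [set b * a | b in setT] /\
       ru_val f p = to_frac (to_completion _ a)) /\
    (sval p <> i (sd_point c) -> ru_val f p = 1).

(* [h] is h_c: the double coset does not depend on the choice of a local
   generator, and the measure is unique. *)
Definition divisor_measure (R : realType) (h : {measure set borelGL2A C -> \bar R}) : Prop :=
  exists2 f : idele C, divisor_idele f & characteristic_measure (gl_diagV f) h.

End DivisorIdele.

(* Main.v *)
(* Let [K = GL2(O)], and let [D], [D'] be the double cosets of [d = diag(f^-1, 1)] and
   [d' = diag(f'^-1, 1)]. The measure [h] gives the same mass to the finitely many cosets
   [xK] in [D], and is determined on each of them by the uniqueness of Haar measure on [K].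
   Hence [h h'] gives to [zK] a mass proportional to the number of cosets [xK] in [D] with
   [x^-1 z] in [D'], and commutativity follows from Gelfand's trick with the transposition,
   once [D D'] is known to consist of double cosets stable under transposition. This is a
   local question on the inverses [diag(f', 1) k diag(f, 1)], and only the case where both
   divisors have the same support is not obvious. There, up to row and column operations,
   either the matrix is diagonal, or it is [[0, f], [f', e]] with [e] nilpotent. As [C] is
   special, the maximal ideal is [(f, eps) = (f', eps)] with [eps] nilpotent, so [O / f] is
   a chain ring: either [e] lies in [(f, f')] and can be eliminated, or [f' = u f + t e] with
   [u] a unit, and then explicit operations exchange [f] and [f']. *)
From HB Require Import structures.
Require Import Defs.
From mathcomp Require Import all_boot all_order all_algebra ring.
From mathcomp Require Import all_classical all_reals all_analysis measurable_realfun.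
Set Implicit Arguments.
Unset Strict Implicit.
Unset Printing Implicit Defensive.
Import Order.TTheory GRing.Theory Num.Theory.
Local Open Scope classical_set_scope.
Local Open Scope ring_scope.

(** * Matrices of size two over a local ring *)

(** Continuity of multiplication by an arbitrary adele rests on the Artin-Rees lemma, and the proof
    avoids it. Only the translations by [K], [d], [d'] and the inverses of [d], [d'] are shown
    continuous, from the inclusion of [m^(j+n)] in [f m^j], which follows from [m = (f, eps)] and
    [eps^n = 0]. The function under the integral of a convolution is accordingly evaluated only on
    the cosets that carry the mass, and its measurability elsewhere is left open.

    Uniqueness of Haar measure is obtained by counting: the congruence subgroups are normal of
    finite index in [K], and inner regularity reduces open sets to finite unions of their cosets.

    In the exchange of [f] and [f'], the coefficient [u] must be a unit: otherwise [f] would be a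
    multiple of [eps], hence nilpotent. That a local equation stays a nonzerodivisor in the
    completion is read off the invertibility of the idele. *)

Section GL2Group.
Variable A : comPzRingType.
Implicit Types g h : GL2 A.

Lemma gl_eq g h : gl_mx g = gl_mx h -> g = h.
Proof.
case: g h => [g g' gV Vg] [h h' hV Vh] /= e; move: hV Vh; rewrite -e => gV' Vg'.
have e' : g' = h' by rewrite -[g']mulmx1 -gV' mulmxA Vg mul1mx.
move: gV' Vg'; rewrite -e' => gV' Vg'.
by rewrite (Prop_irrelevance gV gV') (Prop_irrelevance Vg Vg').
Qed.

Definition gl_inv g : GL2 A := MkGL2 (gl_Vmx g) (gl_mxV g).

Lemma gl_mulA g h k : gl_mul g (gl_mul h k) = gl_mul (gl_mul g h) k.
Proof. by apply: gl_eq; rewrite /= mulmxA. Qed.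
Lemma gl_mul1g g : gl_mul (gl_one A) g = g.
Proof. by apply: gl_eq; rewrite /= mul1mx. Qed.
Lemma gl_mulVg g : gl_mul (gl_inv g) g = gl_one A.
Proof. by apply: gl_eq; rewrite /= gl_Vmx. Qed.

Fact gl_tr_subproof g : (gl_mx g)^T *m (gl_inv_mx g)^T = 1%:M.
Proof. by rewrite -trmx_mul gl_Vmx trmx1. Qed.
Fact gl_tr_subproof2 g : (gl_inv_mx g)^T *m (gl_mx g)^T = 1%:M.
Proof. by rewrite -trmx_mul gl_mxV trmx1. Qed.
Definition gl_tr g : GL2 A := MkGL2 (gl_tr_subproof g) (gl_tr_subproof2 g).

Lemma gl_trK g : gl_tr (gl_tr g) = g.
Proof. by apply: gl_eq; rewrite /= trmxK. Qed.
Lemma gl_trM g h : gl_tr (gl_mul g h) = gl_mul (gl_tr h) (gl_tr g).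
Proof. by apply: gl_eq; rewrite /= trmx_mul. Qed.

End GL2Group.

Section Equivalence.
Variable A : comPzRingType.

Definition mx2 (a b c d : A) : 'M[A]_2 :=
  \matrix_(i, j) if i == ord0 then if j == ord0 then a else b
                 else if j == ord0 then c else d.

Lemma mx2E (M : 'M[A]_2) : M = mx2 (M ord0 ord0) (M ord0 ord_max)
  (M ord_max ord0) (M ord_max ord_max).
Proof.
have o (i : 'I_2) : i != ord0 -> i = ord_max.
  by case: i => [[|[|i]] hi] // _; apply/val_inj.
by apply/matrixP => i j; rewrite mxE; case: eqP => [->|/eqP/o->]; case: eqP => [->|/eqP/o->].
Qed.

Lemma mx2M (a b c d a' b' c' d' : A) : mx2 a b c d *m mx2 a' b' c' d' =
  mx2 (a * a' + b * c') (a * b' + b * d') (c * a' + d * c') (c * b' + d * d').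
Proof.
apply/matrixP => i j; rewrite !mxE !big_ord_recr big_ord0 /= add0r !mxE /=.
by case: (i == ord0); case: (j == ord0).
Qed.

Lemma mx2_tr (a b c d : A) : (mx2 a b c d)^T = mx2 a c b d.
Proof. by apply/matrixP => i j; rewrite !mxE; case: eqP; case: eqP. Qed.

Lemma mx2_1 : mx2 1 0 0 1 = 1%:M.
Proof.
rewrite [RHS]mx2E; congr mx2; by rewrite !mxE.
Qed.

Lemma diag2E (a b : A) : diag2 a b = mx2 a 0 0 b.
Proof. by rewrite [LHS]mx2E !mxE. Qed.

Definition mx_equiv (M M' : 'M[A]_2) : Prop :=
  exists P Q : GL2 A, P *m M *m Q = M'.

Lemma mx_equiv_sym M M' : mx_equiv M M' -> mx_equiv M' M.
Proof.
move=> [P [Q <-]]; exists (gl_inv P), (gl_inv Q).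
by rewrite /= !mulmxA gl_Vmx mul1mx -mulmxA gl_mxV mulmx1.
Qed.

Lemma mx_equiv_trans M N M' : mx_equiv M N -> mx_equiv N M' -> mx_equiv M M'.
Proof.
move=> [P [Q <-]] [P' [Q' <-]]; exists (gl_mul P' P), (gl_mul Q Q').
by rewrite /= !mulmxA.
Qed.

Lemma mx_equiv_tr M M' : mx_equiv M M' -> mx_equiv M^T M'^T.
Proof.
by move=> [P [Q <-]]; exists (gl_tr Q), (gl_tr P); rewrite /= !trmx_mul mulmxA.
Qed.

(** [M ~ S = S^T ~ M^T]: it is enough to bring a matrix to a symmetric form, such as a diagonal
    one. *)
Lemma mx_equiv_sym_tr M S : mx_equiv M S -> S^T = S -> mx_equiv M M^T.
Proof.
by move=> h e; apply: (mx_equiv_trans h); rewrite -e; apply/mx_equiv_sym/mx_equiv_tr.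
Qed.

Lemma mx_equiv_row (P P' : 'M[A]_2) M M' : P *m P' = 1%:M -> P' *m P = 1%:M ->
  P *m M = M' -> mx_equiv M M'.
Proof. by move=> h h' <-; exists (MkGL2 h h'), (gl_one A); rewrite mulmx1. Qed.

Lemma mx_equiv_addrow (x a b c d : A) :
  mx_equiv (mx2 a b c d) (mx2 (a + x * c) (b + x * d) c d).
Proof.
apply: (@mx_equiv_row (mx2 1 x 0 1) (mx2 1 (- x) 0 1)).
- by rewrite mx2M -mx2_1; congr mx2; ring.
- by rewrite mx2M -mx2_1; congr mx2; ring.
- by rewrite mx2M; congr mx2; ring.
Qed.

Lemma mx_equiv_scalerow (u v a b c d : A) : u * v = 1 ->
  mx_equiv (mx2 a b c d) (mx2 (u * a) (u * b) c d).
Proof.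
move=> uv; apply: (@mx_equiv_row (mx2 u 0 0 1) (mx2 v 0 0 1)).
- by rewrite mx2M -mx2_1; congr mx2; rewrite ?(mulrC v) ?uv; ring.
- by rewrite mx2M -mx2_1; congr mx2; rewrite ?(mulrC v) ?uv; ring.
- by rewrite mx2M; congr mx2; ring.
Qed.

Lemma mx_equiv_swaprow (a b c d : A) : mx_equiv (mx2 a b c d) (mx2 c d a b).
Proof.
apply: (@mx_equiv_row (mx2 0 1 1 0) (mx2 0 1 1 0)).
- by rewrite mx2M -mx2_1; congr mx2; ring.
- by rewrite mx2M -mx2_1; congr mx2; ring.
- by rewrite mx2M; congr mx2; ring.
Qed.

Lemma mx_equiv_addcol (x a b c d : A) :
  mx_equiv (mx2 a b c d) (mx2 (a + x * b) b (c + x * d) d).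
Proof. by have /mx_equiv_tr := mx_equiv_addrow x a c b d; rewrite !mx2_tr. Qed.

Lemma mx_equiv_scalecol (u v a b c d : A) : u * v = 1 ->
  mx_equiv (mx2 a b c d) (mx2 (u * a) b (u * c) d).
Proof. by move=> /(mx_equiv_scalerow a c b d)/mx_equiv_tr; rewrite !mx2_tr. Qed.

Lemma mx_equiv_addrow2 (x a b c d : A) :
  mx_equiv (mx2 a b c d) (mx2 a b (c + x * a) (d + x * b)).
Proof.
apply: (mx_equiv_trans (mx_equiv_swaprow _ _ _ _)).
apply: (mx_equiv_trans (mx_equiv_addrow x _ _ _ _)).
exact: mx_equiv_swaprow.
Qed.

Lemma mx_equiv_addcol2 (x a b c d : A) :
  mx_equiv (mx2 a b c d) (mx2 a (b + x * a) c (d + x * c)).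
Proof. by have /mx_equiv_tr := mx_equiv_addrow2 x a c b d; rewrite !mx2_tr. Qed.

End Equivalence.

(* In the application [A] is a completed local ring of [C], [eps] generates its
   nilradical and [f] is a local equation of a simple divisor. *)
Section LocalRing.
Variables (A : comPzRingType) (eps : A) (q : nat).
Hypothesis epsq : eps ^+ q = 0.
Implicit Types x y f : A.

(** Says that [A] is local with maximal ideal [(f, eps)]. The first clause makes every nonunit a
    combination of [f] and [eps]; the second makes the ideal proper, so that no combination is a
    unit. *)
Definition maximal_gen (f : A) : Prop :=
  (forall x : A, is_unit x \/ exists a b, x = f * a + eps * b) /\
  ~ (exists a b, (1 : A) = f * a + eps * b).

Lemma nonunitP f x : maximal_gen f -> (~ is_unit x <-> exists a b, x = f * a + eps * b).
Proof.
move=> [h h1]; split; first by have [] := h x.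
move=> [a [b ->]] [c e]; apply: h1; exists (a * c), (b * c).
by rewrite -e; ring.
Qed.

Lemma unitM_nonunit (x y : A) : ~ is_unit y -> ~ is_unit (x * y).
Proof. by move=> h [z e]; apply: h; exists (x * z); rewrite -e; ring. Qed.

Lemma nonunitD f x y : maximal_gen f ->
  ~ is_unit x -> ~ is_unit y -> ~ is_unit (x + y).
Proof.
move=> hf /(nonunitP _ hf)[a [b ->]] /(nonunitP _ hf)[a' [b' ->]].
by apply/(nonunitP _ hf); exists (a + a'), (b + b'); ring.
Qed.

Lemma unit1 : is_unit (1 : A). Proof. by exists 1; rewrite mulr1. Qed.

Lemma unit_subl f x y : maximal_gen f ->
  is_unit (x - y) -> ~ is_unit x -> is_unit y.
Proof.
move=> hf h hx; apply: contrapT => hy; have := @nonunitD f x (- y) hf hx.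
by move=> /(_ _ h); apply; rewrite -mulN1r; exact: unitM_nonunit.
Qed.

(* [A / f] is a chain ring with uniformizer [eps]. *)
Lemma eps_order f y : maximal_gen f ->
  exists j w z, is_unit w /\ y = w * eps ^+ j + f * z.
Proof.
move=> hf; suff: forall r, (exists j w z, is_unit w /\ y = w * eps ^+ j + f * z) \/
    exists z t, y = f * z + eps ^+ r * t.
  (* Here [y] lies in [(f)]. The exponent [q] with [w = 1] records this, since [eps ^+ q = 0]. *)
  move=> /(_ q)[//|[z [t ->]]]; exists q, 1, z; split; first exact: unit1.
  by rewrite epsq; ring.
elim=> [|r [?|[z [t ->]]]]; [|by left|].
  by right; exists 0, y; rewrite expr0; ring.
have [ut|[a [b ->]]] := hf.1 t.
  by left; exists r, t, z; split => //; ring.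
by right; exists (z + eps ^+ r * a), b; rewrite exprS; ring.
Qed.

(** Modulo [f], both elements are units times powers of [eps]; the one with the smaller exponent
    divides the other. *)
Lemma eps_compare f x y : maximal_gen f ->
  (exists s t, x = f * s + y * t) \/ (exists s t, y = f * s + x * t).
Proof.
move=> hf; have [j [w [z [[w' ww'] ->]]]] := eps_order x hf.
have [l [v [z' [[v' vv'] ->]]]] := eps_order y hf.
have [/subnK <-|/ltnW/subnK <-] := leqP l j; [left|right].
  exists (z - w * eps ^+ (j - l) * v' * z'), (w * eps ^+ (j - l) * v').
  rewrite exprD -[w in LHS]mulr1 -vv'; ring.
exists (z' - v * eps ^+ (l - j) * w' * z), (v * eps ^+ (l - j) * w').
rewrite exprD -[v in LHS]mulr1 -ww'; ring.
Qed.

(** If [u] were a nonunit, substituting [f = f' x + eps z] into the relation would give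
    [f (1 - u x) = eps (y x + z)] with [1 - u x] a unit. Then [f] would be nilpotent, which is
    impossible for a nonzerodivisor in a nonzero ring. *)
Lemma maximal_gen_exchange f f' u y : maximal_gen f -> maximal_gen f' ->
  nonzerodivisor f -> f' = f * u + eps * y -> is_unit u.
Proof.
move=> hf hf' nf e; apply: contrapT => nu.
have /(nonunitP _ hf')[x [z e']] : ~ is_unit f.
  by apply/(nonunitP _ hf); exists 1, 0; ring.
have [v uv] : is_unit (1 - u * x).
  apply: contrapT => h; have := nonunitD hf h (unitM_nonunit (x := x) nu).
  by rewrite (mulrC x) subrK; apply; exact: unit1.
have ef : f = eps * (v * (y * x + z)).
  have -> : eps * (v * (y * x + z)) = v * (f * u * x + eps * y * x + eps * z - f * u * x) by ring.
  rewrite -mulrDl -e -e' -[f in LHS]mul1r -uv; ring.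
have : is_unit (0 : A).
  suff e1 : (1 : A) = 0 by exists 0; rewrite mulr0 e1.
  have : 1 * f ^+ q = 0 by rewrite ef exprMn epsq mul0r mulr0.
  elim: (q) => [|r IHr]; first by rewrite expr0 mulr1.
  by rewrite exprSr mulrA => /nf/IHr.
by move=> [t]; rewrite mul0r => e0; apply: hf.2; exists 0, 0; rewrite -e0; ring.
Qed.

Lemma antidiag_equiv_tr f f' e : maximal_gen f -> maximal_gen f' ->
  nonzerodivisor f -> ~ is_unit e ->
  mx_equiv (mx2 0 f f' e) (mx2 0 f' f e).
Proof.
move=> hf hf' nf /(nonunitP _ hf)[x [y ->]].
(* The multiple of [f] in [e] is cleared by a row operation, and by a column operation for the
   transposed matrix; so [e] may be replaced by [eps * y]. *)
have step1 : mx_equiv (mx2 0 f f' (f * x + eps * y)) (mx2 0 f f' (eps * y)).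
  have := mx_equiv_addrow2 (- x) 0 f f' (f * x + eps * y).
  by congr (mx_equiv _ (mx2 _ _ _ _)); ring.
have step1' : mx_equiv (mx2 0 f' f (f * x + eps * y)) (mx2 0 f' f (eps * y)).
  have := mx_equiv_addcol2 (- x) 0 f' f (f * x + eps * y).
  by congr (mx_equiv _ (mx2 _ _ _ _)); ring.
apply: (mx_equiv_trans step1); apply: mx_equiv_trans (mx_equiv_sym step1').
have [[s [t ed]]|[u [t ef']]] := eps_compare (eps * y) f' hf.
  have h1 : mx_equiv (mx2 0 f f' (eps * y)) (mx2 0 f f' 0).
    apply: (mx_equiv_trans (mx_equiv_addrow2 (- s) _ _ _ _)).
    apply: (mx_equiv_trans (mx_equiv_addcol2 (- t) _ _ _ _)).
    have -> : mx2 0 (f + - t * 0) (f' + - s * 0)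
        (eps * y + - s * f + - t * (f' + - s * 0)) = mx2 0 f f' 0.
      by rewrite ed; congr mx2; ring.
    by exists (gl_one A), (gl_one A); rewrite mulmx1 mul1mx.
  (* Exchanging the rows makes the matrix diagonal, hence symmetric. *)
  have h2 : mx_equiv (mx2 0 f f' 0) (mx2 0 f' f 0).
    have h3 := mx_equiv_swaprow 0 f f' 0.
    have := mx_equiv_sym_tr (mx_equiv_trans h3 (mx_equiv_addrow 0 _ _ _ _)).
    by rewrite !mx2_tr; apply; congr mx2; ring.
  apply: (mx_equiv_trans h1 (mx_equiv_trans h2 _)).
  by have /mx_equiv_tr := mx_equiv_sym h1; rewrite !mx2_tr.
have [v uv] : is_unit u.
  by apply: (maximal_gen_exchange hf hf' nf (y := y * t)); rewrite ef'; ring.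
(* Write [e] for [eps * y], so that [f' = f u + e t]. Subtracting [t] times the second column turns
   [f'] into [f u] and puts [- t f] at the top left. Adding [t v] times the second row cancels this
   entry and turns [f] into [f + t v e]. Scaling the row by [u] yields [f'], scaling the column by
   [v = u^-1] yields [f]. *)
apply: (mx_equiv_trans (mx_equiv_addcol (- t) _ _ _ _)).
apply: (mx_equiv_trans (mx_equiv_addrow (t * v) _ _ _ _)).
apply: (mx_equiv_trans (mx_equiv_scalerow _ _ _ _ uv)).
apply: (mx_equiv_trans (mx_equiv_scalecol (u := v) (v := u) _ _ _ _ _)).
  by rewrite mulrC.
rewrite ef'.
have -> : mx2 (v * (u * (0 + - t * f + t * v * (f * u + eps * y * t + - t * (eps * y)))))
  (u * (f + t * v * (eps * y))) (v * (f * u + eps * y * t + - t * (eps * y))) (eps * y)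
  = mx2 (t * (u * v) * f * (u * v - 1)) (u * f + t * (eps * y) * (u * v)) (f * (u * v)) (eps * y).
  by congr mx2; ring.
rewrite uv.
by exists (gl_one A), (gl_one A); rewrite mulmx1 mul1mx; congr mx2; ring.
Qed.

Lemma gl_det (k : GL2 A) :
  is_unit (k ord0 ord0 * k ord_max ord_max - k ord0 ord_max * k ord_max ord0).
Proof.
have := gl_mxV k; rewrite (mx2E (gl_mx k)) (mx2E (gl_inv_mx k)) mx2M -mx2_1.
set a := gl_mx k _ _; set b := gl_mx k _ _; set c := gl_mx k _ _; set d := gl_mx k _ _.
set a' := gl_inv_mx k _ _; set c' := gl_inv_mx k _ _.
set b' := gl_inv_mx k _ _; set d' := gl_inv_mx k _ _ => /matrixP e.
move: (e ord0 ord0) (e ord0 ord_max) (e ord_max ord0) (e ord_max ord_max).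
rewrite !mxE /= => e1 e2 e3 e4; exists (a' * d' - b' * c').
transitivity ((a * a' + b * c') * (c * b' + d * d') - (a * b' + b * d') * (c * a' + d * c')).
  by ring.
by rewrite e1 e2 e3 e4; ring.
Qed.

Lemma diag_mul_diag_equiv_tr f f' (k : GL2 A) : maximal_gen f -> maximal_gen f' ->
  nonzerodivisor f ->
  mx_equiv (diag2 f 1 *m k *m diag2 f' 1) (diag2 f 1 *m k *m diag2 f' 1)^T.
Proof.
move=> hf hf' nf; rewrite !diag2E (mx2E (gl_mx k)).
have := gl_det k.
set a := gl_mx k _ _; set e := gl_mx k _ _; set b := gl_mx k _ _; set c := gl_mx k _ _.
move=> hdet.
have -> : mx2 f 0 0 1 *m mx2 a b c e *m mx2 f' 0 0 1 = mx2 (f * f' * a) (f * b) (f' * c) e.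
  by rewrite !mx2M; congr mx2; ring.
have [[v ev]|ne] := pselect (is_unit e).
  apply: (@mx_equiv_sym_tr _ _ (mx2 (f * f' * (a - b * v * c)) 0 0 e)); last by rewrite mx2_tr.
  apply: (mx_equiv_trans (mx_equiv_addrow (- (f * b * v)) _ _ _ _)).
  apply: (mx_equiv_trans (mx_equiv_addcol (- (f' * c * v)) _ _ _ _)).
  have -> : mx2 (f * f' * a + - (f * b * v) * (f' * c) +
        - (f' * c * v) * (f * b + - (f * b * v) * e))
      (f * b + - (f * b * v) * e) (f' * c + - (f' * c * v) * e) e =
    mx2 (f * f' * a - (f * b * v) * (f' * c) - (f' * c * v) * (f * b * (1 - e * v)))
      (f * b * (1 - e * v)) (f' * c * (1 - e * v)) e by congr mx2; ring.
  rewrite ev subrr !mulr0 subr0.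
  by exists (gl_one A), (gl_one A); rewrite mulmx1 mul1mx; congr mx2; ring.
(* The determinant [a e - b c] is a unit and [a e] is not. *)
have [w bcw] : is_unit (b * c).
  by apply: unit_subl hf hdet _; exact: unitM_nonunit.
pose a1 := a * w.
have [u hu] : is_unit (1 - a1 * e).
  apply: contrapT => h; apply: hf.2; apply/(nonunitP _ hf).
  have -> : 1 = 1 - a1 * e + a1 * e by ring.
  by apply: (nonunitD hf h); exact: unitM_nonunit.
(* The units [b] and [c] are scaled to [1]. Subtracting [f a1] times the second row then clears the
   top left entry and multiplies the top right one by the unit [1 - a1 e]. *)
have h1 : mx_equiv (mx2 (f * f' * a) (f * b) (f' * c) e) (mx2 0 f f' e).
  have cc : (b * w) * c = 1 by rewrite -bcw; ring.
  have bb : (c * w) * b = 1 by rewrite -bcw; ring.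
  apply: (mx_equiv_trans (mx_equiv_scalerow _ _ _ _ bb)).
  apply: (mx_equiv_trans (mx_equiv_scalecol _ _ _ _ cc)).
  apply: (mx_equiv_trans (mx_equiv_addrow (- f * a1) _ _ _ _)).
  rewrite mulrC in hu.
  apply: (mx_equiv_trans (mx_equiv_scalerow _ _ _ _ hu)).
  exists (gl_one A), (gl_one A); rewrite mulmx1 mul1mx; congr mx2.
  - by rewrite /a1; ring.
  - transitivity (u * (b * c * w - a1 * e) * f); first by ring.
    by rewrite bcw hu mul1r.
  - by transitivity ((b * c * w) * f'); [ring|rewrite bcw; ring].
apply: (mx_equiv_trans h1).
apply: mx_equiv_trans (mx_equiv_tr (mx_equiv_sym h1)); rewrite mx2_tr.
exact: antidiag_equiv_tr.
Qed.

End LocalRing.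

(** * Adic completions *)

Section IdealPowers.
Variables (A : comPzRingType) (I : set A).
Implicit Types x y : A.

Lemma ideal_pow1 x : is_ideal I -> ideal_pow I 1 x <-> I x.
Proof.
move=> [I0 ID IM]; split=> [[l hl ->]|Ix].
  elim: l hl => [|p l IHl] hl; first by rewrite big_nil.
  rewrite big_cons; apply: (ID); last by apply: IHl => r hr; apply: hl; rewrite inE hr orbT.
  by have [a Ia [b _ ->]] := hl p (mem_head _ _); apply: (IM); rewrite mulrC; apply: (IM).
exists [:: (1, x)]; last by rewrite big_seq1 mul1r.
by move=> p; rewrite inE => /eqP -> /=; exists x => //; exists 1; rewrite ?mulr1.
Qed.

Lemma ideal_mul_ind (P J : set A) (x : A) : ideal_mul I J x ->
  P 0 -> (forall a b, P a -> P b -> P (a + b)) ->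
  (forall c a b, I a -> J b -> P (c * (a * b))) -> P x.
Proof.
move=> [l hl ->] P0 PD PM; elim: l hl => [|p l IHl] hl; first by rewrite big_nil.
rewrite big_cons; apply: PD; last by apply: IHl => r hr; apply: hl; rewrite inE hr orbT.
by have [a Ia [b Jb ->]] := hl p (mem_head _ _); exact: PM.
Qed.

Lemma ideal_mul_mem (J : set A) x y : I x -> J y -> ideal_mul I J (x * y).
Proof.
move=> Ix Jy; exists [:: (1, x * y)]; last by rewrite big_seq1 mul1r.
by move=> p; rewrite inE => /eqP -> /=; exists x => //; exists y.
Qed.

Lemma ideal_powD i j x y : ideal_pow I i x -> ideal_pow I j y -> ideal_pow I (i + j) (x * y).
Proof.
have hpow := ideal_pow_ideal I.
elim: i x y => [|i IHi] x y; first by move=> _; case: (hpow j) => _ _; apply.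
have [h0 hD hM] := hpow (i.+1 + j)%N.
move=> hx hy; apply: (ideal_mul_ind (P := fun x => ideal_pow I (i.+1 + j) (x * y)) hx).
- by rewrite mul0r.
- by move=> a b ha hb; rewrite mulrDl; exact: hD.
- move=> c a b Ia hb; rewrite -!mulrA; apply: hM; rewrite addSn.
  by apply: ideal_mul_mem => //; exact: IHi.
Qed.

Lemma ideal_powX n x : ideal_pow I 1 x -> ideal_pow I n (x ^+ n).
Proof.
by move=> Ix; elim: n => [//|n IHn]; rewrite exprS -add1n; exact: ideal_powD.
Qed.

Lemma ideal_pow_le i j x : (i <= j)%N -> ideal_pow I j x -> ideal_pow I i x.
Proof.
move=> /subnK <-; elim: (j - i)%N => [//|k IHk] h; apply: IHk.
exact: ideal_powS.
Qed.

End IdealPowers.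

Section Completion.
Variables (A : comPzRingType) (I : set A).
Implicit Types x y : adic_completion I.

Local Notation qpi := (qpi (S := coherent_data I)).
Local Notation rep x := (qrepr (S := coherent_data I) x).

Lemma coh_qpiP (c d : coherent I) : qpi c = qpi d <-> coh_eq c d.
Proof. exact: qpiP. Qed.

Lemma to_completionM a b : to_completion I (a * b) = to_completion I a * to_completion I b.
Proof.
rewrite /to_completion -[RHS](@qpiM (coherent_data I)); apply/coh_qpiP => k /=.
by rewrite subrr; case: (ideal_pow_ideal I k).
Qed.
Lemma to_completionX a n : to_completion I (a ^+ n) = to_completion I a ^+ n.
Proof. by elim: n => [|n IHn]; rewrite ?expr0 // !exprS to_completionM IHn. Qed.

(** [completion_ker] refers to a chosen representative; two representatives of one class agree
    modulo [I^k] at index [k], so any of them may be tested. *)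
Lemma completion_kerE k (c : coherent I) :
  completion_ker k (qpi c) <-> ideal_pow I k (c k).
Proof.
have [_ hD _] := ideal_pow_ideal I k; have hB := @idealB _ _ _ _ (ideal_pow_ideal I k).
have := qreprP (c : coherent_data I) k.
rewrite /completion_ker /= => h; split=> h'.
  by rewrite -(subKr (coh_seq (rep (qpi c)) k) (c k)); apply: hB.
by rewrite -(subrK (c k) (coh_seq _ _)); apply: hD.
Qed.

Lemma completion_ker_ideal k : is_ideal (@completion_ker A I k).
Proof.
have [h0 hD hM] := ideal_pow_ideal I k; split.
- exact/completion_kerE.
- move=> x y; rewrite -(qreprK x) -(qreprK y) -[_ + _](@qpiD (coherent_data I)).
  by move=> /completion_kerE hx /completion_kerE hy; apply/completion_kerE/hD.
- move=> x y; rewrite -(qreprK x) -(qreprK y) -[_ * _](@qpiM (coherent_data I)).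
  by move=> /completion_kerE hy; apply/completion_kerE/hM.
Qed.

Lemma coherent_le (c : coherent I) i j : (i <= j)%N -> ideal_pow I i (c j - c i).
Proof.
have [h0 hD _] := ideal_pow_ideal I i.
move=> /subnK <-; elim: (j - i)%N => [|k IHk]; first by rewrite subrr.
rewrite addSn -(subrK (c (k + i)%N) (c _)) -addrA; apply: hD => //.
apply: (ideal_pow_le (leq_addl k i)); exact: coh_seqP.
Qed.

Lemma to_completion_span g h (Y Z : coherent I) :
  to_completion I g * qpi Y + to_completion I h * qpi Z =
  qpi (coh_add (coh_mul (coh_const I g) Y) (coh_mul (coh_const I h) Z)).
Proof. by rewrite [RHS](@qpiD (coherent_data I)) !(@qpiM (coherent_data I)). Qed.

(* The series of the increments of [x] is divided termwise, and the quotients converge. *)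
Lemma completion_ker_span (g h : A) r j0 x :
  (forall j a, ideal_pow I (j + r) a ->
     exists b c, [/\ ideal_pow I j b, ideal_pow I j c & a = g * b + h * c]) ->
  completion_ker (j0 + r) x ->
  exists y z, [/\ completion_ker j0 y, completion_ker j0 z &
    x = to_completion I g * y + to_completion I h * z].
Proof.
move=> hspan hx; set s := rep x in hx.
have /choice[p hp] j : exists p : A * A, [/\ ideal_pow I j p.1, ideal_pow I j p.2 &
    s (j + r).+1 - s (j + r)%N = g * p.1 + h * p.2].
  by have [b [c []]] := hspan j _ (coh_seqP s (j + r)); exists (b, c).
have [b0 [c0 [hb0 hc0 e0]]] := hspan j0 _ hx.
(* The partial sums start at [j0]. The terms before are accounted for by the constants [b0] and
   [c0], which lie in [I^j0] and so place the limits in [completion_ker j0]. *)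
pose coh (F : nat -> A) a k := a + \sum_(j0 <= j < k) F j.
have hcoh F a (hF : forall j, ideal_pow I j (F j)) k :
    ideal_pow I k (coh F a k.+1 - coh F a k).
  rewrite /coh opprD addrACA subrr add0r.
  have [le|lt] := leqP j0 k; first by rewrite big_nat_recr //= addrAC subrr add0r.
  by rewrite !big_geq ?(ltnW lt) // subrr; case: (ideal_pow_ideal I k).
pose Y := Coherent (hcoh (fun j => (p j).1) b0 (fun j => let: And3 h _ _ := hp j in h)).
pose Z := Coherent (hcoh (fun j => (p j).2) c0 (fun j => let: And3 _ h _ := hp j in h)).
exists (qpi Y), (qpi Z); split.
- by apply/completion_kerE; rewrite /= /coh big_geq // addr0.
- by apply/completion_kerE; rewrite /= /coh big_geq // addr0.
rewrite -[LHS]qreprK.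
rewrite to_completion_span; apply/coh_qpiP => k /=; rewrite -/s -opprB.
apply: idealN; first exact: ideal_pow_ideal.
(* The sum telescopes to a later term of the coherent sequence [s], congruent to [s k] modulo [I^k].
   For [k < j0] the sum is empty, whence the [maxn]. *)
have -> : g * coh (fun j => (p j).1) b0 k + h * coh (fun j => (p j).2) c0 k =
    s (maxn j0 k + r)%N.
  rewrite /coh !mulrDr addrACA -[X in X + _]e0 !mulr_sumr -big_split /=.
  rewrite (eq_bigr (fun j => s (j + r).+1 - s (j + r)%N)); last by move=> j _; case: (hp j).
  have [le|lt] := leqP j0 k.
    by rewrite (telescope_sumr (fun j => s (j + r)%N)) // addrC subrK.
  by rewrite big_geq ?(ltnW lt) // addr0.
apply: coherent_le; exact: leq_trans (leq_maxr _ _) (leq_addr _ _).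
Qed.

End Completion.

Section LocalCompletion.
Variable A : comPzRingType.
Local Notation m := (@nonunits A).
Hypothesis m_ideal : is_ideal m.
Variables (f eps : A) (q : nat).
Hypotheses (epsq : eps ^+ q = 0) (mf : m f) (meps : m eps).
Hypothesis m_gen : forall x, m x -> exists a b, x = f * a + eps * b.

Local Notation to := (to_completion m).

Lemma maximal_pow_span j a : ideal_pow m (j + 1) a ->
  exists b c, [/\ ideal_pow m j b, ideal_pow m j c & a = f * b + eps * c].
Proof.
have [h0 hD hM] := ideal_pow_ideal m j.
rewrite addn1 => h; apply: (ideal_mul_ind (P := [set a | exists b c,
  [/\ ideal_pow m j b, ideal_pow m j c & a = f * b + eps * c]]) h).
- by exists 0, 0; split=> //; ring.
- move=> _ _ [b [c [hb hc ->]]] [b' [c' [hb' hc' ->]]].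
  by exists (b + b'), (c + c'); split; [exact: hD|exact: hD|ring].
- move=> d x y /m_gen[b [c ->]] hy.
  by exists (d * b * y), (d * c * y); split; [exact: hM|exact: hM|ring].
Qed.

(** Each application of [maximal_pow_span] to the remainder spends one power of [m] and gains one
    factor [eps]; after [q] of them the remainder vanishes. The term [0 * c] gives the result the
    shape required by [completion_ker_span]. *)
Lemma maximal_pow_divf j a : ideal_pow m (j + q) a ->
  exists b c, [/\ ideal_pow m j b, ideal_pow m j c & a = f * b + 0 * c].
Proof.
suff: forall r j a, ideal_pow m (j + r) a -> exists b c,
    [/\ ideal_pow m j b, ideal_pow m j c & a = f * b + eps ^+ r * c].
  by move=> /(_ q j a); rewrite epsq.
elim=> [|r IHr] {}j {}a.
  have [h0 _ _] := ideal_pow_ideal m j.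
  by rewrite addn0 => h; exists 0, a; split=> //; rewrite expr0; ring.
rewrite addnS -addSn => /IHr[b [c [hb hc ->]]].
move: (hc); rewrite -addn1 => /maximal_pow_span[b' [c' [hb' hc' ->]]].
have [h0 hD hM] := ideal_pow_ideal m j.
exists (b + eps ^+ r * b'), c'; split=> //; last by rewrite exprS; ring.
by apply: hD; [exact: ideal_powS|exact: hM].
Qed.

(** Division by [f] loses only [q] steps of the filtration: this makes multiplication by [f^-1]
    continuous on the fraction ring. *)
Lemma completion_ker_divf k x : @completion_ker A m (k + q) x ->
  exists2 y, completion_ker k y & x = to f * y.
Proof.
move=> /(completion_ker_span (@maximal_pow_divf))[y [z [hy _ ->]]]; exists y => //.
have -> : to 0 = 0 by [].
by rewrite mul0r addr0.
Qed.

(** A representative of an element outside the maximal ideal has unit terms from index [1] on, and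
    their inverses are again coherent. *)
Lemma completion_unit (x : adic_completion m) : ~ completion_ker 1 x -> is_unit x.
Proof.
set s := qrepr (S := coherent_data m) x => hx.
have [m0 mD mM] := m_ideal.
have hs k : is_unit (s k.+1).
  apply: contrapT => hk; apply: hx; rewrite /completion_ker /= -/s.
  have := coherent_le s (ltn0Sn k).
  move=> /(ideal_pow1 _ m_ideal) h; apply/(ideal_pow1 _ m_ideal).
  by rewrite -(subKr (s k.+1) (s 1%N)); apply: idealB.
have /choice[t ht] k := hs k.
(* The term [s 0] carries no information and may be a nonunit; modulo [m^0] any value, here [0], is
   an inverse. *)
pose y k := if k is k'.+1 then t k' else 0.
have hy k : ideal_pow m k (y k.+1 - y k).
  case: k => [//|k]; have [_ _ hM] := ideal_pow_ideal m k.+1; rewrite /y.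
  have -> : t k.+1 - t k = (- (t k * t k.+1)) * (s k.+2 - s k.+1).
    transitivity ((s k.+1 * t k) * t k.+1 - t k * (s k.+2 * t k.+1)); last by ring.
    by rewrite !ht; ring.
  by apply: hM; exact: coh_seqP.
exists (qpi (S := coherent_data m) (Coherent hy)).
rewrite -(qreprK x) -[LHS](@qpiM (coherent_data m)); apply/coh_qpiP => -[//|k] /=.
by rewrite -/s ht subrr; case: (ideal_pow_ideal m k.+1).
Qed.

(** Elements outside [completion_ker 1] are units; those inside are combinations by
    [completion_ker_span] with [j0 = 0] and [r = 1]. Reading a relation at index [1] shows that [1]
    is no combination. *)
Lemma completion_maximal_gen : maximal_gen (to eps) (to f).
Proof.
have [m0 mD mM] := m_ideal.
split=> [x|[a [b]]].
  have [h|] := pselect (@completion_ker A m 1 x); last by move=> /completion_unit; left.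
  right; have [y [z [_ _ ->]]] := completion_ker_span (j0 := 0) (@maximal_pow_span) h.
  by exists y, z.
rewrite -(qreprK a) -(qreprK b) to_completion_span.
set s := qrepr _; set t := qrepr _ => /coh_qpiP /(_ 1%N) /=.
move=> /(ideal_pow1 _ m_ideal) h.
have : m 1.
  rewrite -(subrK (f * s 1%N + eps * t 1%N) 1); apply: (mD) => //.
  by apply: (mD); rewrite mulrC; apply: (mM).
by apply; exact: unit1.
Qed.

Lemma completion_epsX : to eps ^+ q = 0.
Proof. by rewrite -to_completionX epsq. Qed.

End LocalCompletion.

Section FractionRing.
Variable A : comPzRingType.

Lemma to_frac_inj : injective (@to_frac A).
Proof. by move=> a b /qpiP; rewrite /= /fr_eq /= !mulr1. Qed.

(** If [y = b / s], then [a b = s] is a nonzerodivisor, and so is [a]. Applied to the components of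
    an idele, this shows that a local equation of a divisor remains a nonzerodivisor in the
    completion. *)
Lemma nonzerodivisor_to_frac (a : A) y : to_frac a * y = 1 -> nonzerodivisor a.
Proof.
rewrite -(qreprK y); case: (qrepr _) => b s hs; rewrite /to_frac -[_ * _](@qpiM (fraction_data A)).
move=> /qpiP; rewrite /= /fr_eq /= !mul1r mulr1 => e c ec.
by apply: hs; rewrite -e mulrA ec mul0r.
Qed.

End FractionRing.

(** * Special nilpotent extensions *)

Section Units.
Variable A : comPzRingType.
Implicit Types a b : A.

Lemma is_unitMl a b : is_unit (a * b) -> is_unit a.
Proof. by move=> [c e]; exists (b * c); rewrite mulrA. Qed.

End Units.

Section Stalks.
Variable X : ringedSpace.
Variable x : X.
Implicit Types U V W : opens X.

Lemma germ_at_res U W (h : pts W `<=` pts U) (Ux : pts U x) (Wx : pts W x) (s : sect U) :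
  germ_at Wx (res h s) = germ_at Ux s.
Proof.
apply/qpiP; exists W, (@subset_refl _ _), h; split=> //=; exact: res_id.
Qed.

Lemma germ_at_eqP U V (Ux : pts U x) (Vx : pts V x) (s : sect U) (t : sect V) :
  germ_at Ux s = germ_at Vx t ->
  exists W (hU : pts W `<=` pts U) (hV : pts W `<=` pts V),
    pts W x /\ res hU s = res hV t.
Proof. by move=> /qpiP. Qed.

Lemma germ_at_surj (a : stalk x) : exists U (Ux : pts U x) (s : sect U), a = germ_at Ux s.
Proof.
rewrite -(qreprK a); case: (qrepr a) => U Ux s.
by exists U, Ux, s.
Qed.

Lemma germ_at2 (op : forall U, sect U -> sect U -> sect U)
    (hop : forall U V (h : pts V `<=` pts U) s t, res h (op U s t) = op V (res h s) (res h t))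
    U (Ux : pts U x) (s t : sect U) :
  qpi (S := germ_data x) (germ_op2 op (Germ Ux s) (Germ Ux t)) = germ_at Ux (op U s t).
Proof.
have hU : pts U `<=` pts (opens_cap U U) by move=> y.
apply/qpiP; exists U, hU, (@subset_refl _ _); split=> //=.
rewrite hop !(res_comp _ hU (@subset_refl _ _)) !res_id.
by [].
Qed.

Lemma germ_atD U (Ux : pts U x) (s t : sect U) :
  germ_at Ux (s + t) = germ_at Ux s + germ_at Ux t.
Proof.
rewrite -(@germ_at2 (fun U a b => a + b)); last by move=> *; exact: rmorphD.
exact: (@qpiD (germ_data x)).
Qed.

Lemma germ_atM U (Ux : pts U x) (s t : sect U) :
  germ_at Ux (s * t) = germ_at Ux s * germ_at Ux t.
Proof.
rewrite -(@germ_at2 (fun U a b => a * b)); last by move=> *; exact: rmorphM.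
exact: (@qpiM (germ_data x)).
Qed.

Lemma germ_at1 U (Ux : pts U x) : germ_at Ux 1 = 1.
Proof.
have <- : res (@subsetT _ (pts U) : pts U `<=` pts (opens_full X)) 1 = 1 by rewrite rmorph1.
by rewrite (@germ_at_res (opens_full X) U _ I).
Qed.

Lemma germ_at0 U (Ux : pts U x) : germ_at Ux 0 = 0.
Proof.
have <- : res (@subsetT _ (pts U) : pts U `<=` pts (opens_full X)) 0 = 0 by rewrite rmorph0.
by rewrite (@germ_at_res (opens_full X) U _ I).
Qed.

Lemma germ_atX U (Ux : pts U x) (s : sect U) n : germ_at Ux (s ^+ n) = germ_at Ux s ^+ n.
Proof. by elim: n => [|n IHn]; rewrite ?germ_at1 // !exprS germ_atM IHn. Qed.

Lemma germ_at_unit U (Ux : pts U x) (s : sect U) : is_unit s -> is_unit (germ_at Ux s).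
Proof. by move=> [t e]; exists (germ_at Ux t); rewrite -germ_atM e germ_at1. Qed.

Lemma germ_at_surj2 (a b : stalk x) : exists U (Ux : pts U x) (s t : sect U),
  a = germ_at Ux s /\ b = germ_at Ux t.
Proof.
have [U [Ux [s ->]]] := germ_at_surj a; have [V [Vx [t ->]]] := germ_at_surj b.
pose W := opens_cap U V; have Wx : pts W x by [].
exists W, Wx, (res (@opens_capl _ U V) s), (res (@opens_capr _ U V) t).
by split; rewrite germ_at_res.
Qed.

End Stalks.

Section AffineOpens.
Variable X : ringedSpace.
Variable U : opens X.
Variable psi : X -> set (sect U).
Hypothesis psi_prime : forall x, pts U x -> prime_ideal (psi x).
Hypothesis psi_open : forall B : set X, B `<=` pts U ->
  (open B <-> exists S : set (sect U),
     B = [set x | pts U x /\ exists2 f, S f & ~ psi x f]).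
Hypothesis psi_loc : forall (f : sect U) (D : opens X) (hD : pts D `<=` pts U),
  pts D = [set x | pts U x /\ ~ psi x f] -> localization_away f (res hD).

Definition basic_open_set (f : sect U) : set X := [set x | pts U x /\ ~ psi x f].

Lemma basic_open_open f : open (basic_open_set f).
Proof.
apply/psi_open; first by move=> x [].
exists [set f]; apply/seteqP; split=> x [Ux h]; split=> //; first by exists f.
by case: h => g ->.
Qed.

Definition basic_open f : opens X := Opens (basic_open_open f).

Lemma basic_open_sub f : pts (basic_open f) `<=` pts U.
Proof. by move=> x []. Qed.

Lemma basic_open_loc f : localization_away f (res (@basic_open_sub f)).
Proof. exact: psi_loc. Qed.

Lemma germ_unitP x (Ux : pts U x) (s : sect U) : ~ psi x s -> is_unit (germ_at Ux s).
Proof.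
move=> h; have Dx : pts (basic_open s) x by [].
rewrite -(germ_at_res (@basic_open_sub s) Ux Dx); apply: germ_at_unit.
by have [] := basic_open_loc s.
Qed.

Lemma basic_open_basis (V : opens X) x : pts U x -> pts V x ->
  exists g, ~ psi x g /\ pts (basic_open g) `<=` pts V.
Proof.
move=> Ux Vx; have [] := psi_open (B := pts (opens_cap U V)); first by move=> y [].
move=> /(_ (pts_open _)) [S eS] _.
have : pts (opens_cap U V) x by [].
rewrite eS => -[_ [g Sg pg]]; exists g; split=> // y [Uy py].
suff : pts (opens_cap U V) y by case.
by rewrite eS; split=> //; exists g.
Qed.

(* [D(s)] is empty, so the zero ring [O(D(s))] is the localization at [s]. *)
Lemma nilrad_of_psi s : (forall x, pts U x -> psi x s) -> nilrad s.
Proof.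
move=> hs; have [_ _ /(_ 1)] := basic_open_loc s.
case=> [|m]; last by rewrite mulr1 => e; exists m.
apply: (@sect_separated X (basic_open s) False
  (fun j => match j with end) (fun j => match j with end)) => //.
by move=> x [Ux]; have := hs x Ux.
Qed.

End AffineOpens.

Section SpecialNilradical.
Variables (A : comPzRingType) (e : A) (n : nat).
Let N := ideal_pow (@nilrad A).
Hypothesis Nn : N n `<=` [set 0].
Hypothesis Ne : forall s, N 1 s -> exists a, N 2 (s - a * e).

(** Nakayama's lemma for a nilpotent ideal: an error in [N^(j+1)] is a combination of products
    [p q'] with [p] nilpotent, and replacing [p] by a multiple of [e] pushes the error into
    [N^(j+2)]. It vanishes once it reaches [N^n]. *)
Lemma special_nilrad_principal s : N 1 s -> exists a, s = a * e.
Proof.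
suff: forall j s, N 1 s -> exists a t, N j.+1 t /\ s = a * e + t.
  move=> /(_ n) h /h[a [t [ht ->]]]; exists a.
  by rewrite (Nn (ideal_powS ht)) addr0.
move=> {s}; elim=> [|j IHj] s hs; first by exists 0, s; split=> //; ring.
have [a [t [ht ->]]] := IHj s hs.
have [h0 hD hM] := ideal_pow_ideal (@nilrad A) j.+2.
suff [a' [t' [ht' ->]]] : exists a' t', N j.+2 t' /\ t = a' * e + t'.
  by exists (a + a'), t'; split=> //; ring.
apply: (ideal_mul_ind (P := [set t | exists a' t', N j.+2 t' /\ t = a' * e + t']) ht).
- by exists 0, 0; split=> //; ring.
- move=> _ _ [b [u [hu ->]]] [b' [u' [hu' ->]]]; exists (b + b'), (u + u').
  by split; [exact: hD|ring].
- move=> c p q' hp hq.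
  have [|b hb] := Ne (s := p).
    have [k hk] := hp; rewrite -(mulr1 p); exact: ideal_mul_mem.
  exists (c * b * q'), (c * ((p - b * e) * q')); split; last by ring.
  by apply: hM; rewrite -(add2n j); exact: ideal_powD.
Qed.

End SpecialNilradical.

Section SpecialExtension.
Variables (Cbar C : scheme) (i : morphism Cbar C) (n : nat).
Hypothesis i_closed : closed_immersion i.
Hypothesis i_surj : forall y, exists x, i x = y.
Hypothesis Cbar_nontrivial : forall (W : opens Cbar) x, pts W x -> (1 : sect W) <> 0.
Hypothesis C_special : special C n.

Lemma preim_sub (V : opens C) : pts (opens_preim i V) `<=` i @^-1` pts V.
Proof. by []. Qed.

Lemma stalk_nontrivial (z : Cbar) : (1 : stalk z) <> 0.
Proof.
rewrite -(germ_at1 (I : pts (opens_full Cbar) z)) -(germ_at0 (I : pts (opens_full Cbar) z)).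
move=> /germ_at_eqP[W [h [h' [Wz]]]]; rewrite !rmorph1 !rmorph0.
exact: Cbar_nontrivial Wz.
Qed.

Section AtPoint.
Variable x : Cbar.
Let A := stalk (i x).
Let B := stalk x.

Lemma preim_in (V : opens C) : pts V (i x) -> pts (opens_preim i V) x.
Proof. by []. Qed.

(** The map of stalks induced by [i], evaluated on a chosen germ; [comor_stalkE] shows that the
    choice does not matter. *)
Definition comor_stalk (a : A) : B :=
  germ_at (preim_in (g_in (qrepr a))) (comor (@preim_sub _) (g_sec (qrepr a))).

Lemma comor_stalkE V U (h : pts U `<=` i @^-1` pts V) (Vy : pts V (i x)) (Ux : pts U x)
  (s : sect V) : comor_stalk (germ_at Vy s) = germ_at Ux (comor h s).
Proof.
have : germ_at (g_in (qrepr (germ_at Vy s))) (g_sec (qrepr (germ_at Vy s))) = germ_at Vy s.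
  by rewrite -[RHS]qreprK; case: (qrepr _).
rewrite /comor_stalk; set g := qrepr _ => /germ_at_eqP[W [hg [hV [Wy e]]]].
pose W' := opens_cap (opens_preim i W) U.
have W'x : pts W' x by [].
have hW' : pts W' `<=` i @^-1` pts W by move=> z [].
have k1 : pts W' `<=` pts (opens_preim i (g_dom g)) by move=> z [/hg].
have k2 : pts W' `<=` pts U by move=> z [].
rewrite -(germ_at_res k1 _ W'x) -(germ_at_res k2 _ W'x).
by rewrite (comor_res hg k1 _ hW') (comor_res hV k2 _ hW') e.
Qed.

Lemma comor_stalkD a b : comor_stalk (a + b) = comor_stalk a + comor_stalk b.
Proof.
have [V [Vy [s [t [-> ->]]]]] := germ_at_surj2 a b.
rewrite -germ_atD !(comor_stalkE (@preim_sub V) Vy Vy).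
by rewrite rmorphD germ_atD.
Qed.

Lemma comor_stalkM a b : comor_stalk (a * b) = comor_stalk a * comor_stalk b.
Proof.
have [V [Vy [s [t [-> ->]]]]] := germ_at_surj2 a b.
rewrite -germ_atM !(comor_stalkE (@preim_sub V) Vy Vy).
by rewrite rmorphM germ_atM.
Qed.

Lemma comor_stalk1 : comor_stalk 1 = 1.
Proof.
rewrite -(germ_at1 (I : pts (opens_full C) (i x))).
rewrite (comor_stalkE (@preim_sub (opens_full C)) I I).
by rewrite rmorph1 germ_at1.
Qed.

Lemma comor_stalk0 : comor_stalk 0 = 0.
Proof. by apply: (addrI (comor_stalk 0)); rewrite -comor_stalkD !addr0. Qed.

Lemma comor_stalkN a : comor_stalk (- a) = - comor_stalk a.
Proof. by apply/eqP; rewrite -addr_eq0 -comor_stalkD addNr comor_stalk0. Qed.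

Lemma comor_stalkX a m : comor_stalk (a ^+ m) = comor_stalk a ^+ m.
Proof. by elim: m => [|m IHm]; rewrite ?comor_stalk1 // !exprS comor_stalkM IHm. Qed.

Lemma comor_stalk_surj b : exists a, comor_stalk a = b.
Proof.
have [_ _ /(_ x b)[V [U [h [Ux [s ->]]]]]] := i_closed.
by exists (germ_at (h x Ux) s); exact: comor_stalkE.
Qed.

Lemma comor_stalk_unit a : is_unit (comor_stalk a) <-> is_unit a.
Proof.
split; last by move=> [b e]; exists (comor_stalk b); rewrite -comor_stalkM e comor_stalk1.
have [V [Vy [s ->]]] := germ_at_surj a.
rewrite (comor_stalkE (@preim_sub V) Vy Vy).
exact: mor_local.
Qed.

End AtPoint.

(** For [n > 1], [e] lifts a local generator of the line bundle [N / N^2], and it has [e ^+ n = 0]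
    because it lies in [N]. For [n = 1] the nilradical is zero and so is [e]. *)
Lemma special_local_generator (y : C) : exists (U : opens C) (e : sect U),
  [/\ pts U y, affine U, e ^+ n = 0 & forall s, nilrad s -> exists a, s = a * e].
Proof.
have [n0 Nn He] := C_special.
have [n1|n1] := ltnP 1 n.
  have [|U [Uy aU [e [Ne He' _]]]] := He 1%N _ y; first by rewrite n1.
  exists U, e; split=> //.
    by apply: (Nn U aU); exact: ideal_powX.
  move=> s [k hk]; apply: (special_nilrad_principal (Nn U aU)) => //.
  by rewrite -(mulr1 s); apply: ideal_mul_mem => //; exists k.
have [U Uy aU] := sch_affine y; exists U, 0; split=> //.
  by rewrite expr0n; case: (n) n0.
have n1' : n = 1%N by apply/eqP; rewrite eqn_leq n1 n0.
move=> s [k hk]; exists 0; rewrite mulr0; apply: (Nn U aU); rewrite n1'.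
by rewrite -(mulr1 s); apply: ideal_mul_mem => //; exists k.
Qed.

(* A section whose pullback vanishes is a nonunit at all points, hence nilpotent. *)
Lemma comor_stalk_ker (x : Cbar) : exists eps : stalk (i x),
  eps ^+ n = 0 /\ forall a, comor_stalk a = 0 -> exists b, a = eps * b.
Proof.
have [U [e [Uy [psi [pr _ op loc]] en He]]] := special_local_generator (i x).
exists (germ_at Uy e); split; first by rewrite -germ_atX en germ_at0.
move=> a; have [V [Vy [s ->]]] := germ_at_surj a.
rewrite (comor_stalkE (@preim_sub V) Vy Vy).
rewrite -(germ_at0 (preim_in Vy)) => /germ_at_eqP[W [hW [hW' [Wx]]]]; rewrite rmorph0 => sW.
have [i_inj i_cl _] := i_closed.
(* A closed bijection is open. *)
have oW : open (i @` pts W).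
  rewrite -[X in open X]setCK; apply: closed_openC; have -> : ~` (i @` pts W) = i @` (~` pts W).
    apply/seteqP; split=> z.
      by have [w <-] := i_surj z => h; exists w => // hw; apply: h; exists w.
    by move=> [w hw <-] [w' hw' /i_inj e']; apply: hw; rewrite -e'.
  by apply: i_cl; exact/open_closedC/pts_open.
have [g [pg hg]] := basic_open_basis op (V := opens_cap V (Opens oW)) Uy
  (conj Vy (ex_intro2 _ _ x Wx erefl)).
set D := basic_open op g in hg.
have hDV : pts D `<=` pts V by move=> z /hg[].
have nonunit z (Dz : pts D z) : ~ is_unit (germ_at Dz (res hDV s)).
  have [_ [w Ww ew]] := hg z Dz; case: z / ew Dz => Dz.
  rewrite -comor_stalk_unit.
  have k : pts (opens_preim i D) `<=` i @^-1` pts D by [].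
  rewrite (comor_stalkE k _ Dz).
  have k2 : pts (opens_preim i D) `<=` pts W.
    by move=> u Du; have [_ [u' Wu' /i_inj <-]] := hg _ Du.
  have k3 : pts (opens_preim i D) `<=` pts (opens_preim i V) by move=> u /hDV.
  rewrite -(comor_res hDV k3 (@preim_sub V) k) -(res_comp hW k2 k3) sW rmorph0 germ_at0.
  by move=> [b]; rewrite mul0r => /esym; exact: stalk_nontrivial.
have Dy : pts D (i x) by [].
have [ug surj _] := basic_open_loc op loc g.
have [r [t et]] := surj (res hDV s).
have ugz z (Uz : pts U z) : ~ psi z g -> is_unit (germ_at Uz g) by exact: germ_unitP.
have es z (Dz : pts D z) (Uz : pts U z) : germ_at Uz t = germ_at Uz g ^+ r * germ_at Dz (res hDV s).
  by rewrite -(germ_at_res (@basic_open_sub _ _ _ op g) Uz Dz t) -et germ_atM germ_atX germ_at_res.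
(* On [D(g)] the germs of [t] are nonunits, as those of [s] are; off [D(g)], where [t] is not
   controlled, [g] lies in the prime. So [t * g] lies in every prime. At [i x] the factor [g] is
   invertible and can be removed again. *)
have [b eb] : exists b, t * g = b * e.
  apply: He; apply: (nilrad_of_psi op loc) => z Uz.
  have [[_ hD hM] _ _] := pr z Uz.
  have [pzg|npzg] := pselect (psi z g); first exact: hM.
  rewrite mulrC; apply: hM; apply: contrapT => npzt.
  have Dz : pts D z by [].
  apply: (nonunit z Dz); apply: (is_unitMl (b := germ_at Uz g ^+ r)).
  by rewrite mulrC -es; exact: (germ_unitP op loc).
have [v ev] := ugz _ Uy pg.
exists (germ_at Uy b * v ^+ r.+1).
have -> : germ_at Vy s = germ_at Dy (res hDV s) by rewrite germ_at_res.
have := congr1 (germ_at Uy) eb; rewrite !germ_atM (es _ Dy Uy) => eb'.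
transitivity ((germ_at Uy g * v) ^+ r.+1 * germ_at Dy (res hDV s)).
  by rewrite ev expr1n mul1r.
transitivity (germ_at Uy g ^+ r * germ_at Dy (res hDV s) * germ_at Uy g * v ^+ r.+1).
  by rewrite exprMn [in LHS]exprS; ring.
by rewrite eb'; ring.
Qed.

(** The stalk map detects units, so the nonunits upstairs are the preimage of those of the stalk of
    [Cbar]. The latter form an ideal generated by the image of [f], because the intersection is a
    reduced point, and the kernel is contained in [(eps)]. *)
Lemma simple_local_equation (c : cartierDivisor C) (x : Cbar) (f eps : stalk (i x)) :
  intersection_stalk i c x = @nonunits (stalk x) ->
  cd_stalk c (i x) = [set b * f | b in setT] ->
  eps ^+ n = 0 -> (forall a, comor_stalk a = 0 -> exists b, a = eps * b) ->
  [/\ is_ideal (@nonunits (stalk (i x))), nonunits f, nonunits eps &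
      forall a : stalk (i x), nonunits a -> exists b d, a = f * b + eps * d].
Proof.
move=> hB hf en ker.
have iB : is_ideal (@nonunits (stalk x)) by rewrite -hB; exact: ideal_gen_ideal.
have nuE (a : stalk (i x)) : nonunits a <-> @nonunits (stalk x) (comor_stalk a).
  by rewrite /nonunits /= comor_stalk_unit.
have [B0 BD BM] := iB.
have mem_gen b : cd_stalk c (i x) b -> nonunits (comor_stalk b).
  move=> [V [Vy [s [cs ->]]]]; rewrite -hB.
  rewrite (comor_stalkE (@preim_sub V) Vy (preim_in Vy)).
  exists [:: (1, germ_at (preim_in Vy) (comor (@preim_sub V) s))].
    move=> p; rewrite inE => /eqP -> /=.
    by exists V, (opens_preim i V), (@preim_sub V), (preim_in Vy), s; split.
  by rewrite big_seq1 mul1r.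
split.
- split; first by apply/nuE; rewrite comor_stalk0.
  + by move=> a b /nuE ha /nuE hb; apply/nuE; rewrite comor_stalkD; exact: BD.
  + by move=> a b /nuE hb; apply/nuE; rewrite comor_stalkM; exact: BM.
- by apply/nuE/mem_gen; rewrite hf; exists 1; rewrite ?mul1r.
- apply/nuE => -[b eb]; apply: (@stalk_nontrivial x).
  have := congr1 (fun t => t ^+ n) eb; rewrite exprMn -comor_stalkX en comor_stalk0 mul0r.
  by rewrite expr1n.
- move=> a /nuE; rewrite -hB => -[l hl ea].
  (* Surjectivity of the stalk map lifts the coefficients of the combination. *)
  have [g hg] : exists g, comor_stalk a = comor_stalk (f * g).
    rewrite ea {ea}; elim: l hl => [|p l IHl] hl.
      by exists 0; rewrite big_nil mulr0 comor_stalk0.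
    have [|g eg] := IHl; first by move=> q hq; apply: hl; rewrite inE hq orbT.
    rewrite big_cons eg.
    have [V [U [h [Ux [s [cs ->]]]]]] := hl p (mem_head _ _).
    have : cd_stalk c (i x) (germ_at (h x Ux) s) by exists V, (h x Ux), s.
    rewrite hf => -[b' _ eb']; have [b'' <-] := comor_stalk_surj p.1.
    exists (b'' * b' + g); rewrite -(comor_stalkE h (h x Ux)) -comor_stalkM -comor_stalkD.
    by rewrite -eb'; congr comor_stalk; ring.
  have [d ed] : exists d, a - f * g = eps * d.
    by apply: ker; rewrite comor_stalkD comor_stalkN hg subrr.
  by exists g, d; rewrite -ed; ring.
Qed.

End SpecialExtension.

(** * Cosets and Gelfand's trick *)

Section Cosets.
Variables (G : choiceType) (mul : G -> G -> G) (one : G) (inv : G -> G).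
Local Notation "x ** y" := (mul x y) (at level 40, left associativity).
Hypothesis mulA : forall x y z, x ** (y ** z) = x ** y ** z.
Hypothesis mul1g : forall x, one ** x = x.
Hypothesis mulVg : forall x, inv x ** x = one.
Implicit Types (x y z : G) (A H : set G) (s : seq G).

Lemma grp_mulKg x y : inv x ** (x ** y) = y.
Proof. by rewrite mulA mulVg mul1g. Qed.
Lemma grp_mulgV x : x ** inv x = one.
Proof. by rewrite -[LHS]mul1g -(mulVg (inv x)) -!mulA (mulA (inv x)) mulVg mul1g mulVg. Qed.
Lemma grp_mulg1 x : x ** one = x.
Proof. by rewrite -(mulVg x) mulA grp_mulgV mul1g. Qed.
Lemma grp_mulVKg x y : x ** (inv x ** y) = y.
Proof. by rewrite mulA grp_mulgV mul1g. Qed.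
Lemma grp_invgK x : inv (inv x) = x.
Proof. by rewrite -[LHS]grp_mulg1 -(mulVg x) grp_mulKg. Qed.
Lemma grp_mulgK x y : y ** x ** inv x = y.
Proof. by rewrite -mulA grp_mulgV grp_mulg1. Qed.
Lemma grp_mulgKV x y : y ** inv x ** x = y.
Proof. by rewrite -mulA mulVg grp_mulg1. Qed.
Lemma grp_invMg x y : inv (x ** y) = inv y ** inv x.
Proof.
by rewrite -[RHS]grp_mulg1 -(grp_mulgV (x ** y)) !mulA grp_mulgKV mulVg mul1g.
Qed.
Definition subgroup H : Prop :=
  [/\ H one, forall x y, H x -> H y -> H (x ** y) & forall x, H x -> H (inv x)].

Definition left_coset x H : set G := [set y | H (inv x ** y)].

Definition left_cosets s H : set G := [set y | exists2 x, x \in s & left_coset x H y].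

Definition stable A H : Prop := forall x k, A x -> H k -> A (x ** k).

Section Subgroup.
Variable H : set G.
Hypothesis Hgrp : subgroup H.

Lemma coset_refl x : left_coset x H x.
Proof. by rewrite /left_coset /= mulVg; case: Hgrp. Qed.

Lemma coset_sym x y : left_coset x H y -> left_coset y H x.
Proof. by have [_ _ HV] := Hgrp; move=> /HV; rewrite /left_coset /= grp_invMg grp_invgK. Qed.

Lemma coset_trans x y z : left_coset x H y -> left_coset y H z -> left_coset x H z.
Proof.
by have [_ HM _] := Hgrp; move=> /HM h /h; rewrite /left_coset /= mulA grp_mulgK.
Qed.

Lemma coset_stable A x y : stable A H -> left_coset x H y -> A x -> A y.
Proof. by move=> AH xy Ax; rewrite -(grp_mulVKg x y); exact: AH. Qed.

Definition inequivalent s : bool := pairwise (fun x y => ~~ `[< left_coset x H y >]) s.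

Definition coset_reps s A : Prop :=
  [/\ forall x, x \in s -> A x, inequivalent s & A `<=` left_cosets s H].

Lemma inequivalent_eq s x y : inequivalent s -> x \in s -> y \in s ->
  left_coset x H y -> x = y.
Proof.
elim: s => [//|a s IHs] /= /andP[/allP as_ inq]; rewrite !inE.
move=> /predU1P[->|xs] /predU1P[->|ys] // xy; last exact: IHs.
  by have /asboolPn := as_ y ys.
by have /asboolPn := as_ x xs; case; exact: coset_sym.
Qed.

Lemma inequivalent_uniq s : inequivalent s -> uniq s.
Proof.
elim: s => [//|a s IHs] /= /andP[/allP as_ /IHs ->]; rewrite andbT.
by apply/negP => /as_/asboolPn; apply; exact: coset_refl.
Qed.

Lemma thin_cosets s : exists t, [/\ forall x, x \in t -> x \in s, inequivalent t &
  left_cosets s H `<=` left_cosets t H].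
Proof.
elim: s => [|a s [t [ts it st]]]; first by exists [::]; split=> // x [].
have [[b bt ab]|na] := pselect (left_cosets t H a).
  exists t; split=> //; first by move=> x /ts; rewrite inE orbC => ->.
  move=> y [x]; rewrite inE => /predU1P[->|xs] xy; last by apply: st; exists x.
  by exists b => //; exact: coset_trans xy.
exists (a :: t); split=> /=.
- by move=> x; rewrite !inE => /predU1P[->|/ts ->]; rewrite ?eqxx ?orbT.
- rewrite /inequivalent /= -/(inequivalent t) it andbT.
  by apply/allP => b bt; apply/asboolPn => ab; apply: na; exists b => //; exact: coset_sym.
- move=> y [x]; rewrite inE => /predU1P[->|xs] xy; first by exists a; rewrite ?mem_head.
  have [|x' xt xy'] := st y; first by exists x.
  by exists x' => //; rewrite inE xt orbT.
Qed.

Lemma exists_coset_reps s : exists2 t, (forall x, x \in t -> x \in s) &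
  coset_reps t (left_cosets s H).
Proof.
have [t [ts it st]] := thin_cosets s; exists t => //; split=> // x /ts xs.
by exists x => //; exact: coset_refl.
Qed.

(** A partition of unity: an element of [A] lies in exactly one of the cosets, any other element in
    none. Sums over representatives are reindexed with it. The values lie in a mere additive monoid
    because masses are extended reals. *)
Lemma coset_reps_sum (V : nmodType) s A a (v : V) : stable A H -> coset_reps s A ->
  \sum_(x <- s) (if `[< left_coset x H a >] then v else 0) = if `[< A a >] then v else 0.
Proof.
move=> AH [sA inq As]; case: asboolP => [/As|nAa]; last first.
  rewrite big_seq big1 // => x xs; case: asboolP => // xa; case: nAa.
  exact: coset_stable xa (sA x xs).
elim: s {sA As} inq => [|b s IHs] /=; first by move=> _ [].
move=> /andP[/allP bs inq] [x]; rewrite inE big_cons => xs xa.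
case: asboolP => [ba|nba].
  rewrite big_seq big1 ?addr0 // => y ys; case: asboolP => // ya.
  have /asboolPn := bs y ys; case; exact: coset_trans ba (coset_sym ya).
rewrite add0r; apply: IHs => //; exists x => //.
by move/predU1P: xs => [e|//]; rewrite e in xa.
Qed.

End Subgroup.

(** * Gelfand's trick for an anti-involution preserving two double cosets *)

Section GelfandTrick.
Variables (K D D' : set G) (tr : G -> G).
Hypothesis Kgrp : subgroup K.
Hypotheses (trK : forall x, tr (tr x) = x) (trM : forall x y, tr (x ** y) = tr y ** tr x).
Hypotheses (K_tr : forall x, K x -> K (tr x)) (D_tr : forall x, D x -> D (tr x))
  (D'_tr : forall x, D' x -> D' (tr x)).
Hypotheses (KD : forall k x, K k -> D x -> D (k ** x)) (DK : stable D K).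
Hypotheses (KD' : forall k x, K k -> D' x -> D' (k ** x)) (D'K : stable D' K).
Hypothesis tr_mul : forall x y, D x -> D' y ->
  exists k k', [/\ K k, K k' & tr (x ** y) = k ** (x ** y) ** k'].
Variables (xs ys : seq G).
Hypotheses (xsD : coset_reps K xs D) (ysD' : coset_reps K ys D').
Variable V : nmodType.
Implicit Type v : V.

Let tr1 : tr one = one.
Proof. by rewrite -[LHS]grp_mulg1 -{2}(trK one) -trM grp_mulg1 trK. Qed.

Let trV x : tr (inv x) = inv (tr x).
Proof. by rewrite -[LHS]grp_mulg1 -(grp_mulgV (tr x)) mulA -trM grp_mulgV tr1 mul1g. Qed.

(* The coefficient of [zK] in the product of [D] and [D']. *)
Let count z v : V := \sum_(x <- xs) (if `[< D' (inv x ** z) >] then v else 0).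

Let count_mulr z k v : K k -> count (z ** k) v = count z v.
Proof.
have [_ _ KV] := Kgrp; move=> Kk; apply: eq_bigr => x _; congr (if _ then _ else _).
rewrite mulA; apply: asbool_equiv_eq; split=> [h|]; last by move/D'K; exact.
by rewrite -(grp_mulgK k (inv x ** z)); apply: D'K => //; exact: KV.
Qed.

(** Translation by [k] permutes the cosets [xK] in [D]. The permutation is kept as the relation [R],
    and the pairs in it are counted in both ways. *)
Let count_mull z k v : K k -> count (k ** z) v = count z v.
Proof.
have [K1 KM KV] := Kgrp; have [xs_D _ _] := xsD; move=> Kk.
pose R x x' := `[< left_coset x K (k ** x') >].
transitivity (\sum_(x <- xs) \sum_(x' <- xs) if R x x' then
    (if `[< D' (inv x' ** z) >] then v else 0) else 0).
  rewrite /count [LHS]big_seq [RHS]big_seq; apply: eq_bigr => x xx.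
  transitivity (\sum_(x' <- xs) if `[< left_coset x' K (inv k ** x) >]
      then (if `[< D' (inv x ** (k ** z)) >] then v else 0) else 0).
    rewrite (coset_reps_sum Kgrp _ _ DK xsD) [`[< D _ >]]asboolT //.
    by apply: KD; [exact: KV|exact: xs_D].
  apply: eq_bigr => x' _; rewrite /R.
  have -> : `[< left_coset x' K (inv k ** x) >] = `[< left_coset x K (k ** x') >].
    apply: asbool_equiv_eq; split=> h.
      by have := KV _ h; rewrite /left_coset /= !grp_invMg !grp_invgK -!mulA.
    by have := KV _ h; rewrite /left_coset /= !grp_invMg !grp_invgK -!mulA.
  case: asboolP => // h; congr (if _ then _ else _).
  have e : inv x ** (k ** z) = (inv x ** (k ** x')) ** (inv x' ** z).
    by rewrite -!mulA grp_mulVKg.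
  apply: asbool_equiv_eq; rewrite e; split=> h'; last exact: KD'.
  by rewrite -(grp_mulKg (inv x ** (k ** x')) (inv x' ** z)); apply: KD' => //; exact: KV.
rewrite exchange_big /= /count big_seq [RHS]big_seq; apply: eq_bigr => x' xx'.
rewrite (coset_reps_sum Kgrp _ _ DK xsD) [`[< D _ >]]asboolT //.
by apply: KD => //; exact: xs_D.
Qed.

(** The count depends only on the double coset of [z], so [z] may be replaced by [tr z]. Both sides
    then count the pairs [(x, y)] with [x^-1 (tr z) (tr y)^-1] in [K]: transposing this condition
    turns it into [y^-1 z (tr x)^-1] in [K]. *)
Lemma gelfand_count z v : (exists x y, [/\ D x, D' y & z = x ** y \/ z = y ** x]) ->
  \sum_(x <- xs) (if `[< D' (inv x ** z) >] then v else 0) =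
  \sum_(y <- ys) (if `[< D (inv y ** z) >] then v else 0).
Proof.
have [K1 KM KV] := Kgrp.
have [xs_D _ _] := xsD; have [ys_D' _ _] := ysD'.
move=> [x0 [y0 [Dx0 D'y0 ez]]]; rewrite -/(count z v).
have [k [k' [Kk Kk' e]]] : exists k k', [/\ K k, K k' & tr z = k ** z ** k'].
  case: ez => ->; first exact: tr_mul.
  (* Here [z = y x], and [tr x ** tr y = tr z]. The hypothesis gives [z = k (tr z) k'], which is
     solved for [tr z]. *)
  have [k [k' [Kk Kk' e]]] := tr_mul (D_tr Dx0) (D'_tr D'y0).
  exists (inv k), (inv k'); split; [exact: KV|exact: KV|].
  by move: e; rewrite -trM trK => {2}->; rewrite -!mulA grp_mulgV grp_mulg1 grp_mulKg.
rewrite -(count_mull z v Kk) -(count_mulr (k ** z) v Kk') -e /count.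
pose Q x y := `[< left_coset x K (tr z ** inv (tr y)) >].
transitivity (\sum_(x <- xs) \sum_(y <- ys) if Q x y then v else 0).
  rewrite big_seq [RHS]big_seq; apply: eq_bigr => x xx.
  rewrite -(asbool_equiv_eq (P := D' (tr (inv x ** tr z)))); last first.
    by split=> /D'_tr; rewrite ?trK.
  rewrite -(coset_reps_sum Kgrp _ _ D'K ysD'); apply: eq_bigr => y _.
  congr (if _ then _ else _); apply: asbool_equiv_eq; rewrite /left_coset /=.
  by split=> /K_tr; rewrite !(trM, trV, trK) !mulA.
rewrite exchange_big /= big_seq [RHS]big_seq; apply: eq_bigr => y yy.
rewrite (coset_reps_sum Kgrp _ _ DK xsD); congr (if _ then _ else _).
rewrite -trV -trM; apply: asbool_equiv_eq.
by split=> /D_tr; rewrite ?trK.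
Qed.

(** Products are grouped by the coset [zK] containing them, on which [phi] is constant. The
    multiplicity of [zK] is then a count on either side, and the two agree by [gelfand_count]. *)
Lemma gelfand_sum (phi : G -> V) :
  (forall x y k, D x -> D' y -> K k -> phi (x ** y ** k) = phi (x ** y)) ->
  (forall x y k, D x -> D' y -> K k -> phi (y ** x ** k) = phi (y ** x)) ->
  \sum_(x <- xs) \sum_(y <- ys) phi (x ** y) = \sum_(y <- ys) \sum_(x <- xs) phi (y ** x).
Proof.
move=> hphi hphi'.
have [xs_D _ _] := xsD; have [ys_D' _ _] := ysD'.
have [zs zsub zsT] := exists_coset_reps Kgrp
  ([seq x ** y | x <- xs, y <- ys] ++ [seq y ** x | x <- xs, y <- ys]).
set P := left_cosets _ K in zsT.
have Pst : stable P K.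
  move=> x k [a aa xa] Kk; exists a => //; rewrite /left_coset /= mulA.
  by have [_ KM _] := Kgrp; exact: KM.
have zsP z : z \in zs -> exists x y, [/\ D x, D' y & z = x ** y \/ z = y ** x].
  move=> /zsub; rewrite mem_cat => /orP[] /allpairsP[[x y] /= [xx yy ->]]; exists x, y.
    by split; [exact: xs_D|exact: ys_D'|left].
  by split; [exact: xs_D|exact: ys_D'|right].
have phiE z a : z \in zs -> left_coset z K a -> phi a = phi z.
  move=> /zsP[x [y [Dx D'y e]]] za; rewrite -(grp_mulVKg z a).
  by case: e za => -> za; [apply: hphi|apply: hphi'].
have phi_sum a : P a -> phi a = \sum_(z <- zs) if `[< left_coset z K a >] then phi z else 0.
  move=> Pa; have := coset_reps_sum Kgrp a (phi a) Pst zsT.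
  rewrite asboolT // => <-; rewrite big_seq [RHS]big_seq; apply: eq_bigr => z zz.
  by case: asboolP => // /(phiE _ _ zz).
have Pxy x y : x \in xs -> y \in ys -> P (x ** y).
  move=> xx yy; exists (x ** y); last exact: coset_refl.
  by rewrite mem_cat; apply/orP; left; apply: allpairs_f.
have Pyx x y : x \in xs -> y \in ys -> P (y ** x).
  move=> xx yy; exists (y ** x); last exact: coset_refl.
  by rewrite mem_cat; apply/orP; right; apply/allpairsP; exists (x, y).
have flip a b z : `[< left_coset z K (a ** b) >] = `[< left_coset b K (inv a ** z) >].
  by apply: asbool_equiv_eq; split=> /(coset_sym Kgrp);
    rewrite /left_coset /= grp_invMg ?grp_invgK -!mulA ?grp_invMg ?grp_invgK ?mulA.
transitivity (\sum_(z <- zs) \sum_(x <- xs) if `[< D' (inv x ** z) >] then phi z else 0).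
  rewrite [RHS]exchange_big /= big_seq [RHS]big_seq; apply: eq_bigr => x xx.
  transitivity (\sum_(y <- ys) \sum_(z <- zs) if `[< left_coset z K (x ** y) >] then phi z else 0).
    by rewrite big_seq [RHS]big_seq; apply: eq_bigr => y yy; apply/phi_sum/Pxy.
  rewrite exchange_big; apply: eq_bigr => z _.
  rewrite -(coset_reps_sum Kgrp _ _ D'K ysD'); apply: eq_bigr => y _.
  by rewrite flip.
transitivity (\sum_(z <- zs) \sum_(y <- ys) if `[< D (inv y ** z) >] then phi z else 0).
  by rewrite big_seq [RHS]big_seq; apply: eq_bigr => z /zsP; exact: gelfand_count.
rewrite exchange_big /= big_seq [RHS]big_seq; apply: eq_bigr => y yy.
transitivity (\sum_(x <- xs) \sum_(z <- zs) if `[< left_coset z K (y ** x) >] then phi z else 0).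
  rewrite exchange_big; apply: eq_bigr => z _.
  rewrite -(coset_reps_sum Kgrp _ _ DK xsD); apply: eq_bigr => x _.
  by rewrite -flip.
by rewrite big_seq [RHS]big_seq; apply: eq_bigr => x xx; apply/esym/phi_sum/Pyx.
Qed.

End GelfandTrick.

End Cosets.

(** * Haar measures and convolution *)

Section NonmeasurableIntegral.
Local Open Scope ereal_scope.
Context d (T : measurableType d) (R : realType).
Variable mu : {measure set T -> \bar R}.

(** No measurability is involved: the integral of a nonnegative function is a supremum over the
    simple functions below it. *)
Lemma ge0_le_integralT (f g : T -> \bar R) : (forall x, 0 <= f x) ->
  (forall x, f x <= g x) -> \int[mu]_x f x <= \int[mu]_x g x.
Proof.
move=> f0 fg; have g0 x : 0 <= g x by exact: le_trans (f0 x) (fg x).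
rewrite !ge0_integralTE //; apply: ge_ereal_sup => _ [h hf <-].
by apply: ereal_sup_ubound; exists h => // x; exact: le_trans (hf x) (fg x).
Qed.

(* [f] is not assumed measurable off the cells: the function [x |-> m' (x^-1 E)] of a
   convolution is only controlled on the support of [m]. *)
Lemma integral_cells (I : eqType) (s : seq I) (F : I -> set T) (f : T -> \bar R) (v : I -> R) :
  (forall i, i \in s -> measurable (F i)) ->
  (forall i j x, i \in s -> j \in s -> F i x -> F j x -> i = j) -> uniq s ->
  mu (~` [set x | exists2 i, i \in s & F i x]) = 0 ->
  (forall x, 0 <= f x) -> (forall i x, i \in s -> F i x -> f x = (v i)%:E) ->
  \int[mu]_x f x = \sum_(i <- s) (v i)%:E * mu (F i).
Proof.
move=> mF tF us muN f0 fv.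
set U := [set x | _] in muN.
have mU : measurable U.
  have -> : U = \bigcup_(i in [set` s]) F i.
    by apply/seteqP; split=> x [i si Fi]; exists i.
  by apply: fin_bigcup_measurable => // i; exact: mF.
pose F' i := if i \in s then F i else set0.
have mF' i : measurable (F' i) by rewrite /F'; case: ifP => // /mF.
(* On a nonempty cell [v i] is a value of [f], hence nonnegative, but it is arbitrary when the cell
   is empty. *)
pose v' i := Num.max (v i) 0%R.
have v'0 i : (0 <= v' i)%R by rewrite /v' le_max lexx orbT.
have fv' i x : i \in s -> F i x -> f x = (v' i)%:E.
  move=> si Fx; rewrite (fv i x si Fx); congr EFin; rewrite /v'; apply/esym/max_idPl.
  by rewrite -lee_fin -(fv i x si Fx).
pose g x := \sum_(i <- s) (v' i)%:E * (\1_(F' i) x)%:E.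
have gE x : U x -> g x = f x.
  move=> [i si Fx]; rewrite (fv' i x si Fx) /g (bigD1_seq i) //=.
  rewrite big_seq_cond big1 => [|j /andP[sj ji]].
    by rewrite adde0 /F' si indicE mem_set // mule1.
  rewrite /F' sj indicE memNset ?mule0 // => Fj; move/eqP: ji; apply.
  exact: (tF j i x).
have gN x : ~ U x -> g x = 0.
  move=> nU; rewrite /g big_seq big1 // => i si; rewrite /F' si indicE memNset ?mule0 //.
  by move=> Fi; apply: nU; exists i.
have mI A : measurable A -> measurable_fun [set: T] (fun x => (\1_A x : R)%:E).
  by move=> mA; apply/measurable_EFinP; exact: measurable_indic.
have mt i : measurable_fun [set: T] (fun x => (v' i)%:E * (\1_(F' i) x)%:E).
  by apply: measurable_funeM; exact: mI.
have t0 i x : 0 <= (v' i)%:E * (\1_(F' i) x)%:E.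
  by rewrite mule_ge0 // lee_fin ?v'0 // indicE.
have intg : \int[mu]_x g x = \sum_(i <- s) (v i)%:E * mu (F i).
  rewrite ge0_integral_sum // big_seq [RHS]big_seq; apply: eq_bigr => i si.
  rewrite ge0_integralZl_EFin //; last by exact: mI.
  rewrite integral_indic // setIT /F' si.
  have [->|/set0P[x Fx]] := eqVneq (F i) set0; first by rewrite measure0 !mule0.
  by rewrite -(fv' i x si Fx) (fv i x si Fx).
(* [f] is squeezed between the simple function [g] and [g + oo * 1_N], which have the same integral
   because [N] is null. *)
pose N := ~` U.
have mN : measurable N by exact: measurableC.
pose g2 x := g x + (fun x => +oo * (\1_N x)%:E) x.
have mg : measurable_fun [set: T] g.
  by rewrite /g; apply: emeasurable_sum => i; exact: mt.
have g0 x : 0 <= g x by exact: sume_ge0.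
have n0 x : 0 <= +oo * (\1_N x)%:E :> \bar R by rewrite mule_ge0 // lee_fin indicE.
have mn : measurable_fun [set: T] (fun x => +oo * (\1_N x : R)%:E).
  by apply: measurable_funeM; exact: mI.
have intg2 : \int[mu]_x g2 x = \sum_(i <- s) (v i)%:E * mu (F i).
  rewrite ge0_integralD // intg [X in _ + X](_ : _ = 0) ?adde0 //.
  rewrite (eq_integral ((cst +oo) \_ N)); last first.
    move=> x _; rewrite /patch indicE; case: ifP => _; first by rewrite mule1.
    by rewrite mule0.
  by rewrite -integral_mkcond integral_cst // muN mule0.
apply/eqP; rewrite eq_le; apply/andP; split.
  rewrite -intg2; apply: ge0_le_integralT => // x; rewrite /g2.
  have [Ux|nUx] := pselect (U x); first by rewrite gE // leeDl.
  by rewrite indicE mem_set // mule1 gN // add0e leey.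
rewrite -intg; apply: ge0_le_integralT => // x.
have [Ux|nUx] := pselect (U x); first by rewrite gE.
by rewrite gN.
Qed.

End NonmeasurableIntegral.

Section Measures.
Variables (R : realType) (G : ptopologicalType).
Variables (mul : G -> G -> G) (one : G) (inv : G -> G).
Local Notation "x ** y" := (mul x y) (at level 40, left associativity).
Hypothesis mulA : forall x y z, x ** (y ** z) = x ** y ** z.
Hypothesis mul1g : forall x, one ** x = x.
Hypothesis mulVg : forall x, inv x ** x = one.
Local Notation BG := (g_sigma_algebraType (@open G)).
Local Notation coset := (left_coset mul inv).
Local Notation cosets := (left_cosets mul inv).
Local Notation subgroup := (subgroup mul one inv).
Local Notation stable := (stable mul).
Local Notation coset_reps := (coset_reps mul inv).
Local Notation inequivalent := (inequivalent mul inv).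
Implicit Types (x y z : G) (m : {measure set BG -> \bar R}).

Local Open Scope ereal_scope.

Definition inner_regular m (U : set BG) : Prop := m U = ereal_sup
  [set m L | L in [set L : set BG | [/\ measurable L, compact (L : set G) & L `<=` U]]].

Lemma open_measurable_borel (U : set G) : open U -> measurable (U : set BG).
Proof. exact: sub_sigma_algebra. Qed.

Lemma inner_regular_pos m U : inner_regular m U -> 0 < m U ->
  exists L : set BG, [/\ measurable L, compact (L : set G), L `<=` U & 0 < m L].
Proof.
move=> reg pos; apply: contrapT => h.
suff : m U <= 0 by rewrite leNgt pos.
rewrite reg; apply: ge_ereal_sup => _ [L [mL cL LU] <-].
by rewrite leNgt; apply/negP => Lpos; apply: h; exists L.
Qed.

Section CosetReps.
Variable H : set G.
Hypothesis Hgrp : subgroup H.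

Lemma cosets_cons x s : cosets (x :: s) H = coset x H `|` cosets s H.
Proof.
apply/seteqP; split=> y.
  by move=> [z]; rewrite inE => /predU1P[->|zs] zy; [left|right; exists z].
move=> [xy|[z zs zy]]; first by exists x; rewrite ?mem_head.
by exists z; rewrite // inE zs orbT.
Qed.

Lemma measurable_cosets s : (forall x, x \in s -> measurable (coset x H : set BG)) ->
  measurable (cosets s H : set BG).
Proof.
elim: s => [|x s IHs] ms.
  have -> : cosets [::] H = set0 by apply/seteqP; split=> y // [].
  exact: measurable0.
rewrite cosets_cons; apply: measurableU; first by apply: ms; rewrite mem_head.
by apply: IHs => y ys; apply: ms; rewrite inE ys orbT.
Qed.

Lemma measure_cosets m s (E : set BG) : measurable E ->
  (forall x, x \in s -> measurable (coset x H : set BG)) -> inequivalent H s ->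
  m (E `&` cosets s H) = \sum_(x <- s) m (E `&` coset x H).
Proof.
move=> mE; elim: s => [|x s IHs] ms.
  have -> : cosets [::] H = set0 by apply/seteqP; split=> y // [].
  by rewrite setI0 measure0 big_nil.
move=> /= /andP[/allP xs inq].
have ms' y : y \in s -> measurable (coset y H : set BG).
  by move=> ys; apply: ms; rewrite inE ys orbT.
have mx : measurable (coset x H : set BG) by apply: ms; rewrite mem_head.
rewrite big_cons cosets_cons setIUr measureU.
- by rewrite -IHs.
- exact: measurableI.
- by apply: measurableI => //; exact: measurable_cosets.
apply/seteqP; split=> // y [[_ xy] [_ [z zs zy]]].
have /asboolPn := xs z zs; case.
exact: (coset_trans mulA mul1g mulVg Hgrp xy (coset_sym mulA mul1g mulVg Hgrp zy)).
Qed.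

Lemma compact_cosets (L : set BG) (A : set G) : compact (L : set G) -> L `<=` A ->
  (forall x, A x -> open (coset x H)) ->
  exists s, [/\ forall x, x \in s -> A x, inequivalent H s & L `<=` cosets s H].
Proof.
rewrite compact_cover => cL LA oH.
have [|D' D'A LD'] := cL G A (fun x => coset x H) oH.
  by move=> x /LA Ax; exists x => //; exact: (coset_refl mulVg Hgrp).
have [s [sD inq Ds]] := thin_cosets mulA mul1g mulVg Hgrp (finmap.enum_fset D').
exists s; split=> //.
  move=> x /sD xD; exact: set_mem (D'A x xD).
by move=> x /LD'[y yD yx]; apply: Ds; exists y.
Qed.

Variables (m : {measure set BG -> \bar R}) (A : set G) (w : \bar R).
Hypotheses (AH : stable A H) (oH : forall x, A x -> open (coset x H)).
Hypothesis mw : forall x, A x -> m (coset x H) = w.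

Let mH x : A x -> measurable (coset x H : set BG).
Proof. by move=> /oH; exact: open_measurable_borel. Qed.

Lemma measure_equal_cosets s : (forall x, x \in s -> A x) -> inequivalent H s ->
  m (cosets s H) = (size s)%:R%:E * w.
Proof.
move=> sA inq; rewrite -[cosets s H](setTI _) measure_cosets //; last by move=> x /sA/mH.
rewrite big_seq (eq_bigr (fun=> w)) => [|x /sA/mw]; last by rewrite setTI.
rewrite -big_seq big_const_seq count_predT; elim: (size s) => [|k IHk] /=.
  by rewrite mul0e.
by rewrite IHk -[w in w + _]mul1e -ge0_muleDl ?lee_fin // -EFinD -natr1 addrC.
Qed.

(** Inner regularity yields a compact set of positive mass, covered by finitely many cosets, so the
    common mass [w] is positive. As [m A] is finite, this bounds the number of inequivalent cosets,
    and a list of maximal length must cover [A]. *)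
Lemma finite_coset_reps : open A -> m A < +oo -> 0 < m A -> inner_regular m A ->
  exists s, coset_reps H s A.
Proof.
move=> oA fA pA rA; have [L [mL cL LA Lpos]] := inner_regular_pos rA pA.
have [s0 [s0A inq0 Ls0]] := compact_cosets cL LA oH.
have mono s : (forall x, x \in s -> A x) -> inequivalent H s -> (size s)%:R%:E * w <= m A.
  move=> sA inq; rewrite -measure_equal_cosets //.
  apply: le_measure.
  - by apply/mem_set; apply: measurable_cosets => x xs; exact: (mH (sA x xs)).
  - by apply/mem_set; exact: open_measurable_borel.
  - by move=> y [x /sA Ax xy]; exact: (coset_stable mulA mul1g mulVg AH xy Ax).
have w0 : 0 <= w.
  case: s0 s0A inq0 Ls0 => [|x s0] s0A _ Ls0; last by rewrite -(mw (s0A x (mem_head _ _))).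
  suff : m L = 0 by move=> e; rewrite e ltxx in Lpos.
  by rewrite (_ : L = set0) ?measure0 //; apply/seteqP; split=> // y /Ls0[].
have wpos : 0 < w.
  rewrite lt_neqAle w0 andbT; apply/eqP => ew.
  have : m L <= m (cosets s0 H).
    apply: le_measure => //; apply/mem_set => //.
    by apply: measurable_cosets => x xs; exact: (mH (s0A x xs)).
  by rewrite measure_equal_cosets // -ew mule0 leNgt Lpos.
have wfin : w \is a fin_num.
  rewrite ge0_fin_numE //; case: s0 s0A inq0 Ls0 => [|x s0] s0A _ Ls0.
    suff : m L = 0 by move=> e; rewrite e ltxx in Lpos.
    by rewrite (_ : L = set0) ?measure0 //; apply/seteqP; split=> // y /Ls0[].
  apply: le_lt_trans fA; have := mono [:: x]; rewrite mul1e; apply=> //.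
  by move=> y; rewrite inE => /eqP ->; apply: s0A; rewrite mem_head.
have Afin : m A \is a fin_num by rewrite ge0_fin_numE.
pose P n := `[< exists s, [/\ size s = n, forall x, x \in s -> A x & inequivalent H s] >].
have exP : exists n, P n by exists 0%N; apply/asboolP; exists [::].
have bndP n : P n -> (n <= (Num.trunc (fine (m A) / fine w)).+1)%N.
  move=> /asboolP[s [<- sA inq]]; have := mono s sA inq.
  rewrite -(fineK wfin) -(fineK Afin) -EFinM lee_fin => h.
  have wr : (0 < fine w)%R by apply: fine_gt0; rewrite wpos -ge0_fin_numE.
  rewrite -(ler_nat R); apply/ltW/(le_lt_trans _ (truncnS_gt _)).
  by rewrite ler_pdivlMr.
have [n /asboolP[s [sn sA inq]] max_n] := ex_maxnP exP bndP.
exists s; split=> // a Aa; apply: contrapT => na.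
have : P n.+1.
  apply/asboolP; exists (a :: s); split.
  - by rewrite /= sn.
  - by move=> x; rewrite inE => /predU1P[->|/sA].
  - rewrite /inequivalent /= -/(inequivalent H s) inq andbT.
    apply/allP => b bs; apply/asboolPn => ab; apply: na; exists b => //.
    exact: (coset_sym mulA mul1g mulVg Hgrp ab).
by move/max_n; rewrite ltnn.
Qed.

Lemma coset_reps_measure s : coset_reps H s A -> m A = (size s)%:R%:E * w.
Proof.
move=> [sA inq As]; rewrite -measure_equal_cosets //; congr (m _).
apply/seteqP; split=> // y [x /sA Ax xy].
exact: (coset_stable mulA mul1g mulVg AH xy Ax).
Qed.

End CosetReps.

(* Only left translations by some elements are known to be continuous. *)
Definition tame x : Prop := forall U : set G, open U -> open [set y | U (x ** y)].

Lemma tame_measurable x (E : set BG) : tame x -> measurable E ->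
  measurable ([set y | E (x ** y)] : set BG).
Proof.
move=> tx mE; have mf : @measurable_fun _ _ BG BG setT (mul x).
  apply: (@measurability _ _ BG BG setT (mul x) (@open G)) => // _ [U oU <-].
  by rewrite setTI; apply: open_measurable_borel; exact: tx.
by rewrite -[X in measurable X]setTI; exact: mf.
Qed.

Lemma tame_coset_open H x : tame (inv x) -> open H -> open (coset x H).
Proof. by move=> tx oH; exact: tx. Qed.

Section Translate.
Variable m : {measure set BG -> \bar R}.
Variables (x : G) (tx : tame (inv x)).

(** The measure [E |-> m (x E)], which moves the part of [m] on [xK] to [K]. Tameness is an argument
    because the measure structure declared below depends on it. *)
Definition translate of tame (inv x) : set BG -> \bar R :=
  fun E => m [set y | E (inv x ** y)].

Let translate0 : translate tx set0 = 0.
Proof. by rewrite /translate (_ : [set y | _] = set0) ?measure0. Qed.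

Let translate_ge0 E : 0 <= translate tx E.
Proof. exact: measure_ge0. Qed.

Let translate_sigma_additive : semi_sigma_additive (translate tx).
Proof.
move=> F mF tF mUF; rewrite /translate.
have -> : [set y | (\bigcup_n F n) (inv x ** y)] = \bigcup_n [set y | F n (inv x ** y)].
  by apply/seteqP; split=> y [n _ Fy]; exists n.
apply: measure_semi_sigma_additive.
- by move=> n; exact: tame_measurable.
- apply/trivIsetP => i j _ _ ij; apply/seteqP; split=> // y [Fi Fj].
  move/trivIsetP : tF => /(_ i j I I ij) e.
  by have : (F i `&` F j) (inv x ** y) by []; rewrite e.
- apply: bigcup_measurable => n _; exact: tame_measurable.
Qed.

HB.instance Definition _ := isMeasure.Build _ _ _
  (translate tx) translate0 translate_ge0 translate_sigma_additive.

End Translate.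

(** * Uniqueness of Haar measure on [K], by means of normal open subgroups *)

Section Haar.
Variables (K : set G) (I : Type) (Kn : I -> set G).
Hypothesis Kgrp : subgroup K.
Hypothesis Kn_grp : forall n, subgroup (Kn n).
Hypothesis Kn_sub : forall n, Kn n `<=` K.
Hypothesis Kn_normal : forall n v x, K v -> Kn n x -> Kn n (inv v ** x ** v).
Hypotheses (K_open : open K) (Kn_open : forall n, open (Kn n)).
Hypothesis Kn_base : forall U : set G, open U -> U one -> exists n, Kn n `<=` U.
Hypothesis K_tame : forall x, K x -> tame x.

(** Invariance is required under right translations, which commute with the left translations used
    to move measures to [K]. *)
Definition haar_measure m : Prop :=
  [/\ m setT < +oo, forall U : set G, open U -> inner_regular m U &
      forall k (E : set BG), K k -> measurable E -> m [set x | E (x ** inv k)] = m E].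

Let Kn_coset_open n v : K v -> open (coset v (Kn n)).
Proof. by move=> Kv; apply: tame_coset_open => //; apply: K_tame; case: Kgrp => _ _; apply. Qed.

(** By normality [v Kn] is also the coset [Kn v], a right translate of [Kn]. *)
Lemma haar_coset m n v : haar_measure m -> K v -> m (coset v (Kn n)) = m (Kn n).
Proof.
move=> [_ _ inv_m] Kv; rewrite -[RHS](inv_m v); [|by []|exact: open_measurable_borel].
have [_ _ KV] := Kgrp; congr (m _); apply/seteqP; split=> y h.
  have := Kn_normal (KV _ Kv) h; rewrite (grp_invgK mulA mul1g mulVg).
  by rewrite (grp_mulVKg mulA mul1g mulVg).
by have := Kn_normal Kv h; rewrite mulA (grp_mulgKV mulA mul1g mulVg).
Qed.

Lemma Kn_stable n : stable K (Kn n).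
Proof. by have [_ KM _] := Kgrp; move=> x k Kx /Kn_sub; exact: KM. Qed.

Lemma haar_fin m E : haar_measure m -> measurable E -> m E \is a fin_num.
Proof.
move=> [fm _ _] mE; rewrite ge0_fin_numE //; apply: le_lt_trans fm.
by apply: le_measure => //; apply/mem_set.
Qed.

Lemma haar_index m n : haar_measure m -> 0 < m K ->
  exists s, coset_reps (Kn n) s K.
Proof.
move=> hm pK; have [fm reg _] := hm.
apply: (finite_coset_reps (Kn_grp n) (m := m) (w := m (Kn n))) => //.
- exact: Kn_stable.
- by move=> v; exact: Kn_coset_open.
- by move=> v; exact: haar_coset.
- by rewrite -ge0_fin_numE //; apply: (haar_fin hm); exact: open_measurable_borel.
- exact: reg.
Qed.

Lemma haar_proportional_Kn m1 m2 n : haar_measure m1 -> haar_measure m2 ->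
  0 < m1 K -> m1 (Kn n) * m2 K = m2 (Kn n) * m1 K.
Proof.
move=> h1 h2 p1; have [s hs] := haar_index n h1 p1.
rewrite (coset_reps_measure (Kn_grp n) (m := m1) (w := m1 (Kn n)) (@Kn_stable n) _ _ hs).
- rewrite (coset_reps_measure (Kn_grp n) (m := m2) (w := m2 (Kn n)) (@Kn_stable n) _ _ hs).
  + by rewrite muleCA [RHS]muleCA [m2 _ * _]muleC.
  + by move=> v; exact: Kn_coset_open.
  + by move=> v; exact: haar_coset.
- by move=> v; exact: Kn_coset_open.
- by move=> v; exact: haar_coset.
Qed.

Lemma Kn_common (s : seq G) (f : G -> I) : exists n, forall x, x \in s -> Kn n `<=` Kn (f x).
Proof.
elim: s => [|x s [n hn]].
  by have [n _] := Kn_base K_open (let: And3 h _ _ := Kgrp in h); exists n.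
have [|n' hn'] := Kn_base (openI (Kn_open n) (Kn_open (f x))).
  by split; [case: (Kn_grp n)|case: (Kn_grp (f x))].
exists n' => y; rewrite in_cons => /predU1P[->|ys] z /hn'[zn zx] //.
exact: (hn y ys).
Qed.

(** A compact subset of [U] is covered by finitely many cosets of a single [Kn] that are contained
    in [U]. On such a union both measures are proportional to the number of cosets. *)
Lemma haar_le m1 m2 (U : set G) : haar_measure m1 -> haar_measure m2 ->
  0 < m1 K -> 0 < m2 K -> open U -> U `<=` K -> m1 U * m2 K <= m2 U * m1 K.
Proof.
move=> h1 h2 p1 p2 oU UK.
have mK : measurable (K : set BG) by exact: open_measurable_borel.
have mU : measurable (U : set BG) by exact: open_measurable_borel.
have f1 := haar_fin h1 mK; have f2 := haar_fin h2 mK.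
have [_ reg1 _] := h1.
have r2 : (0 < fine (m2 K))%R by apply: fine_gt0; rewrite p2 -ge0_fin_numE.
rewrite -[m2 K]fineK // -lee_pdivlMr // reg1 //; apply: ge_ereal_sup => _ [L [mL cL LU] <-].
rewrite lee_pdivlMr // fineK //.
have /choice[f hf] u : exists n, U u -> coset u (Kn n) `<=` U.
  have [Uu|nU] := pselect (U u); last first.
    by have [n _] := Kn_base K_open (let: And3 h _ _ := Kgrp in h); exists n => /nU.
  have [||n hn] := Kn_base (U := [set y | U (u ** y)]).
  - by apply: K_tame => //; exact: UK.
  - by rewrite /= (grp_mulg1 mulA mul1g mulVg).
  exists n => _ y /hn /=; by rewrite (grp_mulVKg mulA mul1g mulVg).
move: (cL); rewrite compact_cover => /(_ G U (fun u => coset u (Kn (f u)))) [].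
- by move=> u Uu; exact/Kn_coset_open/UK.
- move=> u /LU Uu; exists u => //; exact: (coset_refl mulVg (Kn_grp _)).
move=> D' D'U LD'; have [n hn] := Kn_common (finmap.enum_fset D') f.
(* Unlike [U], this neighbourhood of [L] is stable under the common subgroup [Kn n]. *)
pose V := [set y | exists2 u, u \in finmap.enum_fset D' & coset u (Kn (f u)) y].
have VU : V `<=` U by move=> y [u uD /hf]; apply; exact: set_mem (D'U u uD).
have LV : L `<=` V by move=> y /LD'[u uD uy]; exists u.
have Vst : stable V (Kn n).
  move=> y k [u uD uy] Kk; exists u => //; rewrite /left_coset /= mulA.
  by have [_ KM _] := Kn_grp (f u); apply: KM => //; exact: hn Kk.
have VK y : V y -> K y by move=> /VU/UK.
have oV y : V y -> open (coset y (Kn n)) by move=> /VK; exact: Kn_coset_open.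
have [s [sV inq Ls]] := compact_cosets (Kn_grp n) cL LV oV.
have ms : measurable (cosets s (Kn n) : set BG).
  by apply: measurable_cosets => y ys; apply: open_measurable_borel; exact: oV (sV y ys).
have e m : haar_measure m -> m (cosets s (Kn n)) = (size s)%:R%:E * m (Kn n).
  move=> hm; apply: (measure_equal_cosets (Kn_grp n) (A := V)) => //.
  by move=> y /VK Ky; exact: haar_coset.
apply: (@le_trans _ _ (m1 (cosets s (Kn n)) * m2 K)).
  by apply: lee_wpmul2r => //; apply: le_measure => //; apply/mem_set.
apply: (@le_trans _ _ (m2 (cosets s (Kn n)) * m1 K)).
  by rewrite !e // -!muleA haar_proportional_Kn.
apply: lee_wpmul2r => //; apply: le_measure; [exact: mem_set|exact: mem_set|].
move=> y [x /sV Vx xy]; apply: VU.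
exact: (coset_stable mulA mul1g mulVg Vst xy Vx).
Qed.

(** After cross multiplication the two measures agree on open sets, by [haar_le] in both directions,
    and open sets are stable under intersection and generate the Borel sets. *)
Lemma haar_unique m1 m2 (E : set BG) : haar_measure m1 -> haar_measure m2 ->
  0 < m1 K -> 0 < m2 K -> measurable E -> E `<=` K -> m1 E * m2 K = m2 E * m1 K.
Proof.
move=> h1 h2 p1 p2 mE EK.
have mK : measurable (K : set BG) by exact: open_measurable_borel.
have f1 := haar_fin h1 mK; have f2 := haar_fin h2 mK.
have r1 : (0 <= fine (m1 K))%R by exact: fine_ge0.
have r2 : (0 <= fine (m2 K))%R by exact: fine_ge0.
pose m1' := mscale (NngNum r2) (mrestr m1 mK).
pose m2' := mscale (NngNum r1) (mrestr m2 mK).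
have e1 A : m1' A = m2 K * m1 (A `&` K) by rewrite -[m2 K in RHS]fineK.
have e2 A : m2' A = m1 K * m2 (A `&` K) by rewrite -[m1 K in RHS]fineK.
suff : m1' E = m2' E by rewrite e1 e2 (setIidl EK) muleC => ->; rewrite muleC.
apply: (@measure_unique _ R BG (@open G) (fun=> setT)) => //.
- by move=> A B; exact: openI.
- by move=> _; exact: openT.
- by apply/seteqP; split=> // y _; exists 0%N.
- move=> A oA; rewrite [LHS]e1 [RHS]e2.
  have oAK : open (A `&` K) by exact: openI.
  rewrite muleC [RHS]muleC; apply/eqP; rewrite eq_le.
  by rewrite !haar_le //; move=> y [].
- move=> _; rewrite [X in X < _]e1 setTI -(fineK f1) -(fineK f2) -EFinM.
  exact: ltry.
Qed.

Definition hecke_like m : Prop :=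
  [/\ m setT < +oo, forall E : set BG, measurable E -> inner_regular m E &
      forall (u : G) (E : set BG), K u -> measurable E ->
        m [set u ** x | x in E] = m E /\ m [set x ** u | x in E] = m E].

Definition characteristic d m : Prop :=
  [/\ hecke_like m, m setT = 1 & m (~` [set u ** d ** v | u in K & v in K]) = 0].

Lemma tame_mul x y : tame x -> tame y -> tame (x ** y).
Proof.
move=> tx ty U oU; have := ty _ (tx _ oU); congr open.
by apply/seteqP; split=> z /=; rewrite mulA.
Qed.

Lemma hecke_left m k (E : set BG) : hecke_like m -> K k -> measurable E ->
  m [set y | E (k ** y)] = m E.
Proof.
move=> [_ _ hm] Kk mE; have mE' := tame_measurable (K_tame Kk) mE.
have [<- _] := hm k _ Kk mE'; congr (m _); apply/seteqP; split=> y.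
  by move=> [x Ex <-].
move=> Ey; exists (inv k ** y) => /=; by rewrite (grp_mulVKg mulA mul1g mulVg).
Qed.

Lemma hecke_right m k (E : set BG) : hecke_like m -> K k -> measurable E ->
  m [set y | E (y ** inv k)] = m E.
Proof.
move=> [_ _ hm] Kk mE; have [_ <-] := hm k _ Kk mE; congr (m _).
apply/seteqP; split=> y; last by move=> [x Ex <-] /=; rewrite (grp_mulgK mulA mul1g mulVg).
by move=> Ey; exists (y ** inv k) => //; rewrite (grp_mulgKV mulA mul1g mulVg).
Qed.

Lemma tame_compact x (L : set G) : tame x -> compact L -> compact [set x ** y | y in L].
Proof.
move=> tx; apply: continuous_compact; apply: (@continuous_subspaceT _ _ L (mul x)).
by apply/continuousP => U oU; exact: tx.
Qed.

(** For inner regularity, the sets [x^-1 L] are compact as images under translation by [x^-1] and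
    measurable as preimages under translation by [x]; hence both tameness hypotheses. *)
Lemma haar_translate m x (tx : tame (inv x)) : tame x -> hecke_like m ->
  haar_measure (translate m tx).
Proof.
move=> tx' hm; have [fm reg hm'] := hm; split.
- exact: fm.
- move=> U oU; have oxU : open [set y | U (inv x ** y)] by exact: tx.
  have mxU := open_measurable_borel oxU.
  apply/eqP; rewrite eq_le; apply/andP; split; last first.
    apply: ge_ereal_sup => _ [L [mL _ LU] <-].
    apply: le_measure => //; apply/mem_set => //; exact: open_measurable_borel.
  apply: (@le_trans _ _ (m [set y | U (inv x ** y)])); first exact: lexx.
  rewrite reg //; apply: ge_ereal_sup => _ [L [mL cL LU] <-].
  apply: ereal_sup_ubound; exists [set inv x ** y | y in L].
    split; last by move=> _ [y /LU Uy <-].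
      have -> : [set inv x ** y | y in L] = [set y | L (x ** y)].
        apply/seteqP; split=> [_ [y Ly <-]|y Ly].
          by rewrite /= (grp_mulVKg mulA mul1g mulVg).
        by exists (x ** y) => //; rewrite (grp_mulKg mulA mul1g mulVg).
      exact: tame_measurable.
    exact: tame_compact.
  rewrite /translate; congr (m _); apply/seteqP; split=> y.
    move=> [z Lz /(congr1 (mul x))]; rewrite !(grp_mulVKg mulA mul1g mulVg).
    by move=> <-.
  by move=> Ly; exists y.
- move=> k E Kk mE; rewrite /translate -[RHS](hecke_right hm Kk); last exact: tame_measurable.
  by congr (m _); apply/seteqP; split=> y /=; rewrite mulA.
Qed.

Section DoubleCoset.
Variables (d : G) (m : {measure set BG -> \bar R}).
Hypotheses (td : tame d) (td' : tame (inv d)) (hm : characteristic d m).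
Let D : set G := [set u ** d ** v | u in K & v in K].

Lemma double_coset_tame x : D x -> tame x.
Proof. by move=> [u Ku [v Kv <-]]; apply: tame_mul; [apply: tame_mul|]; try exact: K_tame. Qed.

Lemma double_coset_tameV x : D x -> tame (inv x).
Proof.
have [_ _ KV] := Kgrp.
move=> [u Ku [v Kv <-]]; rewrite !(grp_invMg mulA mul1g mulVg).
by apply: tame_mul; [|apply: tame_mul] => //; apply: K_tame; exact: KV.
Qed.

Lemma double_coset_stable : stable D K.
Proof.
have [_ KM _] := Kgrp.
by move=> x k [u Ku [v Kv <-]] Kk; exists u => //; exists (v ** k); [exact: KM|rewrite mulA].
Qed.

Lemma double_coset_mul k x : K k -> D x -> D (k ** x).
Proof.
have [_ KM _] := Kgrp; move=> Kk [u Ku [v Kv <-]].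
by exists (k ** u); [exact: KM|exists v; rewrite // !mulA].
Qed.

Lemma double_coset_coset_open x : D x -> open (coset x K).
Proof. by move=> /double_coset_tameV tx; exact: tx. Qed.

Lemma double_coset_open : open D.
Proof.
have -> : D = \bigcup_(x in D) coset x K.
  apply/seteqP; split=> [x Dx|y [x Dx xy]]; first by exists x => //; exact: (coset_refl mulVg Kgrp).
  exact: (coset_stable mulA mul1g mulVg double_coset_stable xy Dx).
by apply: bigcup_open => x; exact: double_coset_coset_open.
Qed.

Lemma double_coset_measure : m D = 1.
Proof.
have [_ m1 mD] := hm; have oD := open_measurable_borel double_coset_open.
rewrite -m1 -(setUv D) measureU //; first by rewrite -/D in mD; rewrite [X in _ + X]mD adde0.
  exact: measurableC.
exact: setICr.
Qed.

(** [K] permutes the cosets [xK] in [D] transitively from the left: [u' u^-1] carries [u d v K] to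
    [u' d v' K]. *)
Lemma measure_coset_double_coset x y : D x -> D y -> m (coset x K) = m (coset y K).
Proof.
have [K1 KM KV] := Kgrp; have [hm1 _ _] := hm.
move=> Dx Dy; have oy := open_measurable_borel (double_coset_coset_open Dy).
case: Dx Dy oy => u Ku [v Kv <-] [u' Ku' [v' Kv' <-]] oy.
have Kk : K (u' ** inv u) by apply: KM => //; exact: KV.
rewrite -[RHS](hecke_left hm1 Kk oy); congr (m _).
have e z : inv (u' ** d ** v') ** (u' ** inv u ** z) =
   inv v' ** v ** (inv (u ** d ** v) ** z).
  rewrite !(grp_invMg mulA mul1g mulVg) -!mulA (grp_mulVKg mulA mul1g mulVg).
  by rewrite (grp_mulKg mulA mul1g mulVg).
have Kvv : K (inv v' ** v) by apply: KM => //; exact: KV.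
apply/seteqP; split=> z; rewrite /left_coset /= e => h; first exact: KM.
by rewrite -(grp_mulKg mulA mul1g mulVg (inv v' ** v) (inv _ ** z)); apply: KM => //; exact: KV.
Qed.

(** The finiteness of [KdK / K] is deduced from the measure: the cosets have equal mass and the
    total mass is one. *)
Lemma double_coset_reps : exists s, coset_reps K s D.
Proof.
have [hm1 m1 mD] := hm; have [_ reg _] := hm1.
apply: (finite_coset_reps Kgrp (m := m) (w := m (coset d K))) => //.
- exact: double_coset_stable.
- exact: double_coset_coset_open.
- move=> x Dx; apply: measure_coset_double_coset => //.
  have [K1 _ _] := Kgrp; exists one => //; exists one => //.
  by rewrite mul1g (grp_mulg1 mulA mul1g mulVg).
- exact: double_coset_open.
- by rewrite double_coset_measure ltry.
- by rewrite double_coset_measure lte01.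
- by apply: reg; apply: open_measurable_borel; exact: double_coset_open.
Qed.

Lemma double_coset_center : D d.
Proof.
have [K1 _ _] := Kgrp; exists one => //; exists one => //.
by rewrite mul1g (grp_mulg1 mulA mul1g mulVg).
Qed.

Lemma measure_coset_pos x : D x -> 0 < m (coset x K).
Proof.
have [s hs] := double_coset_reps; move=> Dx.
have := coset_reps_measure Kgrp (m := m) (w := m (coset x K)) double_coset_stable
  double_coset_coset_open (fun y Dy => measure_coset_double_coset Dy Dx) hs.
rewrite double_coset_measure => e; rewrite lt_neqAle measure_ge0 andbT; apply/eqP => e0.
by move: e; rewrite -e0 mule0 => /eqP; rewrite onee_eq0.
Qed.

End DoubleCoset.

(** * Convolutions as finite sums over representatives, and their commutation *)

Section Convolution.
Variables (d d' : G) (m m' : {measure set BG -> \bar R}).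
Hypotheses (td : tame d) (tdV : tame (inv d)) (td' : tame d') (tdV' : tame (inv d')).
Hypotheses (hm : characteristic d m) (hm' : characteristic d' m').
Let D : set G := [set u ** d ** v | u in K & v in K].
Let D' : set G := [set u ** d' ** v | u in K & v in K].
Variables (xs ys : seq G).
Hypotheses (xsD : coset_reps K xs D) (ysD' : coset_reps K ys D').
Variable E : set BG.
Hypothesis mE : measurable E.

(** Both translates are Haar measures on [K], of total masses [m (dK)] and [m' (d'K)]. *)
Lemma haar_translate_unique x y (F : set BG) (tx : tame (inv x)) (ty : tame (inv y)) :
  D x -> D' y -> measurable F -> F `<=` K ->
  m (coset d K) * translate m' ty F = m' (coset d' K) * translate m tx F.
Proof.
move=> Dx Dy mF FK; have [hm1 _ _] := hm; have [hm1' _ _] := hm'.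
have h1 := haar_translate tx (double_coset_tame td Dx) hm1.
have h2 := haar_translate ty (double_coset_tame td' Dy) hm1'.
have ex : translate m tx K = m (coset d K).
  by apply: (measure_coset_double_coset tdV hm Dx); exact: double_coset_center.
have ey : translate m' ty K = m' (coset d' K).
  by apply: (measure_coset_double_coset tdV' hm' Dy); exact: double_coset_center.
have p1 : 0 < translate m tx K.
  by rewrite ex; apply: (measure_coset_pos tdV hm); exact: double_coset_center.
have p2 : 0 < translate m' ty K.
  by rewrite ey; apply: (measure_coset_pos tdV' hm'); exact: double_coset_center.
by rewrite -ex -ey muleC [RHS]muleC; apply/esym; exact: haar_unique.
Qed.

(** The integrand is constant on each coset [xK], by left invariance of [m'], and these cosets all
    have mass [m (dK)]. The measure [m'] is then split along the cosets [yK]. *)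
Lemma convolution_reps :
  \int[m]_x m' [set y | E (x ** y)] =
  \sum_(x <- xs) \sum_(y <- ys)
     m (coset d K) * m' [set z | E (x ** z) /\ K (inv y ** z)].
Proof.
have [hm1 m1 mD] := hm; have [hm1' m1' mD'] := hm'; have [fm' _ _] := hm1'.
have [xs_D inqx xsU] := xsD; have [ys_D inqy ysU] := ysD'.
have mEx x : D x -> measurable ([set y | E (x ** y)] : set BG).
  by move=> Dx; apply: tame_measurable => //; exact: (double_coset_tame td Dx).
have fin x : D x -> m' [set y | E (x ** y)] \is a fin_num.
  move=> Dx; rewrite ge0_fin_numE //; apply: le_lt_trans fm'.
  by apply: le_measure => //; apply/mem_set => //; exact: mEx.
rewrite (@integral_cells _ _ _ m _ xs (fun x => coset x K) _
  (fun x => fine (m' [set y | E (x ** y)]))).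
- rewrite big_seq [RHS]big_seq; apply: eq_bigr => x xx.
  have Dx := xs_D x xx.
  rewrite fineK; last exact: fin.
  rewrite (measure_coset_double_coset tdV hm Dx (double_coset_center d)) muleC.
  rewrite -ge0_sume_distrr //; congr (_ * _).
  have mU : measurable (cosets ys K : set BG).
    apply: measurable_cosets => y yy; apply: open_measurable_borel.
    by apply: (double_coset_coset_open tdV'); exact: ys_D.
  rewrite -(setIT [set y | E (x ** y)]) -(setUv (cosets ys K)) setIUr measureU; last 3 first.
  - by apply: measurableI => //; exact: mEx.
  - by apply: measurableI; [exact: mEx|exact: measurableC].
  - by rewrite setIACA setICr setI0.
  rewrite [X in _ + X](_ : _ = 0) ?adde0; last first.
    apply/eqP; rewrite -measure_le0 -mD'; apply: le_measure.
    - by apply/mem_set; apply: measurableI; [exact: mEx|exact: measurableC].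
    - apply/mem_set; apply: measurableC; apply: open_measurable_borel.
      exact: (double_coset_open tdV').
    - by move=> y [_ nU] Dy; apply: nU; exact: ysU.
  apply: (etrans (measure_cosets Kgrp m' (mEx x Dx) _ inqy)) => //.
  by move=> y yy; apply: open_measurable_borel;
    apply: (double_coset_coset_open tdV'); exact: ys_D.
- by move=> x xx; apply: open_measurable_borel; apply: (double_coset_coset_open tdV); exact: xs_D.
- move=> x x' y xx xx' xy xy'; apply: (inequivalent_eq mulA mul1g mulVg Kgrp inqx xx xx').
  exact: (coset_trans mulA mul1g mulVg Kgrp xy (coset_sym mulA mul1g mulVg Kgrp xy')).
- exact: (inequivalent_uniq mulVg Kgrp inqx).
- apply/eqP; rewrite -measure_le0 -mD; apply: le_measure.
  + apply/mem_set; apply: measurableC.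
    apply: (@measurable_cosets K xs) => x xx; apply: open_measurable_borel.
    by apply: (double_coset_coset_open tdV); exact: xs_D.
  + apply/mem_set; apply: measurableC; apply: open_measurable_borel.
    exact: (double_coset_open tdV).
  + by move=> y nU Dy; apply: nU; exact: xsU.
- by move=> x; exact: measure_ge0.
- move=> x z xx xz /=; have Dx := xs_D x xx; rewrite fineK; last exact: fin.
  have Kk : K (inv x ** z) by [].
  rewrite -[RHS](hecke_left hm1' Kk (mEx x Dx)); congr (m' _).
  by apply/seteqP; split=> y /=; rewrite mulA (grp_mulVKg mulA mul1g mulVg).
Qed.

End Convolution.

(** Translates of [m] and [m'] to [K] are proportional, so both convolutions expand into values of
    one function [phi], at the products [x y] and [y x] respectively. The equality of the sums is
    then the combinatorial identity [gelfand_sum]. *)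
Theorem convolution_comm (tr : G -> G) d d' m m' :
  tame d -> tame (inv d) -> tame d' -> tame (inv d') ->
  characteristic d m -> characteristic d' m' ->
  (forall x, tr (tr x) = x) -> (forall x y, tr (x ** y) = tr y ** tr x) ->
  (forall x, K x -> K (tr x)) -> tr d = d -> tr d' = d' ->
  (forall k, K k -> exists u v, [/\ K u, K v &
     tr (d ** k ** d') = u ** (d ** k ** d') ** v]) ->
  forall E : set BG, measurable E ->
  \int[m]_x m' [set y | E (x ** y)] = \int[m']_x m [set y | E (x ** y)].
Proof.
move=> td tdV td' tdV' hm hm' trK trM K_tr trd trd' trdd E mE.
have [K1 KM KV] := Kgrp.
have [xs xsD] := double_coset_reps tdV hm.
have [ys ysD'] := double_coset_reps tdV' hm'.
set D := [set u ** d ** v | u in K & v in K] in xsD.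
set D' := [set u ** d' ** v | u in K & v in K] in ysD'.
have [xs_D _ _] := xsD; have [ys_D _ _] := ysD'.
have Dtr g x : tr g = g -> [set u ** g ** v | u in K & v in K] x ->
    [set u ** g ** v | u in K & v in K] (tr x).
  move=> eg [u Ku [v Kv <-]]; exists (tr v); first exact: K_tr.
  by exists (tr u); [exact: K_tr|rewrite !trM eg mulA].
have tr_mul x y : D x -> D' y ->
    exists k k', [/\ K k, K k' & tr (x ** y) = k ** (x ** y) ** k'].
  move=> [u Ku [v Kv <-]] [u' Ku' [v' Kv' <-]].
  (* The hypothesis handles the middle factor [d (v u') d']; the outer factors are absorbed into [k]
     and [k']. *)
  have [k [k' [Kk Kk' e]]] := trdd (v ** u') (KM _ _ Kv Ku').
  have e1 : u ** d ** v ** (u' ** d' ** v') = u ** (d ** (v ** u') ** d') ** v'.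
    by rewrite !mulA.
  exists (tr v' ** k ** inv u), (inv v' ** k' ** tr u); split.
  - by apply: (KM); [apply: (KM) => //; exact: K_tr|exact: KV].
  - by apply: (KM); [apply: (KM) => //; exact: KV|exact: K_tr].
  - rewrite e1 trM (trM u) e; set g := d ** _ ** d'.
    by rewrite -!mulA (grp_mulKg mulA mul1g mulVg) (grp_mulVKg mulA mul1g mulVg).
(* [F g] is the part of [g^-1 E] in [K], and [phi g] is its mass for the Haar measure of [K] with
   total mass [m (dK) m' (d'K)], a normalization symmetric in both measures. *)
pose F g : set BG := [set z | E (g ** z)] `&` K.
pose phi g := m (coset d K) * m' [set z | F g (inv d' ** z)].
have Dd := double_coset_center d; have Dd' := double_coset_center d'.
have mF g : tame g -> measurable (F g).
  by move=> tg; apply: measurableI; [exact: tame_measurable|exact: open_measurable_borel].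
have FK g : F g `<=` K by move=> z [].
have uni x y g (Dx : D x) (Dy : D' y) (tg : tame g) :
    m (coset d K) * m' [set z | F g (inv y ** z)] = m' (coset d' K) * m [set z | F g (inv x ** z)].
  exact: (haar_translate_unique td tdV td' tdV' hm hm' (double_coset_tameV tdV Dx)
    (double_coset_tameV tdV' Dy) Dx Dy (mF g tg) (@FK g)).
have phiE y g : D' y -> tame g -> m (coset d K) * m' [set z | F g (inv y ** z)] = phi g.
  by move=> Dy tg; rewrite (uni d y g Dd Dy tg) /phi (uni d d' g Dd Dd' tg).
have phiE' x g : D x -> tame g -> m' (coset d' K) * m [set z | F g (inv x ** z)] = phi g.
  by move=> Dx tg; rewrite -(uni x d' g Dx Dd' tg).
have tD x : D x -> tame x by exact: double_coset_tame.
have tD' x : D' x -> tame x by exact: double_coset_tame.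
have FE g h : [set z | F (g ** h) (inv h ** z)] = [set z | E (g ** z) /\ K (inv h ** z)].
  by apply/seteqP; split=> z; rewrite /F /= -mulA (grp_mulVKg mulA mul1g mulVg).
rewrite (convolution_reps td tdV tdV' hm hm' xsD ysD' mE) //.
rewrite (convolution_reps td' tdV' tdV hm' hm ysD' xsD mE) //.
transitivity (\sum_(x <- xs) \sum_(y <- ys) phi (x ** y)).
  rewrite big_seq [RHS]big_seq; apply: eq_bigr => x /xs_D Dx.
  rewrite big_seq [RHS]big_seq; apply: eq_bigr => y /ys_D Dy.
  by rewrite -FE phiE //; apply: tame_mul; [exact: tD|exact: tD'].
transitivity (\sum_(y <- ys) \sum_(x <- xs) phi (y ** x)); last first.
  rewrite big_seq [RHS]big_seq; apply: eq_bigr => y /ys_D Dy.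
  rewrite big_seq [RHS]big_seq; apply: eq_bigr => x /xs_D Dx.
  by rewrite -FE phiE' //; apply: tame_mul; [exact: tD'|exact: tD].
(* [F (g k)] is [k^-1 F g], and the factor [k] is moved to the representative: [d'] and [d' k^-1]
   give the same value by [phiE]. *)
have phi_mulr g k : tame g -> K k -> phi (g ** k) = phi g.
  move=> tg Kk; have Dk : D' (d' ** inv k).
    by apply: double_coset_stable => //; exact: KV.
  rewrite -(phiE _ g Dk tg) /phi; congr (_ * m' _).
  apply/seteqP; split=> z; rewrite /F /= (grp_invMg mulA mul1g mulVg) (grp_invgK mulA mul1g mulVg).
    by rewrite -!mulA => -[Ez Kz]; split=> //; exact: KM.
  rewrite -!mulA => -[Ez Kz]; split=> //.
  by rewrite -(grp_mulKg mulA mul1g mulVg k (inv d' ** z)); apply: KM => //; exact: KV.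
apply: (gelfand_sum mulA mul1g mulVg Kgrp trK trM K_tr _ _ _ _ _ _ tr_mul xsD ysD').
- by move=> x; exact: Dtr.
- by move=> x; exact: Dtr.
- by move=> k x Kk; exact: double_coset_mul.
- exact: double_coset_stable.
- by move=> k x Kk; exact: double_coset_mul.
- exact: double_coset_stable.
- by move=> x y k Dx Dy Kk; apply: phi_mulr => //; apply: tame_mul; [exact: tD|exact: tD'].
- by move=> x y k Dx Dy Kk; apply: phi_mulr => //; apply: tame_mul; [exact: tD'|exact: tD].
Qed.

End Haar.

End Measures.

(** * The adelic group *)

Section FractionMorphism.
Variable A : comPzRingType.

Fact to_frac_zmod : zmod_morphism (@to_frac A).
Proof. by move=> a b; rewrite to_fracD to_fracN. Qed.
Fact to_frac_monoid : monoid_morphism (@to_frac A).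
Proof. by split=> // a b; exact: to_fracM. Qed.
HB.instance Definition _ :=
  GRing.isZmodMorphism.Build A (total_fractions A) (@to_frac A) to_frac_zmod.
HB.instance Definition _ :=
  GRing.isMonoidMorphism.Build A (total_fractions A) (@to_frac A) to_frac_monoid.

End FractionMorphism.

Section MatrixIdentities.
Variables (A : comPzRingType) (n : nat).
Implicit Types M N P : 'M[A]_n.

Lemma mulmx_sub1 M N : M *m N - 1%:M = M *m (N - 1%:M) + (M - 1%:M).
Proof. by rewrite mulmxBr mulmx1 addrA subrK. Qed.

Lemma conjmx_sub1 M M' N : M' *m M = 1%:M ->
  M' *m N *m M - 1%:M = M' *m (N - 1%:M) *m M.
Proof. by move=> e; rewrite mulmxBr mulmx1 mulmxBl e. Qed.

Lemma submxE M N i j : (M - N) i j = M i j - N i j.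
Proof. by rewrite !mxE. Qed.

Lemma submx_add M N P : M - P = (M - N) + (N - P).
Proof. by rewrite addrA subrK. Qed.

End MatrixIdentities.

Lemma map_mx_injective (A B : Type) (f : A -> B) m n :
  injective f -> injective (map_mx f : 'M[A]_(m, n) -> 'M[B]_(m, n)).
Proof.
by move=> inj M N /matrixP e; apply/matrixP => i j; have := e i j; rewrite !mxE => /inj.
Qed.

Section Places.
Variable C : scheme.
Implicit Types (p : closedPoint C) (a b : adele C) (k : closedPoint C -> nat).

Definition adele_at p a : local_frac p := a p.

Fact adele_at_zmod p : zmod_morphism (adele_at p).
Proof. by []. Qed.
Fact adele_at_monoid p : monoid_morphism (adele_at p).
Proof. by []. Qed.
HB.instance Definition _ p :=
  GRing.isZmodMorphism.Build (adele C) (local_frac p) (adele_at p) (adele_at_zmod p).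
HB.instance Definition _ p :=
  GRing.isMonoidMorphism.Build (adele C) (local_frac p) (adele_at p) (adele_at_monoid p).

Lemma adele_mxP m n (M N : 'M[adele C]_(m, n)) :
  (forall p, map_mx (adele_at p) M = map_mx (adele_at p) N) -> M = N.
Proof.
move=> h; apply/matrixP => i j; apply: adele_eq => p.
by have /matrixP/(_ i j) := h p; rewrite !mxE.
Qed.

Lemma adele_add a b p : (a + b) p = a p + b p. Proof. by []. Qed.
Lemma adele_mul a b p : (a * b) p = a p * b p. Proof. by []. Qed.

Definition finsupp k : Prop := finite_set [set p | k p <> 0%N].

Lemma finsuppD k k' : finsupp k -> finsupp k' -> finsupp (fun p => k p + k' p)%N.
Proof.
move=> fk fk'; apply: (@sub_finite_set _ _ ([set p | k p <> 0%N] `|` [set p | k' p <> 0%N])).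
  move=> p /= h; have [e|] := pselect (k p = 0%N); last by left.
  by right => e'; apply: h; rewrite e e'.
by rewrite finite_setU.
Qed.

Lemma finsupp0 : finsupp (fun=> 0%N).
Proof. by apply: sub_finite_set (@finite_set0 (closedPoint C)) => p /=. Qed.

Lemma nbhd0 k : adele_nbhd k 0.
Proof.
by move=> p; exists 0; [case: (completion_ker_ideal (@nonunits (stalk (sval p))) (k p))|].
Qed.

Lemma nbhdD k a b : adele_nbhd k a -> adele_nbhd k b -> adele_nbhd k (a + b).
Proof.
move=> ha hb p; have [x hx ex] := ha p; have [y hy ey] := hb p.
have [_ hD _] := completion_ker_ideal (@nonunits (stalk (sval p))) (k p).
exists (x + y); first exact (hD _ _ hx hy).
rewrite adele_add ex ey; exact (esym (to_fracD x y)).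
Qed.

Lemma nbhdM k a b : integral_adele a -> adele_nbhd k b -> adele_nbhd k (a * b).
Proof.
move=> ha hb p; have [y _ ey] := ha p; have [x hx ex] := hb p.
have [_ _ hM] := completion_ker_ideal (@nonunits (stalk (sval p))) (k p).
exists (y * x); first exact (hM _ _ hx).
rewrite adele_mul ex -ey; exact (esym (to_fracM y x)).
Qed.

Lemma nbhd_le k k' a : (forall p, (k p <= k' p)%N) -> adele_nbhd k' a -> adele_nbhd k a.
Proof. by move=> h ha p; have [x /(completion_ker_le (h p)) hx e] := ha p; exists x. Qed.

Lemma nbhd_integral k a : adele_nbhd k a -> integral_adele a.
Proof. by move=> ha p; have [x _ e] := ha p; exists x. Qed.

Lemma integral_nbhd a : integral_adele a -> adele_nbhd (fun=> 0%N) a.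
Proof. by move=> ha p; have [x _ e] := ha p; exists x. Qed.

Lemma integral_adele0 : integral_adele (0 : adele C).
Proof. by move=> p; exact (Defs.integral0 p). Qed.
Lemma integral_adele1 : integral_adele (1 : adele C).
Proof. by move=> p; exact (Defs.integral1 p). Qed.

Definition mx_in m n (S : set (adele C)) (M : 'M[adele C]_(m, n)) : Prop :=
  forall i j, S (M i j).

Lemma mx_in_mul m n r (S P Q : set (adele C)) (M : 'M[adele C]_(m, n)) (N : 'M[adele C]_(n, r)) :
  S 0 -> (forall a b, S a -> S b -> S (a + b)) ->
  (forall a b, P a -> Q b -> S (a * b)) ->
  mx_in P M -> mx_in Q N -> mx_in S (M *m N).
Proof.
move=> S0 SD PQ hM hN i j; rewrite mxE; elim/big_ind: _ => // l _; exact: PQ.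
Qed.

Lemma mx_in_nbhdD m n k (M N : 'M[adele C]_(m, n)) :
  mx_in (adele_nbhd k) M -> mx_in (adele_nbhd k) N -> mx_in (adele_nbhd k) (M + N).
Proof. by move=> hM hN i j; rewrite mxE; exact: nbhdD. Qed.

Lemma mx_in_nbhdMl m n r k (M : 'M[adele C]_(m, n)) (N : 'M[adele C]_(n, r)) :
  mx_in (@integral_adele C) M -> mx_in (adele_nbhd k) N -> mx_in (adele_nbhd k) (M *m N).
Proof.
by apply: mx_in_mul; [exact: nbhd0|exact: nbhdD|exact: nbhdM].
Qed.

Lemma mx_in_nbhdMr m n r k (M : 'M[adele C]_(m, n)) (N : 'M[adele C]_(n, r)) :
  mx_in (adele_nbhd k) M -> mx_in (@integral_adele C) N -> mx_in (adele_nbhd k) (M *m N).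
Proof.
apply: mx_in_mul; [exact: nbhd0|exact: nbhdD|].
by move=> a b ha hb; rewrite mulrC; exact: nbhdM.
Qed.

Lemma mx_in_integralM m n r (M : 'M[adele C]_(m, n)) (N : 'M[adele C]_(n, r)) :
  mx_in (@integral_adele C) M -> mx_in (@integral_adele C) N ->
  mx_in (@integral_adele C) (M *m N).
Proof.
move=> hM hN i j; apply: (@nbhd_integral (fun=> 0%N)); apply: mx_in_nbhdMl => // i' j'.
exact: integral_nbhd.
Qed.

Lemma mx_in_integral1 n : mx_in (@integral_adele C) (1%:M : 'M[adele C]_n).
Proof.
by move=> i j; rewrite mxE; case: (i == j); [exact: integral_adele1|exact: integral_adele0].
Qed.

Local Notation G := (GL2A C).
Local Notation mul := (@gl_mul (adele C)).
Local Notation one := (gl_one (adele C)).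
Local Notation inv := (@gl_inv (adele C)).
Local Notation K := (@GL2O C).
Implicit Types g h : G.

Lemma GL2OE g : K g <-> mx_in (@integral_adele C) (gl_mx g) /\
  mx_in (@integral_adele C) (gl_inv_mx g).
Proof. by split=> [h|[h h'] i j]; [split=> i j; have [] := h i j|split]. Qed.

Lemma GL2O_subgroup : @subgroup G mul one inv K.
Proof.
split.
- by apply/GL2OE; split; exact: mx_in_integral1.
- move=> g h /GL2OE[hg hg'] /GL2OE[hh hh']; apply/GL2OE.
  by split; exact: mx_in_integralM.
- by move=> g /GL2OE[hg hg']; apply/GL2OE.
Qed.

Lemma GL2O_tr g : K g -> K (gl_tr g).
Proof. by move=> /GL2OE[hg hg']; apply/GL2OE; split=> i j; rewrite mxE. Qed.

Definition level : Type := {k : closedPoint C -> nat | finsupp k}.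

(** The inverse is constrained too, in accordance with the topology induced by [g |-> (g, g^-1)]. *)
Definition congruence (k : level) : set G :=
  [set g | mx_in (adele_nbhd (sval k)) (gl_mx g - 1%:M) /\
           mx_in (adele_nbhd (sval k)) (gl_inv_mx g - 1%:M)].

Lemma mx_in_integral_sub1 n k (M : 'M[adele C]_n) :
  mx_in (adele_nbhd k) (M - 1%:M) -> mx_in (@integral_adele C) M.
Proof.
move=> h i j; rewrite -(subrK (1%:M : 'M[adele C]_n) M) mxE.
apply: (@nbhd_integral (fun=> 0%N)); apply: nbhdD; apply: integral_nbhd.
  exact: nbhd_integral (h i j).
exact: mx_in_integral1.
Qed.

Lemma congruence_sub (k : level) : congruence k `<=` K.
Proof. by move=> g [h h']; apply/GL2OE; split; exact: mx_in_integral_sub1. Qed.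

Lemma congruence_subgroup (k : level) : @subgroup G mul one inv (congruence k).
Proof.
have mul1 (M N : 'M[adele C]_2) : mx_in (adele_nbhd (sval k)) (M - 1%:M) ->
    mx_in (adele_nbhd (sval k)) (N - 1%:M) -> mx_in (adele_nbhd (sval k)) (M *m N - 1%:M).
  move=> hM hN; rewrite mulmx_sub1; apply: mx_in_nbhdD => //.
  by apply: mx_in_nbhdMl => //; exact: mx_in_integral_sub1 hM.
split.
- by split=> i j; rewrite /= subrr mxE; exact: nbhd0.
- by move=> g h [hg hg'] [hh hh']; split; exact: mul1.
- by move=> g [hg hg'].
Qed.

Lemma congruence_normal (k : level) g h : K g -> congruence k h ->
  congruence k (mul (mul (inv g) h) g).
Proof.
move=> /GL2OE[hg hg'] [hh hh']; split.
  rewrite [gl_mx _](_ : _ = gl_inv_mx g *m gl_mx h *m gl_mx g) // conjmx_sub1 ?gl_Vmx //.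
  by apply: mx_in_nbhdMr => //; exact: mx_in_nbhdMl.
rewrite [gl_inv_mx _](_ : _ = gl_inv_mx g *m gl_inv_mx h *m gl_mx g); last exact: mulmxA.
rewrite conjmx_sub1 ?gl_Vmx //.
by apply: mx_in_nbhdMr => //; exact: mx_in_nbhdMl.
Qed.

Definition gl_nbhd k g : set G :=
  [set h | mx_in (adele_nbhd k) (gl_mx h - gl_mx g) /\
           mx_in (adele_nbhd k) (gl_inv_mx h - gl_inv_mx g)].

Lemma gl_openE (E : set G) : open E <->
  forall g, E g -> exists2 k, finsupp k & gl_nbhd k g `<=` E.
Proof.
rewrite (_ : open E = gl_open E) //; split=> h g Eg; have [k fk hk] := h g Eg; exists k => // g'.
  by move=> [h1 h2]; apply: hk => i j; rewrite -!submxE; split; [exact (h1 i j)|exact (h2 i j)].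
move=> hh; apply: hk; split=> i j; rewrite submxE; first exact (proj1 (hh i j)).
exact (proj2 (hh i j)).
Qed.

Lemma GL2O_open : open K.
Proof.
apply/gl_openE => g /GL2OE[hg hg']; exists (fun=> 0%N); first exact: finsupp0.
have aux (M N : 'M[adele C]_2) : mx_in (adele_nbhd (fun=> 0%N)) (M - N) ->
    mx_in (@integral_adele C) N -> mx_in (@integral_adele C) M.
  move=> h hN i j; rewrite -(subrK N M) mxE; apply: (@nbhd_integral (fun=> 0%N)).
  by apply: nbhdD; [exact: h|exact: integral_nbhd].
by move=> h [h1 h2]; apply/GL2OE; split; [exact: aux h1 hg|exact: aux h2 hg'].
Qed.

Lemma congruence_open (k : level) : open (congruence k).
Proof.
apply/gl_openE => g [hg hg']; exists (sval k); first exact: svalP.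
move=> h [h1 h2]; split.
  by rewrite (submx_add _ (gl_mx g)); exact: mx_in_nbhdD.
by rewrite (submx_add _ (gl_inv_mx g)); exact: mx_in_nbhdD.
Qed.

Lemma congruence_base (U : set G) : open U -> U one -> exists k : level, congruence k `<=` U.
Proof.
move=> /gl_openE oU /oU[k fk hk]; exists (exist _ k fk) => g [h1 h2].
by apply: hk; split.
Qed.

(* All adeles are bounded, by the Artin-Rees lemma, but boundedness is elementary for the
   entries of the matrices at hand. *)
Definition bounded_adele a : Prop := forall k, finsupp k ->
  exists2 k', finsupp k' & forall b, adele_nbhd k' b -> adele_nbhd k (a * b).

Lemma integral_bounded a : integral_adele a -> bounded_adele a.
Proof. by move=> ha k fk; exists k => // b; exact: nbhdM. Qed.

Lemma mx_in_bounded (M : 'M[adele C]_2) k : mx_in bounded_adele M -> finsupp k ->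
  exists2 k', finsupp k' & forall b, adele_nbhd k' b -> forall i j, adele_nbhd k (M i j * b).
Proof.
move=> hM fk; pose P i j k' := finsupp k' /\ forall b, adele_nbhd k' b -> adele_nbhd k (M i j * b).
have /choice[f hf] : forall ij : 'I_2 * 'I_2, exists k', P ij.1 ij.2 k'.
  by move=> [i j]; have [k' h h'] := hM i j k fk; exists k'.
pose S (s : seq ('I_2 * 'I_2)) p := (\sum_(ij <- s) f ij p)%N.
have fS s : finsupp (S s).
  elim: s => [|ij s IHs].
    have -> : S [::] = fun=> 0%N by apply: funext => p; rewrite /S big_nil.
    exact: finsupp0.
  have -> : S (ij :: s) = fun p => (f ij p + S s p)%N by apply: funext => p; rewrite /S big_cons.
  by apply: finsuppD => //; case: (hf ij).
exists (S (enum {: 'I_2 * 'I_2})) => // b hb i j; have [_ h] := hf (i, j).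
apply: h; apply: nbhd_le hb => p; rewrite /S (bigD1_seq (i, j)) ?mem_enum ?enum_uniq //=.
exact: leq_addr.
Qed.

(** Left translation by [g] multiplies the difference of two matrices by [g] on the left and the
    difference of their inverses by [g^-1] on the right, so the entries of both must be bounded. *)
Lemma bounded_tame g : mx_in bounded_adele (gl_mx g) -> mx_in bounded_adele (gl_inv_mx g) ->
  @tame G mul g.
Proof.
move=> hg hg' U /gl_openE oU; apply/gl_openE => h /oU[k fk hk].
have [k1 fk1 h1] := mx_in_bounded hg fk; have [k2 fk2 h2] := mx_in_bounded hg' fk.
exists (fun p => k1 p + k2 p)%N; first exact: finsuppD.
move=> h' [hh hh']; apply: hk; split.
  rewrite [X in mx_in _ X](_ : _ = gl_mx g *m (gl_mx h' - gl_mx h)); last first.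
    exact (esym (mulmxBr _ _ _)).
  apply: (mx_in_mul (P := fun a => exists i j, a = gl_mx g i j) _ _ _ _ hh).
  - exact: nbhd0.
  - exact: nbhdD.
  - move=> _ b [i [j ->]] hb; apply: h1; apply: nbhd_le hb => p; exact: leq_addr.
  - by move=> i j; exists i, j.
rewrite [X in mx_in _ X](_ : _ = (gl_inv_mx h' - gl_inv_mx h) *m gl_inv_mx g); last first.
  exact (esym (mulmxBl _ _ _)).
apply: (mx_in_mul (Q := fun a => exists i j, a = gl_inv_mx g i j) _ _ _ hh' _).
- exact: nbhd0.
- exact: nbhdD.
- move=> b _ hb [i [j ->]]; rewrite mulrC; apply: h2; apply: nbhd_le hb => p; exact: leq_addl.
- by move=> i j; exists i, j.
Qed.

Lemma GL2O_tame g : K g -> @tame G mul g.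
Proof.
move=> /GL2OE[hg hg']; apply: bounded_tame => i j; apply: integral_bounded.
  exact: hg.
exact: hg'.
Qed.

Lemma GL2O_at g p : K g -> exists x : GL2 (local_ring p),
  map_mx (@to_frac _) (gl_mx x) = map_mx (adele_at p) (gl_mx g) /\
  map_mx (@to_frac _) (gl_inv_mx x) = map_mx (adele_at p) (gl_inv_mx g).
Proof.
move=> /GL2OE[hg hg'].
have lift (M : 'M[adele C]_2) : mx_in (@integral_adele C) M ->
    exists N : 'M[local_ring p]_2, map_mx (@to_frac _) N = map_mx (adele_at p) M.
  move=> hM; have /choice[f hf] : forall ij : 'I_2 * 'I_2,
      exists c : local_ring p, to_frac c = M ij.1 ij.2 p.
    by move=> [i j]; have [a _ e] := hM i j p; exists a.
  exists (\matrix_(i, j) f (i, j)); apply/matrixP => i j.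
  by rewrite !mxE hf.
have [N eN] := lift _ hg; have [N' eN'] := lift _ hg'.
have inj := @map_mx_injective _ _ _ 2 2 (@to_frac_inj (local_ring p)).
have NN' : N *m N' = 1%:M.
  by apply: inj; rewrite map_mxM eN eN' -map_mxM gl_mxV !map_mx1.
have N'N : N' *m N = 1%:M.
  by apply: inj; rewrite map_mxM eN eN' -map_mxM gl_Vmx !map_mx1.
by exists (MkGL2 NN' N'N).
Qed.

(** Any family of local elements glues, since entries integral at all places automatically satisfy
    the finiteness condition on adeles. *)
Lemma GL2O_of_places (P : forall p, GL2 (local_ring p)) :
  exists g, K g /\ forall p, map_mx (adele_at p) (gl_mx g) = map_mx (@to_frac _) (gl_mx (P p)).
Proof.
have int (M : forall p, 'M[local_ring p]_2) i j p : integral_at (to_frac (M p i j)).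
  by exists (M p i j).
pose L (M : forall p, 'M[local_ring p]_2) : 'M[adele C]_2 :=
  \matrix_(i, j) Adele (fin_cst (int M i j)).
have LE M p : map_mx (adele_at p) (L M) = map_mx (@to_frac _) (M p).
  by apply/matrixP => i j; rewrite !mxE.
pose X := L (fun p => gl_mx (P p)); pose Y := L (fun p => gl_inv_mx (P p)).
have XY : X *m Y = 1%:M.
  by apply: adele_mxP => p; rewrite map_mxM !LE -map_mxM gl_mxV !map_mx1.
have YX : Y *m X = 1%:M.
  by apply: adele_mxP => p; rewrite map_mxM !LE -map_mxM gl_Vmx !map_mx1.
exists (MkGL2 XY YX); split; last by move=> p; exact: LE.
apply/GL2OE; split=> i j p; rewrite mxE.
  exact (int (fun p => gl_mx (P p)) i j p).
exact (int (fun p => gl_inv_mx (P p)) i j p).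
Qed.

End Places.

(** * Hecke operators of simple divisors *)

Section PlaceTransposition.
Variables (A F : comPzRingType) (phi : {rmorphism A -> F}).
Local Notation fr := (map_mx phi).

Definition tr_equiv_at (M : 'M[F]_2) : Prop :=
  exists P Q : GL2 A, fr (gl_mx P) *m M *m fr (gl_mx Q) = M^T.

Lemma diag2_tr (R : comPzRingType) (a b : R) : (diag2 a b)^T = diag2 a b.
Proof. by rewrite !diag2E mx2_tr. Qed.

Lemma map_diag2 (R S : comPzRingType) (f : {rmorphism R -> S}) a b :
  map_mx f (diag2 a b) = diag2 (f a) (f b).
Proof.
apply/matrixP => i j; rewrite !mxE.
by case: (i == j); case: (i == ord0); rewrite ?rmorph0.
Qed.

Lemma map_mxM2 (R S : comPzRingType) (f : {rmorphism R -> S}) (M N P : 'M[R]_2) :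
  map_mx f (M *m N *m P) = map_mx f M *m map_mx f N *m map_mx f P.
Proof. by rewrite !map_mxM. Qed.

(** The transpose is [k^T diag(x, 1) = k^T (diag(x, 1) k) k^-1]. *)
Lemma tr_equiv_diag_mul (k : GL2 A) (x : F) : tr_equiv_at (diag2 x 1 *m fr (gl_mx k)).
Proof.
exists (gl_tr k), (gl_inv k) => /=; rewrite !mulmxA -mulmxA -map_mxM gl_mxV map_mx1 mulmx1.
by rewrite trmx_mul diag2_tr map_trmx.
Qed.

Lemma tr_equiv_mul_diag (k : GL2 A) (x : F) : tr_equiv_at (fr (gl_mx k) *m diag2 x 1).
Proof.
exists (gl_inv k), (gl_tr k) => /=; rewrite !mulmxA -map_mxM gl_Vmx map_mx1 mul1mx.
by rewrite trmx_mul diag2_tr map_trmx.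
Qed.

(** Inverting [P N Q = N^T] gives [Q^-1 M P^-1 = M^T]. This removes denominators: [M] has entries in
    [F], its inverse [N] in [A]. *)
Lemma tr_equiv_inv (M : 'M[F]_2) (N : 'M[A]_2) : M *m fr N = 1%:M -> fr N *m M = 1%:M ->
  mx_equiv N N^T -> tr_equiv_at M.
Proof.
move=> MN NM [P [Q e]]; exists (gl_inv Q), (gl_inv P) => /=.
set X := _ *m fr _; have XN : X *m (fr N)^T = 1%:M.
  rewrite map_trmx -e !map_mxM /X !mulmxA -(mulmxA _ _ (fr P)) -map_mxM gl_Vmx map_mx1 mulmx1.
  by rewrite -(mulmxA _ M) MN mulmx1 -map_mxM gl_Vmx map_mx1.
have NMt : (fr N)^T *m M^T = 1%:M by rewrite -trmx_mul MN trmx1.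
by rewrite -[X]mulmx1 -NMt mulmxA XN mul1mx.
Qed.

(** Inversion reverses the order of the factors and leads to [diag(f', 1) k^-1 diag(f, 1)]; so it is
    [f'] that is assumed to be a nonzerodivisor. *)
Lemma tr_equiv_diag_mul_diag (k : GL2 A) (eps f f' : A) (y y' : F) q :
  eps ^+ q = 0 -> maximal_gen eps f -> maximal_gen eps f' ->
  nonzerodivisor f' -> phi f * y = 1 -> phi f' * y' = 1 ->
  tr_equiv_at (diag2 y 1 *m fr (gl_mx k) *m diag2 y' 1).
Proof.
move=> epsq hf hf' nf' fy fy'.
apply: (tr_equiv_inv (N := diag2 f' 1 *m gl_inv_mx k *m diag2 f 1)).
- rewrite !map_mxM !map_diag2 rmorph1 !mulmxA -(mulmxA _ (diag2 y' 1)) mul_diag2.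
  rewrite mulrC fy' mulr1 diag2_11 mulmx1 -(mulmxA _ (fr (gl_mx k))) -map_mxM gl_mxV map_mx1 mulmx1.
  by rewrite mul_diag2 mulrC fy mulr1 diag2_11.
- rewrite !map_mxM !map_diag2 rmorph1 !mulmxA -(mulmxA _ (diag2 (phi f) 1)) mul_diag2.
  rewrite fy mulr1 diag2_11 mulmx1 -(mulmxA _ (fr (gl_inv_mx k))) -map_mxM gl_Vmx map_mx1 mulmx1.
  by rewrite mul_diag2 fy' mulr1 diag2_11.
exact: (diag_mul_diag_equiv_tr epsq (gl_inv k) hf' hf nf').
Qed.

Lemma inv_morph_mul (f z : A) (y : F) : y * phi f = 1 -> y * phi (f * z) = phi z.
Proof. by move=> e; rewrite rmorphM mulrA e mul1r. Qed.

End PlaceTransposition.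

Section SimpleDivisors.
Variables (Cbar C : scheme) (i : morphism Cbar C) (n : nat).
Hypothesis i_closed : closed_immersion i.
Hypothesis i_surj : forall y, exists x, i x = y.
Hypothesis Cbar_nontrivial : forall (W : opens Cbar) x, pts W x -> (1 : sect W) <> 0.
Hypothesis C_special : special C n.
Implicit Types (p : closedPoint C) (c : simpleDivisor i).

(** [eps] is chosen before the divisor: two divisors through the same point share it, as the
    comparison of their local equations requires. *)
Lemma local_generators p : exists eps : stalk (sval p), eps ^+ n = 0 /\
  forall c, sval p = i (sd_point c) -> forall a : stalk (sval p),
    cd_stalk c (sval p) = [set b * a | b in setT] ->
    [/\ is_ideal (@nonunits (stalk (sval p))), nonunits a, nonunits eps &
        forall x : stalk (sval p), nonunits x -> exists b d, x = a * b + eps * d].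
Proof.
move: (sval p) => y; have [x <-] := i_surj y.
have [eps [en ker]] := comor_stalk_ker i_closed i_surj Cbar_nontrivial C_special x.
have [i_inj _ _] := i_closed.
exists eps; split=> // c /i_inj ex a ha.
have hB : intersection_stalk i c x = @nonunits (stalk x) by rewrite ex; exact: sd_reduced.
exact: (simple_local_equation i_closed Cbar_nontrivial hB ha en ker).
Qed.

Lemma divisor_idele_integral c (f : idele C) : divisor_idele c f -> integral_adele (ru_val f).
Proof.
move=> hf p; have [h1 h2] := hf p.
have [e|ne] := pselect (sval p = i (sd_point c)).
  by have [a [_ ->]] := h1 e; exists (to_completion _ a).
by rewrite (h2 ne); exact: Defs.integral1.
Qed.

Lemma ru_inv_at (f : idele C) p : ru_inv f p * ru_val f p = 1.
Proof. exact (congr1 (adele_at p) (ru_invK f)). Qed.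

Lemma ru_val_at (f : idele C) p : ru_val f p * ru_inv f p = 1.
Proof. exact (congr1 (adele_at p) (ru_valK f)). Qed.

Lemma finite_points_over (y : C) : finite_set [set p : closedPoint C | sval p = y].
Proof.
have [[p0 e0]|h] := pselect (exists p0 : closedPoint C, sval p0 = y).
  apply: (@sub_finite_set _ _ [set p0]); last exact: finite_set1.
  by case: p0 e0 => y0 h0 /= e0 [y1 h1] /= e1; apply: eq_exist; rewrite e1 e0.
apply: sub_finite_set (@finite_set0 (closedPoint C)) => p e; apply: h.
by exists p.
Qed.

Lemma divisor_idele_inv_bounded c (f : idele C) : divisor_idele c f -> bounded_adele (ru_inv f).
Proof.
move=> hf k fk.
(* At the point of the divisor, [n] further steps of the filtration pay for the division by the
   local equation. *)
pose k' (p : closedPoint C) := (k p + if `[< sval p = i (sd_point c) >] then n else 0)%N.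
exists k'.
  apply: finsuppD => //; apply: sub_finite_set (finite_points_over (i (sd_point c))).
  by move=> p /=; case: asboolP.
move=> b hb p; have [h1 h2] := hf p; have [x hx ex] := hb p.
have [e|ne] := pselect (sval p = i (sd_point c)).
  have [a [ha fa]] := h1 e; have [eps [en gen]] := local_generators p.
  have [m_ideal ma meps m_gen] := gen c e a ha.
  have hx' : completion_ker (k p + n) x by move: hx; rewrite /k' asboolT.
  have [y hy exy] := completion_ker_divf en m_gen hx'.
  have fy : ru_inv f p * to_frac (to_completion _ a) = 1 by rewrite -fa; exact (ru_inv_at f p).
  exists y; first exact hy.
  rewrite adele_mul ex exy.
  exact (@inv_morph_mul (local_ring p) (local_frac p) (@to_frac _) _ y _ fy).
exists x; first by move: hx; rewrite /k' asboolF // addn0.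
have fy : ru_inv f p = 1 by rewrite -(ru_inv_at f p) (h2 ne) mulr1.
rewrite adele_mul ex fy; exact (mul1r _).
Qed.

Lemma diag2_in (S : set (adele C)) (a b : adele C) : S 0 -> S a -> S b -> mx_in S (diag2 a b).
Proof. by move=> S0 Sa Sb r s; rewrite mxE; case: (r == s); case: (r == ord0). Qed.

Lemma divisor_idele_tame c (f : idele C) : divisor_idele c f ->
  @tame (GL2A C) (@gl_mul (adele C)) (gl_diagV f) /\
  @tame (GL2A C) (@gl_mul (adele C)) (gl_inv (gl_diagV f)).
Proof.
move=> hf.
have b0 : bounded_adele (0 : adele C) by apply: integral_bounded; exact: integral_adele0.
have b1 : bounded_adele (1 : adele C) by apply: integral_bounded; exact: integral_adele1.
have bv : bounded_adele (ru_val f).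
  by apply: integral_bounded; exact: divisor_idele_integral hf.
have bi := divisor_idele_inv_bounded hf.
have m1 := diag2_in b0 bi b1; have m2 := diag2_in b0 bv b1.
split; first exact (@bounded_tame C (gl_diagV f) m1 m2).
exact (@bounded_tame C (gl_inv (gl_diagV f)) m2 m1).
Qed.

(** Where one of the divisors has no support, its diagonal factor is the identity and the
    transposition is immediate; the local algebra is used at a common point of support. *)
Lemma divisor_idele_tr_at c c' (f f' : idele C) (k : GL2A C) p :
  divisor_idele c f -> divisor_idele c' f' -> GL2O k ->
  tr_equiv_at (@to_frac (local_ring p))
    (map_mx (adele_at p) (gl_mx (gl_mul (gl_mul (gl_diagV f) k) (gl_diagV f')))).
Proof.
move=> hf hf' Kk; have [x [ex _]] := GL2O_at p Kk.
have -> : map_mx (adele_at p) (gl_mx (gl_mul (gl_mul (gl_diagV f) k) (gl_diagV f'))) =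
    diag2 (ru_inv f p) 1 *m map_mx (@to_frac (local_ring p)) (gl_mx x) *m diag2 (ru_inv f' p) 1.
  by rewrite /= !map_mxM !map_diag2 ex.
have [h1 h2] := hf p; have [h1' h2'] := hf' p.
have [e|ne] := pselect (sval p = i (sd_point c)); last first.
  have := ru_inv_at f p; rewrite (h2 ne) mulr1 => ->.
  rewrite diag2_11 mul1mx; exact: tr_equiv_mul_diag.
have [e'|ne'] := pselect (sval p = i (sd_point c')); last first.
  have := ru_inv_at f' p; rewrite (h2' ne') mulr1 => ->.
  rewrite diag2_11 mulmx1; exact: tr_equiv_diag_mul.
have [a [ha fa]] := h1 e; have [a' [ha' fa']] := h1' e'.
have [eps [en gen]] := local_generators p.
have [m_ideal ma meps m_gen] := gen c e a ha.
have [_ ma' _ m_gen'] := gen c' e' a' ha'.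
have fy' : to_frac (to_completion _ a') * ru_inv f' p = 1 by rewrite -fa'; exact (ru_val_at f' p).
have fy : to_frac (to_completion _ a) * ru_inv f p = 1 by rewrite -fa; exact (ru_val_at f p).
apply: (@tr_equiv_diag_mul_diag (local_ring p) (local_frac p) (@to_frac (local_ring p)) x
  (to_completion _ eps) (to_completion _ a) (to_completion _ a') _ _ n).
- exact: completion_epsX.
- exact: completion_maximal_gen.
- exact: completion_maximal_gen.
- exact (nonzerodivisor_to_frac fy').
- exact fy.
- exact fy'.
Qed.

(** The local equivalences are chosen independently at all places and glued by [GL2O_of_places]. *)
Lemma divisor_idele_tr c c' (f f' : idele C) (k : GL2A C) :
  divisor_idele c f -> divisor_idele c' f' -> GL2O k ->
  exists u v : GL2A C, [/\ GL2O u, GL2O v &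
    gl_tr (gl_mul (gl_mul (gl_diagV f) k) (gl_diagV f')) =
    gl_mul (gl_mul u (gl_mul (gl_mul (gl_diagV f) k) (gl_diagV f'))) v].
Proof.
move=> hf hf' Kk; set M := gl_mul (gl_mul _ k) _.
have P0 p : {P | exists Q : GL2 (local_ring p),
    map_mx (@to_frac _) (gl_mx P) *m map_mx (adele_at p) (gl_mx M) *m
    map_mx (@to_frac _) (gl_mx Q) = (map_mx (adele_at p) (gl_mx M))^T}.
  by apply: cid; exact: divisor_idele_tr_at.
have Q0 p := cid (svalP (P0 p)).
have [u [Ku eu]] := GL2O_of_places (fun p => sval (P0 p)).
have [v [Kv ev]] := GL2O_of_places (fun p => sval (Q0 p)).
exists u, v; split=> //; apply: gl_eq; apply: adele_mxP => p.
apply: etrans (esym (map_mxM2 (adele_at p) (gl_mx u) (gl_mx M) (gl_mx v))).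
apply: (etrans (esym (map_trmx (adele_at p) (gl_mx M)))).
rewrite (eu p) (ev p); exact (esym (svalP (Q0 p))).
Qed.

End SimpleDivisors.

Section HeckeMeasures.
Variables (C : scheme) (R : realType).

Lemma characteristic_measureE (g : GL2A C) (mu : {measure set (borelGL2A C) -> \bar R}) :
  characteristic_measure g mu ->
  @characteristic R (GL2A C) (@gl_mul (adele C)) (@GL2O C) g mu.
Proof. by move=> [[h1 h2 _ h4] h5 h6]. Qed.

End HeckeMeasures.

Theorem theoremB (R : realType) (k : finFieldType) (Cbar : kscheme k) (C : scheme)
    (i : morphism Cbar C) (n : nat)
    (hCbar : smooth_proper_curve Cbar) (hC : nilpotent_extension i)
    (hn : special C n) (c c' : simpleDivisor i)
    (h h' : {measure set (borelGL2A C) -> \bar R})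
    (hc : divisor_measure c h) (hc' : divisor_measure c' h') :
  forall E : set (borelGL2A C), measurable E ->
    convolution h h' E = convolution h' h E.
Proof.
have [_ i_closed i_surj _] := hC; have [[_ Cbar_int] _ _] := hCbar.
(* Nonzero rings of sections make the stalks of [Cbar] nonzero, so that germs pulling back to [0] or
   to nilpotents are not units. *)
have Cbar_nontrivial (W : opens Cbar) x : pts W x -> (1 : sect W) <> 0.
  by move=> Wx; have [] := Cbar_int W (ex_intro _ x Wx).
have [f hf hm] := hc; have [f' hf' hm'] := hc'.
have [t tV] := divisor_idele_tame i_closed i_surj Cbar_nontrivial hn hf.
have [t' tV'] := divisor_idele_tame i_closed i_surj Cbar_nontrivial hn hf'.
move=> E mE.
apply: (@convolution_comm R (GL2A C) (@gl_mul (adele C)) (gl_one (adele C)) (@gl_inv (adele C))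
  (@gl_mulA _) (@gl_mul1g _) (@gl_mulVg _) (@GL2O C) (level C) (@congruence C)
  (@GL2O_subgroup C) (@congruence_subgroup C) (@congruence_sub C) _ (@GL2O_open C)
  (@congruence_open C) (@congruence_base C) (@GL2O_tame C) (@gl_tr (adele C))
  (gl_diagV f) (gl_diagV f') h h' t tV t' tV') => //.
- by move=> l v x; exact: congruence_normal.
- exact: characteristic_measureE.
- exact: characteristic_measureE.
- exact: gl_trK.
- exact: gl_trM.
- exact: GL2O_tr.
- by apply: gl_eq; exact: diag2_tr.
- by apply: gl_eq; exact: diag2_tr.
- by move=> x Kx; exact: (divisor_idele_tr i_closed i_surj Cbar_nontrivial hn hf hf').
Qed.
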